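(* There is a nonempty Zariski open subset $U$ of the projective space $\mathbb{P}^{14}$ of plane quartics such that for every $f\in U$: the curve $f=0$ has exactly $28$ bitangent lines, and the White--Miller quartic $\mathrm{WM}_f$ has $28$ distinct singular points corresponding to these bitangents, namely the points $[Q_{l,f}]$ where $l$ runs over the $28$ bitangents of $f$.
   Context: Let $V$ be the 3-dimensional complex vector space with basis $x_0,x_1,x_2$, and let $y_0,y_1,y_2$ be the dual basis of $V^\vee$. Elements of $S^4V$ are quartic forms in $x_0,x_1,x_2$, i.e. (up to scalar) plane quartics; elements of $S^dV^\vee$ are forms of degree $d$ in $y_0,y_1,y_2$, i.e. curves in the dual plane, whose points are the lines $l=\sum y_ix_i=0$. The cubic invariant $A(f,g,h)$ is the symmetric trilinear form on $S^4V$ determined by $A(a^4,b^4,c^4)=\det(a,b,c)^4$ for linear forms $a=\sum a_ix_i$, $b=\sum b_ix_i$, $c=\sum c_ix_i$, where $\det(a,b,c)$ is the $3\times3$ determinant of the coefficients. For $f=\sum_{i+j+k=4}\frac{4!}{i!j!k!}f_{ijk}x_0^ix_1^jx_2^k$ let $\overline f=(f_{ijk})\in\mathbb{C}^{15}$ (column vector). For $g\in S^4V$ let $L_g$ be the symmetric $15\times15$ matrix, linear in $g$, with $A(f,g,h)=\overline f^{\,t}L_g\overline h$ for all $f,h\in S^4V$. For fixed $f,g$, $A(f,g,* )$ denotes the quartic form $H\in S^4V^\vee$ whose value at $y$ is $A(f,g,l^4)$ with $l=\sum y_ix_i$. For $f\in S^4V$, the White--Miller quartic $\mathrm{WM}_f$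 is the quartic form on the 6-dimensional space $S^2V^\vee$ (equivalently, a quartic hypersurface in the $\mathbb{P}^5$ of conics in the dual plane) given by the $16\times 16$ bordered determinant $$\mathrm{WM}_f(q)=\det\begin{pmatrix}L_f&\overline{q^2}\\ \overline{q^2}^{\,t}&0\end{pmatrix},\qquad q\in S^2V^\vee,$$ where $\overline{q^2}\in\mathbb{C}^{15}$ is the column vector of coefficients of the monomials $y_0^iy_1^jy_2^k$ in $q^2$ (with the exponents $(i,j,k)$, $i+j+k=4$, in the same ordering as the one used for the entries $f_{ijk}$ of the column vector $\overline f$). A singular point of $\mathrm{WM}_f$ is a point of $\mathbb{P}^5$ at which all six partial derivatives of $\mathrm{WM}_f$ vanish. If $l$ is a bitangent to $f$ with tangency points $p=(p_0,p_1,p_2)$ and $p'=(p'_0,p'_1,p'_2)$, then $Q_{l,f}\in S^2V^\vee$ is the reducible conic $(\sum p_iy_i)(\sum p_i'y_i)$ in the dual plane (the union of the two pencils of lines through $p$ and through $p'$), defined up to scalar; equivalently, up to scalar, $Q_{l,f}^2=A(f,l^4,* )$. *)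

(* Defs.v *)
From mathcomp Require Import all_boot all_algebra.
From mathcomp Require Import mpoly ring.

Set Implicit Arguments.
Unset Strict Implicit.
Unset Printing Implicit Defensive.

Import GRing.Theory Num.Theory.
Local Open Scope ring_scope.

(* S^d V and S^d V^vee are both modelled by the forms of degree d in          *)
(* {mpoly C[3]}; 'X_i is read as x_i in the first case, as y_i in the second. *)
(* Points of the plane (coordinates p_i) and of the dual plane (lines         *)
(* l = sum y_i x_i, coordinates y_i) are non-zero vectors of 'rV[C]_3 up to   *)
(* scalar.                                                                    *)

Definition proj_eq (C : fieldType) (V : lmodType C) (u v : V) : Prop :=
  exists2 c : C, c != 0 & v = c *: u.

Definition exactly_proj (C : fieldType) (V : lmodType C) (n : nat)
    (P : V -> Prop) : Prop :=
  exists s : 'I_n -> V,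
    [/\ forall i, P (s i),
        forall i j, proj_eq (s i) (s j) -> i = j &
        forall v, P v -> exists i, proj_eq (s i) v].

Section Exponents.

Definition mnm3 (i j k : nat) : 'X_{1..3} :=
  [multinom nth 0%N [:: i; j; k] s | s < 3].

Definition exps (d : nat) : seq 'X_{1..3} :=
  [seq mnm3 i j (d - i - j) | i <- iota 0 d.+1, j <- iota 0 (d - i).+1].

Definition exp4 (k : 'I_15) : 'X_{1..3} := nth 0%MM (exps 4) k.
Definition exp2 (k : 'I_6) : 'X_{1..3} := nth 0%MM (exps 2) k.

Lemma mem_exps d m : (m \in exps d) = (mdeg m == d).
Proof.
pose o k : 'I_3 := inord k.
have mE : m = mnm3 (m (o 0)) (m (o 1)) (m (o 2)).
  apply/mnmP=> i; rewrite mnmE; case: i => [[|[|[|i]]] hi] //=;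
  by congr (m _); apply/val_inj; rewrite /= inordK.
have dE : mdeg m = (m (o 0) + m (o 1) + m (o 2))%N.
  rewrite mdegE !big_ord_recr big_ord0 /= add0n.
  by congr (m _ + m _ + m _)%N; apply/val_inj; rewrite /= inordK.
apply/allpairsPdep/eqP => [[i [j [hi hj ->]]]|hd].
  move: hi hj; rewrite !mem_iota !add0n /= !ltnS => hi hj.
  rewrite mdegE !big_ord_recr big_ord0 /= add0n !mnmE /=.
  by rewrite -addnA subnKC // subnKC.
exists (m (o 0)), (m (o 1)); rewrite !mem_iota /= !add0n !ltnS -hd dE.
split; first by rewrite -addnA leq_addr.
  by rewrite -addnA addKn leq_addr.
by rewrite -addnA addKn addKn.
Qed.

Lemma size_exps4 : size (exps 4) = 15. Proof. by []. Qed.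
Lemma size_exps2 : size (exps 2) = 6. Proof. by []. Qed.

Lemma uniq_exps d : uniq (exps d).
Proof.
rewrite allpairs_uniq_dep ?iota_uniq // => [i _|]; first exact: iota_uniq.
move=> [i j] [i' j'] _ _ /= /mnmP h.
move: (h 0) (h 1); rewrite !mnmE /= => -> ->.
by [].
Qed.

Lemma big_exp4 (C : nmodType) (F : 'X_{1..3} -> C) :
  \sum_(m <- exps 4) F m = \sum_(k < 15) F (exp4 k).
Proof. by rewrite (big_nth 0%MM) size_exps4 big_mkord. Qed.

Lemma big_exp2 (C : nmodType) (F : 'X_{1..3} -> C) :
  \sum_(m <- exps 2) F m = \sum_(k < 6) F (exp2 k).
Proof. by rewrite (big_nth 0%MM) size_exps2 big_mkord. Qed.

Lemma mpoly_exps (R : nzRingType) d (p : {mpoly R[3]}) :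
  p \is d.-homog -> p = \sum_(m <- exps d) p@_m *: 'X_[m].
Proof.
move=> hp; rewrite {1}[p]mpolyE; apply/mpolyP => m.
rewrite !raddf_sum /=.
have E (s : seq 'X_{1..3}) : uniq s ->
    \sum_(i <- s) (p@_i *: 'X_[i])@_m = if m \in s then p@_m else 0.
  move=> us; case: ifP => ms; last first.
    rewrite big_seq big1 // => i si; rewrite mcoeffZ mcoeffX.
    by case: eqP => [ei|]; rewrite ?mulr0 //; rewrite ei ms in si.
  rewrite (bigD1_seq m) //= mcoeffZ mcoeffX eqxx mulr1 big1 ?addr0 // => i.
  by rewrite mcoeffZ mcoeffX => /negbTE ->; rewrite mulr0.
rewrite !E ?uniq_exps ?msupp_uniq // mem_exps.
case: ifP => [/(dhomogP _ _ _ hp)->|/negbT]; first by rewrite eqxx.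
by move/memN_msupp_eq0 ->; case: ifP.
Qed.

End Exponents.

Section Quartics.
Variable C : fieldType.
Implicit Types (f g h q : {mpoly C[3]}) (l p x r : 'rV[C]_3).

Definition linform l : {mpoly C[3]} := \sum_i l 0 i *: 'X_i.

Definition quartic f : Prop := f \is 4.-homog /\ f != 0.

(* The entries f_ijk, where f = sum 4!/(i!j!k!) f_ijk x_0^i x_1^j x_2^k. *)
Definition bar f : 'cV[C]_15 :=
  \col_k (f@_(exp4 k) * (\prod_i (exp4 k i)`!)%:R / 4`!%:R).

(* A subset of the projective space of plane quartics is given by the set of  *)
(* all non-zero forms representing its points; the homogeneous coordinates    *)
(* are the f_ijk.                                                             *)
Definition zariski_open (U : {mpoly C[3]} -> Prop) : Prop :=
  exists S : {mpoly C[15]} -> Prop,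
    (forall P, S P -> exists d, P \is d.-homog) /\
    (forall f, U f <->
       quartic f /\ exists2 P, S P & P.@[fun k => bar f k 0] != 0).

(* det(a,b,c)^4, with a, b and c as the outermost, middle and innermost       *)
(* variables.                                                                 *)
Definition det4 : {mpoly {mpoly {mpoly C[3]}[3]}[3]} :=
  (\det (\matrix_(s < 3, i < 3)
      nth 0 [:: 'X_i; ('X_i)%:MP_[3]; (('X_i)%:MP_[3])%:MP_[3]] s)) ^+ 4.

Definition Acoef (i j k : 'I_15) : C :=
  (((det4@_(exp4 i))@_(exp4 j))@_(exp4 k)).

(* For f = a^4 the coefficient f_ijk is a_0^i a_1^j a_2^k, so this is the     *)
(* trilinear extension of det(a,b,c)^4; see cubicA_pow4.                      *)
Definition cubicA f g h : C :=
  \sum_i \sum_j \sum_k Acoef i j k * bar f i 0 * bar g j 0 * bar h k 0.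

Definition Lmx g : 'M[C]_15 :=
  \matrix_(i, k) \sum_j Acoef i j k * bar g j 0.

Lemma cubicA_Lmx f g h : cubicA f g h = ((bar f)^T *m Lmx g *m bar h) 0 0.
Proof.
rewrite /cubicA mxE.
under [RHS]eq_bigr => k _ do rewrite mxE big_distrl /=.
rewrite [RHS]exchange_big /=; apply: eq_bigr => i _.
rewrite exchange_big /=; apply: eq_bigr => k _.
rewrite [_^T _ _]mxE [Lmx _ _ _]mxE big_distrr /= big_distrl /=.
by apply: eq_bigr => j _; rewrite !mulrA [bar f i 0 * _]mulrC.
Qed.

Definition quartic_coefs (R : nzRingType) (p : {mpoly R[3]}) : 'cV[R]_15 :=
  \col_k p@_(exp4 k).

Definition generic_conic : {mpoly {mpoly C[6]}[3]} :=
  \sum_(k < 6) 'X_k *: 'X_[exp2 k].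

(* WM_f as a polynomial in the six coefficients of q; see WM_eval. *)
Definition WM f : {mpoly C[6]} :=
  let v := quartic_coefs (generic_conic ^+ 2) in
  \det (block_mx (map_mx (@mpolyC 6 C) (Lmx f)) v v^T (0 : 'M_1)).

Definition conic_coefs q : 'I_6 -> C := fun k => q@_(exp2 k).

Definition singular_point n (F : {mpoly C[n]}) (v : 'I_n -> C) : Prop :=
  (exists i, v i != 0) /\ forall i, (F^`M(i)).@[v] = 0.

Lemma WM_eval f q : q \is 2.-homog ->
  (WM f).@[conic_coefs q] =
  \det (block_mx (Lmx f) (quartic_coefs (q ^+ 2)) (quartic_coefs (q ^+ 2))^T
                 (0 : 'M_1)).
Proof.
move=> hq; rewrite /WM -det_map_mx map_block_mx map_mx0 -map_mx_comp -map_trmx.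
have -> : map_mx (meval (conic_coefs q) \o @mpolyC 6 C) (Lmx f) = Lmx f.
  by apply/matrixP=> i j; rewrite !mxE /= mevalC.
suff -> : map_mx (meval (conic_coefs q)) (quartic_coefs (generic_conic ^+ 2))
  = quartic_coefs (q ^+ 2) by [].
apply/matrixP=> i j; rewrite !mxE -mcoeff_map_mpoly rmorphXn /=.
congr ((_ ^+ 2)@_ _); rewrite raddf_sum [RHS](mpoly_exps hq) big_exp2.
apply: eq_bigr => k _; apply/mpolyP => m.
rewrite mcoeff_map_mpoly !mcoeffZ !mcoeffX mulr_natr raddfMn /= mevalXU.
by rewrite mulr_natr.
Qed.

(* The restriction t |-> f(x + t r) of f to the line through x and r. *)
Definition restr f x r : {poly C} :=
  mmap polyC (fun i => (x 0 i)%:P + r 0 i *: 'X) f.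

(* The line l meets f = 0 in the divisor 2p + 2p': at each point x of l, the  *)
(* order of vanishing of f along l (computed with any second point r of l) is *)
(* the multiplicity of x in 2p + 2p'. Hyperflexes (p = p') are allowed. As    *)
(* mup is 0 on the zero polynomial, l is not a component of f = 0.            *)
Definition bitangent_at f l p p' : Prop :=
  [/\ l != 0, p != 0, p' != 0,
      (linform l).@[p 0] = 0 /\ (linform l).@[p' 0] = 0 &
      forall x r, row_free (col_mx x r) ->
        (linform l).@[x 0] = 0 -> (linform l).@[r 0] = 0 ->
        mup 0 (restr f x r) = (2 * (x == p)%MS + 2 * (x == p')%MS)%N].

Definition bitangent f l : Prop := exists p p', bitangent_at f l p p'.

(* q is a representative of Q_{l,f}. *)
Definition bitangent_conic f l q : Prop :=
  exists p p', bitangent_at f l p p' /\ q = linform p * linform p'.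

End Quartics.

Section CubicInvariant.

Definition graded (R : comNzRingType) (T : nat -> R -> Prop) : Prop :=
  [/\ forall n, T n 0, forall n x y, T n x -> T n y -> T n (x + y),
      forall n x, T n x -> T n (- x) &
      forall n m x y, T n x -> T m y -> T (n + m)%N (x * y)].

Definition homlift (R : comNzRingType) (T : nat -> R -> Prop) n
    (p : {mpoly R[3]}) : Prop :=
  p \is n.-homog /\ forall m, T n p@_m.

Lemma homlift_graded (R : comNzRingType) (T : nat -> R -> Prop) :
  graded T -> graded (homlift T).
Proof.
move=> [T0 TD TN TM]; split=> [n|n p q [hp cp] [hq cq]|n p [hp cp]|
  n k p q [hp cp] [hq cq]].
- by split=> [|m]; [exact: dhomog0 | rewrite mcoeff0].
- by split=> [|m]; [exact: dhomogD | rewrite mcoeffD; exact: TD].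
- by split=> [|m]; [rewrite dhomogN | rewrite mcoeffN; exact: TN].
split=> [|m]; first exact: dhomogM.
rewrite mcoeffM; elim/big_ind: _ => // [x y|i _]; first exact: TD.
exact: TM.
Qed.

Lemma homlift_var (R : comNzRingType) (T : nat -> R -> Prop) (y : R) i :
  graded T -> T 1%N y -> homlift T 1%N (y *: 'X_i).
Proof.
move=> [T0 _ _ _] Ty; split=> [|m].
  by apply: dhomogZ; rewrite dhomogX; apply/eqP; exact: mdeg1.
by rewrite mcoeffZ mcoeffX; case: eqP; rewrite ?mulr1 ?mulr0.
Qed.

Lemma homlift_eval (R : comNzRingType) (T : nat -> R -> Prop) p (a : 'I_3 -> R) :
  homlift T 4 p -> p.@[a] = \sum_k p@_(exp4 k) * \prod_i a i ^+ exp4 k i.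
Proof.
move=> [hp _]; rewrite {1}(mpoly_exps hp) raddf_sum big_exp4 /=.
by apply: eq_bigr => k _; rewrite mevalZ mevalX.
Qed.

Lemma meval_sumM (R : comNzRingType) (v : 'I_3 -> R) (F G : 'I_15 -> {mpoly R[3]}) :
  (\sum_k F k * G k).@[v] = \sum_k (F k).@[v] * (G k).@[v].
Proof.
by rewrite rmorph_sum; apply: eq_bigr => k _; rewrite rmorphM.
Qed.

Lemma prodC (R : comNzRingType) (x : 'I_3 -> R) m :
  \prod_i ((x i)%:MP_[3]) ^+ m i = (\prod_i x i ^+ m i)%:MP_[3].
Proof. by rewrite rmorph_prod; apply: eq_bigr => s _; rewrite rmorphXn. Qed.

Lemma detE (R : comNzRingType) (M : 'M[R]_3) (o := fun k => inord k : 'I_3) :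
  \det M =
    M (o 0) (o 0) * M (o 1) (o 1) * M (o 2) (o 2)
  - M (o 0) (o 0) * M (o 1) (o 2) * M (o 2) (o 1)
  - M (o 0) (o 1) * M (o 1) (o 0) * M (o 2) (o 2)
  + M (o 0) (o 1) * M (o 1) (o 2) * M (o 2) (o 0)
  + M (o 0) (o 2) * M (o 1) (o 0) * M (o 2) (o 1)
  - M (o 0) (o 2) * M (o 1) (o 1) * M (o 2) (o 0).
Proof.
pose N i j := M (o i) (o j).
have -> : \det M = \det (\matrix_(i, j) N i j : 'M_3).
  by congr (\det _); apply/matrixP=> i j; rewrite mxE /N /o !inord_val.
rewrite (expand_det_row _ ord0) !big_ord_recr big_ord0 /= /cofactor.
rewrite !(expand_det_row _ ord0) !big_ord_recr !big_ord0 /= /cofactor !det_mx11.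
rewrite !mxE /= /bump /= ?addn0 ?add1n ?addn1 /= ?expr0 ?expr1 /N.
ring.
Qed.

Definition exp4_triples : seq (nat * nat * nat) :=
  [seq (i, j, 4 - i - j)%N | i <- iota 0 5, j <- iota 0 (4 - i).+1].

Lemma exps4E : exps 4 = [seq mnm3 t.1.1 t.1.2 t.2 | t <- exp4_triples].
Proof. by []. Qed.

Lemma trinomial (R : comNzRingType) (x y z : R) :
  (x + y + z) ^+ 4 = \sum_(t <- exp4_triples)
    x ^+ t.1.1 * y ^+ t.1.2 * z ^+ t.2
      *+ (4`! %/ (t.1.1`! * t.1.2`! * t.2`!)).
Proof.
rewrite /exp4_triples /= !big_cons big_nil /=.
repeat match goal with |- context [(?m %/ ?n)%N] =>
  let v := eval vm_compute in (m %/ n)%N in change (m %/ n)%N with v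
end.
ring.
Qed.

Lemma prod_mnm3 (R : pzSemiRingType) (F : 'I_3 -> nat -> R) i j k :
  \prod_s F s (mnm3 i j k s) = F (inord 0) i * F (inord 1) j * F (inord 2) k.
Proof.
rewrite !big_ord_recr big_ord0 /= mul1r !mnmE /=.
by congr (F _ _ * F _ _ * F _ _); apply/val_inj; rewrite /= inordK.
Qed.

Lemma pow4E (R : comNzRingType) (a : 'I_3 -> R) k :
  ((\sum_i a i *: 'X_i : {mpoly R[3]}) ^+ 4)@_(exp4 k) *
    (\prod_i (exp4 k i)`!)%:R = 4`!%:R * \prod_i a i ^+ exp4 k i.
Proof.
pose o k : 'I_3 := inord k.
have -> : \sum_i a i *: 'X_i =
    a (o 0) *: 'X_(o 0) + a (o 1) *: 'X_(o 1) + a (o 2) *: 'X_(o 2)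
    :> {mpoly R[3]}.
  rewrite !big_ord_recr big_ord0 /= add0r.
  by congr (a _ *: 'X_ _ + a _ *: 'X_ _ + a _ *: 'X_ _);
    apply/val_inj; rewrite /= inordK.
rewrite trinomial.
have kin : exp4 k \in exps 4 by rewrite mem_nth ?size_exps4.
move: (exp4 k) kin => m; rewrite exps4E => /mapP[t tin ->].
pose G t := mnm3 t.1.1 t.1.2 t.2.
have termE (u : nat * nat * nat) :
  (a (o 0) *: 'X_(o 0)) ^+ u.1.1 * (a (o 1) *: 'X_(o 1)) ^+ u.1.2
    * (a (o 2) *: 'X_(o 2)) ^+ u.2
  = (a (o 0) ^+ u.1.1 * a (o 1) ^+ u.1.2 * a (o 2) ^+ u.2) *: 'X_[G u]
  :> {mpoly R[3]}.
  have /= E := prod_mnm3 (fun i n => ('X_i : {mpoly R[3]}) ^+ n) u.1.1 u.1.2 u.2.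
  rewrite (mpolyXE_id _ (G u)) E.
  rewrite !exprZn -!scalerAl -!scalerAr -!scalerAl !scalerA.
  by congr (_ *: _); rewrite mulrAC.
rewrite (eq_bigr (fun u =>
  (a (o 0) ^+ u.1.1 * a (o 1) ^+ u.1.2 * a (o 2) ^+ u.2) *: 'X_[G u]
    *+ (4`! %/ (u.1.1`! * u.1.2`! * u.2`!)))); last first.
  by move=> u _; congr (_ *+ _); exact: termE.
have uG : uniq (map G exp4_triples) by rewrite -exps4E uniq_exps.
have Gt u : u != t -> G u != G t.
  apply: contra => /eqP/mnmP e; apply/eqP.
  move: (e 0) (e 1) (e (o 2)); rewrite !mnmE /= inordK //=.
  by case: u t {tin e} => [[? ?] ?] [[? ?] ?] /= -> -> ->.
rewrite raddf_sum (bigD1_seq t) ?(map_uniq uG) //= big1; last first.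
  move=> u ut; rewrite mcoeffMn mcoeffZ mcoeffX.
  by rewrite (negbTE (Gt _ ut)) mulr0 mul0rn.
rewrite addr0 mcoeffMn mcoeffZ mcoeffX eqxx mulr1.
have /= -> := prod_mnm3 (fun i n => a i ^+ n) t.1.1 t.1.2 t.2.
have -> : (\prod_i (G t i)`! = t.1.1`! * t.1.2`! * t.2`!)%N.
  exact: (prod_mnm3 (fun _ n => n`!)).
rewrite mulr_natr -mulrnA mulr_natl; congr (_ *+ _).
apply/eqP; move: t tin {Gt}; apply/allP.
by vm_compute.
Qed.

Lemma bar_linform_pow4 (C : numFieldType) (a : 'rV[C]_3) k :
  bar (linform a ^+ 4) k 0 = \prod_i a 0 i ^+ exp4 k i.
Proof.
have n4 : (4`!%:R : C) != 0 by rewrite pnatr_eq0.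
by rewrite mxE (pow4E (a 0)) mulrAC divff ?mul1r.
Qed.

Lemma cubicA_pow4 (C : numFieldType) (a b c : 'rV[C]_3) :
  cubicA (linform a ^+ 4) (linform b ^+ 4) (linform c ^+ 4) =
  \det (col_mx a (col_mx b c) : 'M_3) ^+ 4.
Proof.
pose T0 (n : nat) (x : C) := True.
have g0 : graded T0 by split.
have g1 := homlift_graded g0; have g2 := homlift_graded g1.
have g3 := homlift_graded g2.
have d1 : homlift (homlift (homlift T0)) 4%N (det4 C).
  have [_ TD TN TM] := g3.
  suff h : homlift (homlift (homlift T0)) 1%N
    (\det (\matrix_(s < 3, i < 3)
      nth 0 [:: 'X_i; ('X_i)%:MP_[3]; (('X_i)%:MP_[3])%:MP_[3]] s)
      : {mpoly {mpoly {mpoly C[3]}[3]}[3]}).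
    rewrite /det4; move: (\det _) h => X h.
    by rewrite !exprS expr0 mulr1; do 3!(apply: (TM 1%N) => //).
  have V i j k : homlift (homlift (homlift T0)) 1%N
      ('X_i * ('X_j)%:MP_[3] * (('X_k)%:MP_[3])%:MP_[3]).
    rewrite -mulrA -mpolyCM mulrC mul_mpolyC; apply: homlift_var => //.
    rewrite mulrC mul_mpolyC; apply: homlift_var => //.
    by rewrite -[X in homlift _ _ X]scale1r; apply: homlift_var.
  rewrite detE !mxE !inordK //=.
  by repeat first [apply: (V) | apply: (TD) | apply: (TN)].
pose ev (p : {mpoly {mpoly {mpoly C[3]}[3]}[3]}) :=
  p.@[fun i => ((a 0 i)%:MP_[3])%:MP_[3]].@[fun i => (b 0 i)%:MP_[3]].@[c 0].
have evl : ev (det4 C) = \det (col_mx a (col_mx b c) : 'M_3) ^+ 4.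
  rewrite /ev /det4 !rmorphXn /= -!det_map_mx; congr (\det _ ^+ 4).
  have E0 : (0 : 'I_3) = @lshift 1 (1 + 1) (0 : 'I_1) by apply/val_inj.
  have E1 : (1 : 'I_3) = @rshift 1 (1 + 1) (@lshift 1 1 (0 : 'I_1)) by apply/val_inj.
  have E2 : inord 2 = @rshift 1 (1 + 1) (@rshift 1 1 (0 : 'I_1)) :> 'I_3.
    by apply/val_inj; rewrite /= inordK.
  apply/matrixP=> s i; rewrite 4!mxE.
  pose M : 'M_3 := col_mx a (col_mx b c); rewrite -/M.
  have M0 : M 0 i = a 0 i by rewrite E0; exact: (col_mxEu a).
  have M1 : M 1 i = b 0 i.
    by rewrite E1; exact: etrans (col_mxEd a _ _ _) (col_mxEu b _ _ _).
  have M2 : M (inord 2) i = c 0 i.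
    by rewrite E2; exact: etrans (col_mxEd a _ _ _) (col_mxEd b _ _ _).
  case: s => [[|[|[|s]]] hs] //=.
  - have -> : Ordinal hs = 0 by exact/val_inj.
    by rewrite M0 mevalXU !mevalC.
  - have -> : Ordinal hs = 1 by exact/val_inj.
    by rewrite M1 mevalC mevalXU mevalC.
  have -> : Ordinal hs = inord 2 by apply/val_inj; rewrite /= inordK.
  by rewrite M2 !mevalC mevalXU.
rewrite -evl /ev (homlift_eval _ d1) !meval_sumM; apply: eq_bigr => i _.
have [_ /(_ (exp4 i)) d2] := d1.
rewrite (homlift_eval _ d2) meval_sumM big_distrl; apply: eq_bigr => j _.
have [_ /(_ (exp4 j)) d3] := d2.
rewrite (homlift_eval _ d3) !big_distrl /=; apply: eq_bigr => k _.
rewrite !bar_linform_pow4 /Acoef !prodC !mevalC; ring.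
Qed.

End CubicInvariant.

(* Main.v *)
(* Away from the pencil of lines through (0 : 0 : 1), a bitangent of f is a
   solution (h, q) of f(1, x, h(x)) = q(x)^2 with h affine and q quadratic: five
   equations in five unknowns, where (h, q) and (h, -q) give the same line. If f
   is smooth, the linearised system is invertible at every zero; if moreover no
   line through (0 : 0 : 1) meets f in a divisor 2p + 2p', zeros cannot escape to
   infinity. Hence the number of zeros is constant along paths of such quartics.
   These quartics contain a Zariski open set, any two of whose points are joined
   by a path, and which contains a Fermat quartic moved to general position;
   there the 56 zeros can be listed.

   If l is a bitangent, the restriction of f to l is a square, so that
   A(f, l^4, m^4) = f(l x m) is a multiple of Q(m)^2 for Q = Q_{l,f}. Thus L_f
   maps the coefficient vector of l^4 to a multiple of that of Q^2. As Q(l) = 0,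
   both Q^2 and its first-order variations Q Q' are orthogonal to l^4, and this
   makes the bordered determinant vanish to second order at Q. Two bitangents
   with the same conic have the same tangency points, hence coincide. *)
Require Import Defs.
From mathcomp Require Import all_boot all_order all_algebra.
From mathcomp Require Import reals complex mpoly ring lra zify.
From mathcomp Require boolp classical_sets topology normedtype derive.

Set Implicit Arguments.
Unset Strict Implicit.
Unset Printing Implicit Defensive.

Import Order.TTheory GRing.Theory Num.Theory.
Local Open Scope ring_scope.

(** No implicit function theorem is used. A zero of a nearby system G is found by minimising |G|^2
    over a small closed ball, and collisions are controlled by a divided difference M with G(z) -
    G(z') = (z - z') M(z,z'). Two distinct zeros make det M(z,z') vanish, while a nondegenerate zero
    makes det M(z,z) nonzero, so having at least k distinct zeros is both open and closed along a
    path. Transporting 56 zeros from the Fermat quartic to f, and hypothetical 57 zeros back from f,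
    gives the exact count. Zeros could escape only if the line tends to one through (0 : 0 : 1).
    Whether the restriction to such a line is a square is decided by two polynomials, found by
    solving f = q^2 for the three coefficients of q and comparing the last two coefficients of f;
    compactness turns their nonvanishing into a uniform bound. The Fermat quartic has to be moved
    because four of its hyperflex tangents pass through (0 : 0 : 1). Openness of the nondegeneracy
    conditions comes from the invertibility of a matrix of coefficients, in place of elimination
    theory. *)

Module Transport.

Import boolp classical_sets topology normedtype derive.
Import numFieldNormedType.Exports.
Local Open Scope classical_set_scope.
Local Open Scope ring_scope.

(** * Continuity and compactness over the reals *)

Lemma continuous_pair (X Y Z : topologicalType) (f : X -> Y) (g : X -> Z) :
  continuous f -> continuous g -> continuous (fun x => (f x, g x)).
Proof. by move=> cf cg x; apply: cvg_pair; [exact: cf | exact: cg]. Qed.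

Lemma continuous_fst (X Y : topologicalType) : continuous (@fst X Y).
Proof. by move=> x; exact: cvg_fst. Qed.

Lemma continuous_snd (X Y : topologicalType) : continuous (@snd X Y).
Proof. by move=> x; exact: cvg_snd. Qed.

Lemma continuous_id (X : topologicalType) : continuous (@id X).
Proof. by move=> x; exact: cvg_id. Qed.

Section RealFunctions.
Variables (R : realType) (X : topologicalType).
Implicit Types f g : X -> R.

Lemma continuous_add f g :
  continuous f -> continuous g -> continuous (fun x => f x + g x).
Proof. by move=> cf cg x; apply: cvgD; [exact: cf | exact: cg]. Qed.

Lemma continuous_opp f : continuous f -> continuous (fun x => - f x).
Proof. by move=> cf x; apply: cvgN; exact: cf. Qed.

Lemma continuous_mul f g :
  continuous f -> continuous g -> continuous (fun x => f x * g x).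
Proof. by move=> cf cg x; apply: cvgM; [exact: cf | exact: cg]. Qed.

Lemma continuous_sum (I : Type) (r : seq I) (P : pred I) (F : I -> X -> R) :
  (forall i, P i -> continuous (F i)) ->
  continuous (fun x => \sum_(i <- r | P i) F i x).
Proof.
move=> cF; elim: r => [|i r IH].
  rewrite (_ : (fun x => _) = fun=> 0); first exact: cst_continuous.
  by apply/funext => x; rewrite big_nil.
have [Pi|/negbTE Pi] := boolP (P i).
  have ci := cF i Pi.
  rewrite (_ : (fun x => _) = fun x => F i x + \sum_(i <- r | P i) F i x).
    exact: continuous_add.
  by apply/funext => x; rewrite big_cons Pi.
rewrite (_ : (fun x => _) = fun x => \sum_(i <- r | P i) F i x) //.
by apply/funext => x; rewrite big_cons Pi.
Qed.

Lemma continuous_norm f : continuous f -> continuous (fun x => `|f x|).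
Proof. by move=> cf x; apply: cvg_norm; exact: cf. Qed.

End RealFunctions.

Lemma near_neq0 (R : realType) (X : topologicalType) (f : X -> R) x :
  continuous f -> f x != 0 -> \forall y \near x, f y != 0.
Proof.
move=> cf fx.
by have := open_comp (fun p _ => cf p) (@open_neq R 0); rewrite openE /=; apply.
Qed.

Lemma near_gt0 (R : realType) (X : topologicalType) (f : X -> R) x :
  continuous f -> 0 < f x -> \forall y \near x, 0 < f y.
Proof.
move=> cf fx.
by have := open_comp (fun p _ => cf p) (@open_gt R 0); rewrite openE /=; apply.
Qed.

Section CompactProjection.
Variables (R : realType) (X Y : topologicalType).

(** The tube lemma. It makes pointwise strict inequalities uniform over spheres, over the path
    parameter and over bounded sets of directions. *)
Lemma near_compact (K : set Y) (x0 : X) (P : X * Y -> Prop) :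
  compact K -> (forall y, K y -> \forall p \near (x0, y), P p) ->
  \forall x \near x0, forall y, K y -> P (x, y).
Proof.
move=> /compact_near_coveringP cK H.
apply: (cK X (nbhs x0) (fun x y => P (x, y))) => y Ky.
have [[A B] /= [A1 B1] AB] := H _ Ky.
by exists (B, A) => //= -[y' x'] [] /= ? ?; exact: AB.
Qed.

Lemma closed_compact_projection (K : set Y) (f : X * Y -> R) :
  compact K -> continuous f -> closed [set x | exists2 y, K y & f (x, y) = 0].
Proof.
move=> cK cf x0 clx; apply: contrapT => nx.
have /(near_compact cK) H : forall y, K y -> \forall p \near (x0, y), f p != 0.
  move=> y Ky.
  have /eqP f0 : f (x0, y) <> 0 by move=> f0; apply: nx; exists y.
  exact: near_neq0.
have [x [[y Ky /eqP fy]]] := clx _ H.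
by move=> /(_ y Ky); rewrite fy.
Qed.

End CompactProjection.

Lemma dist_continuous (R : realType) (V : normedModType R) (z0 : V) :
  continuous (fun z : V => `|z - z0|).
Proof.
move=> z; apply: cvg_norm; apply: cvgB; [exact: cvg_id | exact: cvg_cst].
Qed.

Lemma closed_ball_closed (R : realType) (V : normedModType R) (z0 : V) (r : R) :
  closed [set z : V | `|z - z0| <= r].
Proof.
apply: (@preimage_closed _ _ (fun z : V => `|z - z0|) [set x | x <= r] _ (@closed_le R r)).
by move=> z _; exact: dist_continuous.
Qed.

Lemma compact_rV_ball (R : realType) n (z0 : 'rV[R]_n) (r : R) :
  compact [set z : 'rV[R]_n | `|z - z0| <= r].
Proof.
apply: bounded_closed_compact; last exact: closed_ball_closed.
exists (`|z0| + r); split; first exact: num_real.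
move=> x xr z /= zr; apply: (le_trans _ (ltW xr)).
by rewrite -(subrK z0 z) addrC (le_trans (ler_normD _ _)) // lerD2l.
Qed.

(** * Having k distinct zeros is an open and closed condition on the parameter *)

Section ManySolutions.
Variables (R : realType) (V : normedModType R).
Hypothesis compact_closed_ball : forall (z0 : V) r, compact [set z | `|z - z0| <= r].
(** In the application [rho] is |G|^2 and [delta] is |det M(z,z')|^2 for a divided difference M of
    G. Hence [delta] vanishes at pairs of distinct zeros, is nonzero on the diagonal at a zero, and
    where it is nonzero on the diagonal Newton's step decreases [rho]. *)
Variables (rho : R -> V -> R) (delta : R -> V -> V -> R) (B : R).
Hypothesis rho_cont : continuous (fun p : R * V => rho p.1 p.2).
Hypothesis delta_cont : continuous (fun p : R * (V * V) => delta p.1 p.2.1 p.2.2).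
Hypothesis rho_ge0 : forall s z, 0 <= rho s z.
Hypothesis delta_sol : forall (s : R) z z', 0 <= s <= 1 ->
  rho s z = 0 -> rho s z' = 0 -> z <> z' -> delta s z z' = 0.
Hypothesis delta_diag : forall (s : R) z, 0 <= s <= 1 ->
  rho s z = 0 -> delta s z z <> 0.
Hypothesis rho_not_min : forall s z, rho s z <> 0 -> delta s z z <> 0 ->
  forall e : R, 0 < e -> exists2 z', `|z' - z| < e & rho s z' < rho s z.
Hypothesis sol_bounded : forall (s : R) z, 0 <= s <= 1 -> rho s z = 0 -> `|z| <= B.

Lemma compact_sphere (z0 : V) r : compact [set z | `|z - z0| = r].
Proof.
apply: (subclosed_compact _ (@compact_closed_ball z0 r)); last first.
  by move=> z /= ->.
apply: (@preimage_closed _ _ (fun z : V => `|z - z0|) [set x | x = r] _ (@closed_eq R r)).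
by move=> z _; exact: dist_continuous.
Qed.

(* At an isolated zero rho is larger on a small sphere than at its centre, so
   for nearby parameters its minimum over the ball is attained inside. *)
Lemma local_solution (s0 : R) z0 (e : R) : 0 <= s0 <= 1 -> rho s0 z0 = 0 -> 0 < e ->
  \forall s \near s0, exists2 z, `|z - z0| < e & rho s z = 0.
Proof.
move=> s01 r0 e0.
have /eqP d0 := delta_diag s01 r0.
(* On a small ball [delta] has no zero. This isolates [z0] among the zeros for [s0], and allows a
   descent step at every point of the ball for nearby parameters. *)
have /nbhs_ballP[r /= r_gt0 Hr] :
    \forall p \near (s0, (z0, z0)), delta p.1 p.2.1 p.2.2 != 0.
  exact: (near_neq0 (x := (s0, (z0, z0))) delta_cont).
pose r1 := Num.min r e / 2.
have r1_gt0 : 0 < r1 by rewrite divr_gt0 // lt_min r_gt0.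
have r1r : r1 < r by rewrite ltr_pdivrMr // (le_lt_trans (_ : _ <= r)) ?ge_min ?lexx //; lra.
have r1e : r1 < e by rewrite ltr_pdivrMr // (le_lt_trans (_ : _ <= e)) ?ge_min ?lexx ?orbT //; lra.
have inball z : `|z - z0| <= r1 -> ball z0 r z.
  by move=> h; rewrite -ball_normE /= distrC (le_lt_trans h).
have S z : `|z - z0| = r1 -> \forall p \near (s0, z), rho p.1 z0 < rho p.1 p.2.
  move=> zr.
  have rz : rho s0 z0 < rho s0 z.
    rewrite r0 lt_neqAle rho_ge0 andbT eq_sym; apply/eqP => rz.
    have zz0 : z <> z0 by move=> zz; move: zr r1_gt0; rewrite zz subrr normr0 => <-; rewrite ltxx.
    have := Hr (s0, (z, z0)); rewrite /= (delta_sol s01 rz r0 zz0) eqxx.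
    move=> H; suff : false by []; move: H.
    by apply; split => /=; [exact: ballxx | split => /=; [apply: inball; rewrite zr | exact: ballxx]].
  have c1 : continuous (fun p : R * V => rho p.1 p.2 - rho p.1 z0).
    move=> p; apply: cvgB; first exact: rho_cont.
    apply: (@continuous_comp _ _ _ (fun p : R * V => (p.1, z0)) (fun p => rho p.1 p.2)).
      by apply: continuous_pair; [exact: continuous_fst | exact: cst_continuous].
    exact: rho_cont.
  have := near_gt0 (x := (s0, z)) c1; rewrite subr_gt0 => /(_ rz).
  by apply: filterS => p /=; rewrite subr_gt0.
(* The sphere is compact, so the strict inequality on it persists simultaneously at all its points
   for [s] near [s0]. *)
have S' := near_compact (@compact_sphere z0 r1) S.
near=> s.
have Ds z z' : `|z - z0| <= r1 -> `|z' - z0| <= r1 -> delta s z z' <> 0.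
  move=> zr z'r; apply/eqP; apply: (Hr (s, (z, z'))); split => /=; last by split; exact: inball.
  by near: s; exact: nbhsx_ballx.
have Ss z : `|z - z0| = r1 -> rho s z0 < rho s z by move: z; near: s.
have [zm] : exists2 c : V, c \in [set z | `|z - z0| <= r1] &
    forall t : V, t \in [set z | `|z - z0| <= r1] -> rho s c <= rho s t.
  apply: compact_EVT_min; [|exact: compact_closed_ball|].
    by exists z0 => /=; rewrite subrr normr0 ltW.
  apply: continuous_subspaceT => z.
  apply: (@continuous_comp _ _ _ (fun z : V => (s, z)) (fun p => rho p.1 p.2)).
    by apply: continuous_pair; [exact: cst_continuous | exact: continuous_id].
  exact: rho_cont.
rewrite inE /= => zmr minz.
have zm_lt : `|zm - z0| < r1.
  rewrite lt_neqAle zmr andbT; apply/eqP => /Ss.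
  by rewrite ltNge minz // inE /= subrr normr0 ltW.
exists zm; first exact: lt_trans r1e.
apply: contrapT => rm.
have e1 : 0 < r1 - `|zm - z0| by rewrite subr_gt0.
have [z' z'zm] := rho_not_min rm (Ds _ _ zmr zmr) e1.
rewrite ltNge minz // inE /=.
have -> : z' - z0 = (z' - zm) + (zm - z0) by rewrite addrA subrK.
by rewrite (le_trans (ler_normD _ _)) // -lerBrDr ltW.
Unshelve. all: by end_near.
Qed.

Lemma open_many k (s0 : R) (w : 'I_k -> V) : 0 <= s0 <= 1 -> injective w ->
  (forall i, rho s0 (w i) = 0) ->
  \forall s \near s0, exists w' : 'I_k -> V, injective w' /\ forall i, rho s (w' i) = 0.
Proof.
move=> s01 inj0 w0.
(* With zeros more than 2e apart and each moving by less than e, the moved zeros stay distinct. *)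
have [e e0 He] : exists2 e, 0 < e & forall i j, i != j -> 2 * e < `|w i - w j|.
  have : \forall e \near 0^'+, forall i, forall j, i != j -> 2 * e < `|w i - w j| :> R.
    apply: filter_forall => i; apply: filter_forall => j.
    have [->|ij] := eqVneq i j; first exact: nearW.
    near=> e => _; rewrite mulrC -ltr_pdivlMr //.
    near: e; apply: nbhs_right_lt; rewrite divr_gt0 // normr_gt0 subr_eq0.
    by apply: contra ij => /eqP/inj0 ->.
  move=> H; have [e [e0 He]] := filter_ex (filterI (nbhs_right_gt (0 : R)) H).
  by exists e.
have L : \forall s \near s0, forall i, exists2 z, `|z - w i| < e & rho s z = 0.
  apply: (@filter_forall R 'I_k (fun i s => exists2 z, `|z - w i| < e & rho s z = 0) (nbhs s0)) => i.
  exact: local_solution s01 (w0 i) e0.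
apply: filterS L => s Hs.
have /boolp.choice [w' Hw'] : forall i, exists z, `|z - w i| < e /\ rho s z = 0.
  by move=> i; have [z] := Hs i; exists z.
exists w'; split=> [i j wij|i]; last by have [] := Hw' i.
apply/eqP; apply: contraT => /He; rewrite ltNge => /negP []; move=> {He}.
have -> : w i - w j = (w' j - w j) - (w' i - w i) by rewrite wij opprB [RHS]addrC addrA subrK.
rewrite (le_trans (ler_normB _ _)) // mulrDl !mul1r lerD // ltW //; by have [] := Hw' j; have [] := Hw' i.
Unshelve. all: by end_near.
Qed.

Definition many_solutions k s :=
  exists w : 'I_k -> V, injective w /\ forall i, rho s (w i) = 0.

(** Tuples of k distinct zeros are the zeros of one continuous function [f] on a compact product of
    balls: the sum of all [rho] and of all [delta] over pairs of different indices. Two entries of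
    such a tuple cannot coincide, because [delta] does not vanish on the diagonal at a zero; so
    distinctness, though an open condition, survives limits. *)
Lemma closed_many k :
  exists2 D : set R, closed D &
    forall s : R, 0 <= s <= 1 -> (D s <-> many_solutions k s).
Proof.
pose Y := prod_topology (fun _ : 'I_k => V).
pose f (p : R * Y) := \sum_i rho p.1 (p.2 i) +
  \sum_i \sum_(j | j != i) `|delta p.1 (p.2 i) (p.2 j)|.
pose K : set Y := [set w | forall i, [set z | `|z - 0| <= B] (w i)].
exists [set s | exists2 w, K w & f (s, w) = 0].
  apply: (@closed_compact_projection R R Y K f).
    by apply: (@tychonoff _ (fun=> V) (fun=> [set z | `|z - 0| <= B])) => i; exact: compact_closed_ball.
  have c i : continuous (fun p : R * Y => p.2 i).
    move=> p; apply: (@continuous_comp _ _ _ snd (fun w : Y => w i)).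
      exact: continuous_snd.
    exact: proj_continuous.
  apply: continuous_add.
    apply: continuous_sum => i _ p.
    apply: (@continuous_comp _ _ _ (fun p : R * Y => (p.1, p.2 i)) (fun p => rho p.1 p.2)).
      by apply: continuous_pair; [exact: continuous_fst | exact: c].
    exact: rho_cont.
  apply: continuous_sum => i _; apply: continuous_sum => j _.
  apply: continuous_norm => p.
  apply: (@continuous_comp _ _ _ (fun p : R * Y => (p.1, (p.2 i, p.2 j)))
    (fun p => delta p.1 p.2.1 p.2.2)).
    by apply: continuous_pair; [exact: continuous_fst | apply: continuous_pair; exact: c].
  exact: delta_cont.
move=> s s01; split=> [[w _]|[w [inj_w w0]]].
  move/eqP; rewrite paddr_eq0; last 2 first.
  - by apply: sumr_ge0 => i _; exact: rho_ge0.
  - by apply: sumr_ge0 => i _; apply: sumr_ge0 => j _; exact: normr_ge0.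
  move=> /andP[]; rewrite psumr_eq0; last by move=> i _; exact: rho_ge0.
  move=> /allP r0; rewrite psumr_eq0; last first.
    by move=> i _; apply: sumr_ge0 => j _; exact: normr_ge0.
  move=> /allP d0; exists w; split=> [i j wij|i]; last first.
    by apply/eqP; exact: r0 (mem_index_enum i).
  apply/eqP; apply: contraT => ij; have := d0 i (mem_index_enum i).
  rewrite /= psumr_eq0; last by move=> ? _; exact: normr_ge0.
  move=> /allP /(_ j (mem_index_enum j)) /=; rewrite eq_sym ij /= normr_eq0 -wij.
  have /eqP ri : rho s (w i) == 0 := r0 _ (mem_index_enum i).
  by move=> /eqP; have := delta_diag s01 ri.
exists w; first by move=> i /=; rewrite subr0; exact: sol_bounded (w0 i).
rewrite /f /= big1 ?add0r => [|i _]; last exact: w0.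
apply: big1 => i _; apply: big1 => j ji.
rewrite delta_sol ?normr0 //; move=> /inj_w ij; by rewrite ij eqxx in ji.
Qed.

(** The parameters with k zeros form a nonempty, relatively open and closed subset of the connected
    segment [0, 1]. *)
Lemma many_solutions_transport k : many_solutions k 0 -> many_solutions k 1.
Proof.
move=> m0; have [D cD DE] := closed_many k.
have Iin (s : R) : `[0, 1]%classic s -> 0 <= s <= 1 by rewrite /= in_itv.
suff E : [set s | 0 <= s <= 1 /\ many_solutions k s] = `[0, 1]%classic.
  have : `[0, 1]%classic (1 : R) by rewrite /= in_itv /= ler01 lexx.
  by rewrite -E => -[].
apply: (@segment_connected R 0 1).
- by exists 0; split=> //; rewrite lexx ler01.
(* Outside [0, 1] nothing is known, so the open set is cut out by an implication that is void
   there. *)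
- exists [set s | \forall t \near s, 0 <= t <= 1 -> many_solutions k t].
    by rewrite openE => s /= /nbhs_interior.
  apply/seteqP; split=> s /=; rewrite in_itv /=.
    move=> [s01 [w [inj_w w0]]]; split=> //.
    by apply: filterS (open_many s01 inj_w w0) => t.
  by move=> [s01 H]; split=> //; exact: nbhs_singleton H s01.
- exists D => //; apply/seteqP; split=> s /=; rewrite in_itv /=.
    by move=> [s01 /(DE _ s01)].
  by move=> [s01 /(DE _ s01)].
Qed.

End ManySolutions.

(** * Continuity of complex-valued functions *)

Section ComplexFunctions.
Variables (R : realType) (X : topologicalType).
Implicit Types f g : X -> R[i].

(** Stated on real and imaginary parts, so that only the topology of [R] is involved. *)
Definition ccontinuous f :=
  continuous (fun x => complex.Re (f x)) /\ continuous (fun x => complex.Im (f x)).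

Lemma ccontinuous_cst c : ccontinuous (fun=> c).
Proof. by split; exact: cst_continuous. Qed.

Lemma ccontinuous_real (f : X -> R) : continuous f -> ccontinuous (fun x => real_complex R (f x)).
Proof. by move=> cf; split=> //=; exact: cst_continuous. Qed.

Lemma ccontinuous_ext f g : f =1 g -> ccontinuous f -> ccontinuous g.
Proof. by move/funext ->. Qed.

Lemma ccontinuous_add f g :
  ccontinuous f -> ccontinuous g -> ccontinuous (fun x => f x + g x).
Proof.
move=> [cf cf'] [cg cg']; split.
  rewrite (_ : (fun x => _) = fun x => complex.Re (f x) + complex.Re (g x)).
    exact: continuous_add.
  by apply/funext => x; rewrite raddfD.
rewrite (_ : (fun x => _) = fun x => complex.Im (f x) + complex.Im (g x)).
  exact: continuous_add.
by apply/funext => x; rewrite raddfD.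
Qed.

Lemma ccontinuous_mul f g :
  ccontinuous f -> ccontinuous g -> ccontinuous (fun x => f x * g x).
Proof.
move=> [cf cf'] [cg cg']; split.
  rewrite (_ : (fun x => _) = fun x => complex.Re (f x) * complex.Re (g x)
      + - (complex.Im (f x) * complex.Im (g x))).
    by apply: continuous_add; [|apply: continuous_opp]; exact: continuous_mul.
  by apply/funext => x; case: (f x) (g x) => ? ? [].
rewrite (_ : (fun x => _) = fun x => complex.Re (f x) * complex.Im (g x)
    + complex.Im (f x) * complex.Re (g x)).
  by apply: continuous_add; exact: continuous_mul.
by apply/funext => x; case: (f x) (g x) => ? ? [].
Qed.

Lemma ccontinuous_opp f : ccontinuous f -> ccontinuous (fun x => - f x).
Proof.
move=> cf; apply: (@ccontinuous_ext (fun x => -1 * f x)).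
  by move=> x; rewrite mulN1r.
by apply: ccontinuous_mul => //; exact: ccontinuous_cst.
Qed.

Lemma ccontinuous_sum (I : Type) (r : seq I) (P : pred I) (F : I -> X -> R[i]) :
  (forall i, ccontinuous (F i)) ->
  ccontinuous (fun x => \sum_(i <- r | P i) F i x).
Proof.
move=> cF; split.
  rewrite (_ : (fun x => _) = fun x => \sum_(i <- r | P i) complex.Re (F i x)).
    by apply: continuous_sum => i _; case: (cF i).
  by apply/funext => x; rewrite raddf_sum.
rewrite (_ : (fun x => _) = fun x => \sum_(i <- r | P i) complex.Im (F i x)).
  by apply: continuous_sum => i _; case: (cF i).
by apply/funext => x; rewrite raddf_sum.
Qed.

Lemma ccontinuous_prod (I : Type) (r : seq I) (P : pred I) (F : I -> X -> R[i]) :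
  (forall i, ccontinuous (F i)) ->
  ccontinuous (fun x => \prod_(i <- r | P i) F i x).
Proof.
move=> cF; elim: r => [|i r IH].
  apply: (@ccontinuous_ext (fun=> 1)); last exact: ccontinuous_cst.
  by move=> x; rewrite big_nil.
case Pi : (P i).
  apply: (@ccontinuous_ext (fun x => F i x * \prod_(i <- r | P i) F i x)).
    by move=> x; rewrite big_cons Pi.
  exact: ccontinuous_mul.
by apply: ccontinuous_ext IH => x; rewrite big_cons Pi.
Qed.

Lemma ccontinuous_exp f k : ccontinuous f -> ccontinuous (fun x => f x ^+ k).
Proof.
move=> cf; apply: (@ccontinuous_ext (fun x => \prod_(i < k) f x)).
  by move=> x; rewrite prodr_const card_ord.
exact: ccontinuous_prod.
Qed.

Lemma ccontinuous_det m (A : X -> 'M[R[i]]_m) :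
  (forall i j, ccontinuous (fun x => A x i j)) -> ccontinuous (fun x => \det (A x)).
Proof.
move=> cA; apply: ccontinuous_sum => s; apply: ccontinuous_mul.
  exact: ccontinuous_cst.
exact: ccontinuous_prod.
Qed.

End ComplexFunctions.

Lemma ccontinuous_comp (R : realType) (X Y : topologicalType) (h : X -> Y) (f : Y -> R[i]) :
  continuous h -> ccontinuous f -> ccontinuous (fun x => f (h x)).
Proof.
move=> ch [c1 c2]; split=> x.
  by apply: (@continuous_comp _ _ _ h (fun y => complex.Re (f y))); [exact: ch | exact: c1].
by apply: (@continuous_comp _ _ _ h (fun y => complex.Im (f y))); [exact: ch | exact: c2].
Qed.

(** The squared modulus with values in [R]; the norm of [R[i]] takes its values in [R[i]], where it
    could not be minimised as a real function. *)
Definition sqnorm (R : realType) (c : R[i]) : R := complex.Re c ^+ 2 + complex.Im c ^+ 2.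

Lemma sqnorm_ge0 (R : realType) (c : R[i]) : 0 <= sqnorm c.
Proof. by rewrite addr_ge0 ?sqr_ge0. Qed.

Lemma sqnorm_eq0 (R : realType) (c : R[i]) : (sqnorm c == 0) = (c == 0).
Proof.
case: c => a b; rewrite /sqnorm /= paddr_eq0 ?sqr_ge0 // !sqrf_eq0.
by rewrite eq_complex.
Qed.

Lemma sqnormM (R : realType) (a b : R[i]) : sqnorm (a * b) = sqnorm a * sqnorm b.
Proof. case: a b => a a' [b b']; rewrite /sqnorm /=; ring. Qed.

Lemma sqnorm_gt0 (R : realType) (c : R[i]) : (0 < sqnorm c) = (c != 0).
Proof. by rewrite lt_neqAle sqnorm_ge0 andbT eq_sym sqnorm_eq0. Qed.

Lemma sqnorm_le2 (R : realType) (a b : R[i]) : sqnorm (a + b) <= 2 * (sqnorm a + sqnorm b).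
Proof.
case: a b => a a' [b b']; rewrite /sqnorm /=.
have := sqr_ge0 (a - b); have := sqr_ge0 (a' - b'); nra.
Qed.

Lemma continuous_sqnorm (R : realType) (X : topologicalType) (f : X -> R[i]) :
  ccontinuous f -> continuous (fun x => sqnorm (f x)).
Proof. by move=> [c1 c2]; apply: continuous_add; exact: continuous_mul. Qed.

End Transport.

(** * Transport of the zeros of a complex system with a divided difference *)

Module ComplexTransport.

Import boolp classical_sets topology normedtype derive.
Import numFieldNormedType.Exports.
Import Transport.
Local Open Scope classical_set_scope.
Local Open Scope ring_scope.

Section ComplexZeros.
Variables (R : realType) (m : nat).
Local Notation C := R[i].

Definition complex_row (v : 'rV[R]_(m + m)) : 'rV[C]_m :=
  \row_i Complex (v 0 (lshift m i)) (v 0 (rshift m i)).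

Definition real_row (z : 'rV[C]_m) : 'rV[R]_(m + m) :=
  row_mx (\row_i complex.Re (z 0 i)) (\row_i complex.Im (z 0 i)).

Lemma real_rowK : cancel real_row complex_row.
Proof.
move=> z; apply/rowP => i; rewrite [LHS]mxE row_mxEl row_mxEr !mxE.
by case: (z 0 i).
Qed.

Lemma complex_rowK : cancel complex_row real_row.
Proof.
move=> v; apply/rowP => i; rewrite mxE.
by case: splitP => j ij; rewrite !mxE /=; congr (v _ _); apply/val_inj.
Qed.

Lemma norm_real_row_le (B : R) (z : 'rV[C]_m) :
  (forall i, sqnorm (z 0 i) <= B ^+ 2) -> `|real_row z| <= `|B|.
Proof.
move=> H; rewrite [X in X <= _]mx_normrE.
apply: bigmax_le => // -[i j] _ /=; rewrite ord1 {i} mxE.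
by case: splitP => l _; rewrite mxE; have := H l; rewrite /sqnorm => Hl;
  rewrite -ler_sqr ?nnegrE // !real_normK ?num_real //; nra.
Qed.

Lemma coord_rV_continuous n (i : 'I_n) : continuous (fun v : 'rV[R]_n => v 0 i).
Proof. exact: coord_continuous. Qed.

Lemma ccontinuous_complex_row i : ccontinuous (fun v => complex_row v 0 i).
Proof.
split.
  rewrite (_ : (fun x => _) = fun v : 'rV[R]_(m + m) => v 0 (lshift m i)).
    exact: coord_rV_continuous.
  by apply/funext => v; rewrite mxE.
rewrite (_ : (fun x => _) = fun v : 'rV[R]_(m + m) => v 0 (rshift m i)).
  exact: coord_rV_continuous.
by apply/funext => v; rewrite mxE.
Qed.

(** Continuity is tested on arbitrary continuous families of arguments, which requires no topology
    on complex row vectors. *)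
Definition param_continuous (F : R -> 'rV[C]_m -> C) :=
  forall (X : topologicalType) (s : X -> R) (z : X -> 'rV[C]_m),
  continuous s -> (forall i, ccontinuous (fun x => z x 0 i)) ->
  ccontinuous (fun x => F (s x) (z x)).

Definition param_continuous2 (F : R -> 'rV[C]_m -> 'rV[C]_m -> C) :=
  forall (X : topologicalType) (s : X -> R) (z z' : X -> 'rV[C]_m),
  continuous s -> (forall i, ccontinuous (fun x => z x 0 i)) ->
  (forall i, ccontinuous (fun x => z' x 0 i)) ->
  ccontinuous (fun x => F (s x) (z x) (z' x)).

(** [M] is a divided difference of [G]; on the diagonal it is the Jacobian matrix, acting on row
    vectors from the right. *)
Variables (G : R -> 'rV[C]_m -> 'rV[C]_m) (M : R -> 'rV[C]_m -> 'rV[C]_m -> 'M[C]_m).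
Hypothesis G_cont : forall i, param_continuous (fun s z => G s z 0 i).
Hypothesis M_cont : forall i j, param_continuous2 (fun s z z' => M s z z' i j).
Hypothesis GM : forall s z z', G s z - G s z' = (z - z') *m M s z z'.

Let rho s v := \sum_i sqnorm (G s (complex_row v) 0 i).
Let delta s v v' := sqnorm (\det (M s (complex_row v) (complex_row v'))).

Let rho_ge0 s v : 0 <= rho s v.
Proof. by apply: sumr_ge0 => i _; exact: sqnorm_ge0. Qed.

Let rho_eq0 s v : rho s v = 0 <-> G s (complex_row v) = 0.
Proof.
split=> [/eqP|E]; last by rewrite /rho E big1 // => i _; rewrite mxE /sqnorm /= expr0n addr0.
rewrite psumr_eq0 => [|i _]; last exact: sqnorm_ge0.
move=> /allP H; apply/rowP => i; rewrite mxE; apply/eqP.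
by have := H i (mem_index_enum i); rewrite /= sqnorm_eq0.
Qed.

Let rho_cont : continuous (fun p : R * 'rV[R]_(m + m) => rho p.1 p.2).
Proof.
apply: continuous_sum => i _; apply: continuous_sqnorm.
apply: (G_cont i (s := fst) (z := fun p : R * 'rV[R]_(m + m) => complex_row p.2)).
  exact: continuous_fst.
move=> j; apply: (@ccontinuous_comp _ (R * 'rV[R]_(m + m))%type 'rV[R]_(m + m) snd (fun v => complex_row v 0 j)).
  exact: continuous_snd.
exact: ccontinuous_complex_row.
Qed.

Let delta_cont : continuous (fun p : R * ('rV[R]_(m + m) * 'rV[R]_(m + m)) =>
  delta p.1 p.2.1 p.2.2).
Proof.
apply: continuous_sqnorm; apply: ccontinuous_det => i j.
apply: (M_cont i j (s := fst)
  (z := fun p : R * ('rV[R]_(m + m) * 'rV[R]_(m + m)) => complex_row p.2.1)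
  (z' := fun p : R * ('rV[R]_(m + m) * 'rV[R]_(m + m)) => complex_row p.2.2)).
- exact: continuous_fst.
- move=> k; apply: (@ccontinuous_comp _ (R * ('rV[R]_(m + m) * 'rV[R]_(m + m)))%type
    'rV[R]_(m + m) (fun p => p.2.1) (fun v => complex_row v 0 k)).
    by move=> p; apply: (@continuous_comp _ _ _ snd fst); [exact: continuous_snd | exact: continuous_fst].
  exact: ccontinuous_complex_row.
- move=> k; apply: (@ccontinuous_comp _ (R * ('rV[R]_(m + m) * 'rV[R]_(m + m)))%type
    'rV[R]_(m + m) (fun p => p.2.2) (fun v => complex_row v 0 k)).
    by move=> p; apply: (@continuous_comp _ _ _ snd snd); [exact: continuous_snd | exact: continuous_snd].
  exact: ccontinuous_complex_row.
Qed.

Let delta_eq0 s v v' : delta s v v' = 0 <-> M s (complex_row v) (complex_row v') \notin unitmx.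
Proof.
by rewrite unitmxE unitfE negbK -sqnorm_eq0; split=> [/eqP|/eqP].
Qed.

(* Newton's step v decreases |G| along z + t v for small t. *)
Let rho_not_min s v : rho s v <> 0 -> delta s v v <> 0 ->
  forall e : R, 0 < e -> exists2 v', `|v' - v| < e & rho s v' < rho s v.
Proof.
move=> rv /delta_eq0/negP; rewrite negbK => Mu e e0.
set z := complex_row v in Mu *.
pose w := - G s z *m invmx (M s z z).
pose r := real_row w.
pose zt (t : R) := complex_row (v + t *: r).
have ztE t : zt t = z + (real_complex R t) *: w.
  apply/rowP => i; rewrite [LHS]mxE ![(v + _) _ _]mxE ![(t *: r) _ _]mxE row_mxEl row_mxEr.
  rewrite ![(\row__ _) _ _]mxE [RHS]mxE [(_ *: w) _ _]mxE.
  case: (w 0 i) => a b /=; apply/eqP.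
  rewrite [z _ _]mxE.
  by rewrite eq_complex /=; apply/andP; split; apply/eqP; ring.
pose N t := w *m M s (zt t) z.
have GN t : G s (zt t) = G s z + real_complex R t *: N t.
  by rewrite -[LHS](subrK (G s z)) GM {1}ztE [z + _]addrC addrK -scalemxAl addrC.
have N0 : N 0 = - G s z.
  rewrite /N ztE (_ : real_complex R 0 = 0) // scale0r addr0.
  by rewrite /w mulmxKV.
pose dot (a b : C) := complex.Re a * complex.Re b + complex.Im a * complex.Im b.
(* The increment of [rho] along the step, divided by [t]. Its value at 0 is -2 [rho s v], hence
   negative, and continuity keeps it negative for small [t]. *)
pose phi t := \sum_i (2 * dot (G s z 0 i) (N t 0 i) + t * sqnorm (N t 0 i)).
have rhoE t : rho s (v + t *: r) = rho s v + t * phi t.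
  rewrite /rho mulr_sumr -big_split /=; apply: eq_bigr => i _.
  have -> : G s (complex_row (v + t *: r)) 0 i = G s z 0 i + real_complex R t * N t 0 i.
    by rewrite -/(zt t) GN mxE [X in _ + X]mxE.
  rewrite -/z /dot /sqnorm.
  by case: (G s z 0 i) (N t 0 i) => a b [c d] /=; ring.
have cN i : ccontinuous (fun t : R => N t 0 i).
  apply: (@ccontinuous_ext _ _ (fun t => \sum_j w 0 j * M s (zt t) z j i)).
    by move=> t; rewrite mxE.
  apply: ccontinuous_sum => j; apply: ccontinuous_mul; first exact: ccontinuous_cst.
  apply: (M_cont j i (s := fun=> s) (z := zt) (z' := fun=> z)).
  - exact: cst_continuous.
  - move=> k; apply: (@ccontinuous_ext _ _ (fun t => z 0 k + real_complex R t * w 0 k)).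
      by move=> t; rewrite ztE !mxE.
    apply: ccontinuous_add; first exact: ccontinuous_cst.
    apply: ccontinuous_mul; last exact: ccontinuous_cst.
    by apply: ccontinuous_real => t; exact: cvg_id.
  - by move=> k; exact: ccontinuous_cst.
have cphi : continuous (fun t => - phi t).
  apply: continuous_opp; apply: continuous_sum => i _; apply: continuous_add.
    apply: continuous_mul; first exact: cst_continuous.
    case: (cN i) => c1 c2.
    by apply: continuous_add; apply: continuous_mul => //; exact: cst_continuous.
  apply: continuous_mul; first by move=> t; exact: cvg_id.
  exact: continuous_sqnorm.
have phi0 : 0 < - phi 0.
  have -> : - phi 0 = 2 * rho s v.
    rewrite /phi /rho mulr_sumr -sumrN; apply: eq_bigr => i _.
    rewrite N0 mxE -/z /dot /sqnorm; case: (G s z 0 i) => a b /=; ring.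
  by rewrite mulr_gt0 // lt_neqAle rho_ge0 andbT eq_sym; apply/eqP.
have [t [t0 [pt te]]] : exists t : R, 0 < t /\ 0 < - phi t /\ t * `|r| < e.
  have H0 : \forall t \near (0 : R), 0 < - phi t by exact: near_gt0 cphi phi0.
  have H1 : \forall t \near (0 : R)^'+, 0 < - phi t by apply: cvg_within; exact: H0.
  have H2 : \forall t \near (0 : R)^'+, t * (`|r| + 1) < e.
    near=> t; rewrite -ltr_pdivlMr; last by rewrite ltr_wpDl.
    by near: t; apply: nbhs_right_lt; rewrite divr_gt0 // ltr_wpDl.
  have [t [t0 [pt te]]] := filter_ex (filterI (nbhs_right_gt (0 : R)) (filterI H1 H2)).
  exists t; split=> //; split=> //; apply: le_lt_trans te.
  by rewrite ler_wpM2l ?(ltW t0) // lerDl.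
exists (v + t *: r); first by rewrite addrC addKr normrZ gtr0_norm.
by rewrite rhoE gtrDl pmulr_rlt0 // -oppr_gt0.
Unshelve. all: by end_near.
Qed.

Hypothesis M_unit : forall (s : R) z, 0 <= s <= 1 -> G s z = 0 -> M s z z \in unitmx.
Variable B : R.
Hypothesis G_bounded : forall (s : R) z, 0 <= s <= 1 -> G s z = 0 ->
  forall i, sqnorm (z 0 i) <= B ^+ 2.

Lemma zeros_transport k :
  (exists w : 'I_k -> 'rV[C]_m, injective w /\ forall i, G 0 (w i) = 0) ->
  exists w : 'I_k -> 'rV[C]_m, injective w /\ forall i, G 1 (w i) = 0.
Proof.
move=> [w [inj_w w0]].
have [|||||w' [inj_w' w1]] := @many_solutions_transport R 'rV[R]_(m + m)
  (@compact_rV_ball R (m + m)) rho delta `|B| rho_cont delta_cont rho_ge0 _ _ _ _ k _.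
- move=> s v v' s01 /rho_eq0 Gv /rho_eq0 Gv' vv'; apply/delta_eq0.
  have := GM s (complex_row v) (complex_row v'); rewrite Gv Gv' subr0.
  move=> E; apply/negP => u; apply: vv'; apply: (can_inj complex_rowK).
  apply/eqP; rewrite -subr_eq0; apply/eqP.
  by rewrite -[LHS](mulmxK u) -E mul0mx.
- by move=> s v s01 /rho_eq0 Gv /delta_eq0; rewrite M_unit.
- exact: rho_not_min.
- move=> s v s01 /rho_eq0 Gv; rewrite -(complex_rowK v).
  exact: norm_real_row_le (G_bounded s01 Gv).
- exists (real_row \o w); split=> [i j /(can_inj real_rowK) /inj_w //|i].
  by apply/rho_eq0; rewrite /= real_rowK.
exists (complex_row \o w'); split=> [i j /(can_inj complex_rowK) /inj_w' //|i].
by apply/rho_eq0.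
Qed.

End ComplexZeros.

End ComplexTransport.

(** * The square system for lines in an affine chart *)

Lemma unitmx_inj (F : fieldType) n (A : 'M[F]_n) :
  (forall w : 'rV_n, w *m A = 0 -> w = 0) -> A \in unitmx.
Proof.
move=> H; rewrite -row_free_unit -kermx_eq0; apply/rowV0P => w.
by move/sub_kermxP/H.
Qed.

(* Lines avoiding (0 : 0 : 1) are written x_2 = h(x_1) in the affine chart
   x_0 = 1; g k j is the coefficient of x_0^(4-k-j) x_1^j x_2^k, and z collects
   the coefficients of h and of a binary quadratic form q. *)
Section SquareSystem.
Variable C : numClosedFieldType.
Implicit Types (g : nat -> nat -> C) (z w : 'rV[C]_5) (h : {poly C}).

Definition line_basis (i : 'I_5) : {poly C} := nth 0 [:: 1; 'X; 0; 0; 0] i.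
Definition conic_basis (i : 'I_5) : {poly C} := nth 0 [:: 0; 0; 1; 'X; 'X^2] i.

Definition line_poly z : {poly C} := \sum_i z 0 i *: line_basis i.
Definition conic_poly z : {poly C} := \sum_i z 0 i *: conic_basis i.

Definition chart_coef g k : {poly C} := \poly_(j < 5 - k) g k j.
Definition chart_quartic g h : {poly C} := \sum_(k < 5) chart_coef g k * h ^+ k.
(** The divided difference of [chart_quartic g] between [h] and [h']. The inner sum is empty for k =
    0, so the truncated predecessor does no harm. *)
Definition chart_slope g h h' : {poly C} :=
  \sum_(k < 5) chart_coef g k * \sum_(i < k) h ^+ (k.-1 - i) * h' ^+ i.

Definition square_defect g z : 'rV[C]_5 :=
  \row_j (chart_quartic g (line_poly z) - conic_poly z ^+ 2)`_j.

(** Row i is the contribution of the i-th coordinate of z - z' to the difference of the defects; the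
    second term uses q^2 - q'^2 = (q - q')(q + q'). *)
Definition defect_slope g z z' : 'M[C]_5 :=
  \matrix_(i, j) (line_basis i * chart_slope g (line_poly z) (line_poly z')
                  - conic_basis i * (conic_poly z + conic_poly z'))`_j.

Lemma line_polyE z : line_poly z = (z 0 0)%:P + z 0 1 *: 'X.
Proof.
rewrite /line_poly !big_ord_recl big_ord0 /= !scaler0 !addr0 alg_polyC.
by congr (_ + z 0 _ *: _); apply/val_inj.
Qed.

Lemma conic_polyE z :
  conic_poly z = (z 0 (inord 2))%:P + z 0 (inord 3) *: 'X + z 0 (inord 4) *: 'X^2.
Proof.
rewrite /conic_poly !big_ord_recl big_ord0 /= !scaler0 !add0r addr0 alg_polyC addrA.
by congr ((z 0 _)%:P + z 0 _ *: _ + z 0 _ *: _); apply/val_inj; rewrite /= inordK.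
Qed.

Lemma size_line_poly z : (size (line_poly z) <= 2)%N.
Proof.
apply: (leq_trans (size_sum _ _ _)); apply/bigmax_leqP => i _.
apply: (leq_trans (size_scale_leq _ _)).
rewrite /line_basis; case: i => [[|[|[|[|[|i]]]]] hi] //=.
all: by rewrite ?size_polyX ?size_polyC ?size_poly0 ?oner_neq0 ?eqxx.
Qed.

Lemma size_conic_poly z : (size (conic_poly z) <= 3)%N.
Proof.
apply: (leq_trans (size_sum _ _ _)); apply/bigmax_leqP => i _.
apply: (leq_trans (size_scale_leq _ _)).
rewrite /conic_basis; case: i => [[|[|[|[|[|i]]]]] hi] //=.
all: by rewrite ?size_polyX ?size_polyXn ?size_polyC ?size_poly0 ?oner_neq0 ?eqxx.
Qed.

Lemma size_mul_bound (p q : {poly C}) a b c :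
  (size p <= a)%N -> (size q <= b)%N -> (a + b <= c.+1)%N -> (size (p * q)%R <= c)%N.
Proof. by move=> pa qb abc; apply: (leq_trans (size_polyMleq p q)); lia. Qed.

Lemma size_line_exp h k : (size h <= 2)%N -> (size (h ^+ k) <= k.+1)%N.
Proof.
move=> hs; elim: k => [|k IH]; first by rewrite expr0 size_polyC oner_neq0.
by rewrite exprS; apply: size_mul_bound hs IH _; lia.
Qed.

Lemma size_chart_quartic g h : (size h <= 2)%N -> (size (chart_quartic g h) <= 5)%N.
Proof.
move=> hs; apply: (leq_trans (size_sum _ _ _)); apply/bigmax_leqP => k _.
apply: size_mul_bound (size_poly _ _) (size_line_exp _ hs) _.
by have := ltn_ord k; lia.
Qed.

Lemma size_chart_slope g h h' : (size h <= 2)%N -> (size h' <= 2)%N ->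
  (size (chart_slope g h h') <= 4)%N.
Proof.
move=> hs hs'; apply: (leq_trans (size_sum _ _ _)); apply/bigmax_leqP => k _.
have [->|k0] := eqVneq (nat_of_ord k) 0%N; first by rewrite big_ord0 mulr0 size_poly0.
apply: (@size_mul_bound _ _ (5 - k) k).
- exact: size_poly.
- apply: (leq_trans (size_sum _ _ _)); apply/bigmax_leqP => i _.
  apply: size_mul_bound (size_line_exp _ hs) (size_line_exp _ hs') _.
  by have := ltn_ord i; lia.
- by have := ltn_ord k; lia.
Qed.

(** Both sides have degree at most 4, so the five recorded coefficients decide equality. *)
Lemma square_defect_eq0 g z :
  square_defect g z = 0 <-> chart_quartic g (line_poly z) = conic_poly z ^+ 2.
Proof.
split=> [E|E]; last by apply/rowP => j; rewrite !mxE E subrr coef0.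
apply/eqP; rewrite -subr_eq0; apply/eqP/polyP => j; rewrite coef0.
have [j5|j5] := ltnP j 5; first by have := congr1 (fun u : 'rV_5 => u 0 (Ordinal j5)) E; rewrite !mxE.
apply/nth_default/(leq_trans _ j5); rewrite (leq_trans (size_polyD _ _)) //.
rewrite geq_max size_chart_quartic ?size_line_poly //= size_polyN expr2.
exact: size_mul_bound (size_conic_poly z) (size_conic_poly z) _.
Qed.

Lemma chart_quarticB g h h' :
  chart_quartic g h - chart_quartic g h' = (h - h') * chart_slope g h h'.
Proof.
rewrite /chart_quartic -sumrB mulr_sumr; apply: eq_bigr => k _.
by rewrite -mulrBr subrXX mulrCA.
Qed.

Lemma mul_defect_slope g z z' w :
  w *m defect_slope g z z' = \row_j (line_poly w * chart_slope g (line_poly z) (line_poly z')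
    - conic_poly w * (conic_poly z + conic_poly z'))`_j.
Proof.
apply/rowP => j; rewrite !mxE /line_poly /conic_poly.
rewrite (mulr_suml _ _ (fun i => w 0 i *: line_basis i)).
rewrite (mulr_suml _ _ (fun i => w 0 i *: conic_basis i)) -sumrB coef_sum.
by apply: eq_bigr => i _; rewrite !mxE -!scalerAl -scalerBr coefZ.
Qed.

Lemma line_polyB z z' : line_poly (z - z') = line_poly z - line_poly z'.
Proof. by rewrite /line_poly -sumrB; apply: eq_bigr => i _; rewrite !mxE scalerBl. Qed.

Lemma conic_polyB z z' : conic_poly (z - z') = conic_poly z - conic_poly z'.
Proof. by rewrite /conic_poly -sumrB; apply: eq_bigr => i _; rewrite !mxE scalerBl. Qed.

Lemma square_defectB g z z' :
  square_defect g z - square_defect g z' = (z - z') *m defect_slope g z z'.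
Proof.
rewrite mul_defect_slope; apply/rowP => j; rewrite !mxE -coefB line_polyB conic_polyB -chart_quarticB.
by congr (polyseq _)`_j; ring.
Qed.

Lemma chart_params_eq0 w : line_poly w = 0 -> conic_poly w = 0 -> w = 0.
Proof.
rewrite line_polyE conic_polyE => /polyP E /polyP F; apply/rowP => i; rewrite mxE.
move: (E 0) (E 1) (F 0) (F 1) (F 2); rewrite !coefE /= !mulr0 !mulr1 !addr0 !add0r.
by case: i => [[|[|[|[|[|i]]]]] hi] // e0 e1 f0 f1 f2;
  [rewrite -[RHS]e0 | rewrite -[RHS]e1 | rewrite -[RHS]f0 | rewrite -[RHS]f1 | rewrite -[RHS]f2];
  congr (w 0 _); apply/val_inj; rewrite /= ?inordK.
Qed.

(* The two hypotheses say that the conormal section c has no common zero with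
   q on the projective line, including the point at infinity. *)
Lemma defect_slope_unit g z :
  let c := chart_slope g (line_poly z) (line_poly z) in
  (forall v, root (conic_poly z) v -> c.[v] != 0) ->
  ((conic_poly z)`_2 = 0 -> c`_3 != 0) ->
  defect_slope g z z \in unitmx.
Proof.
move=> c S1 S2; apply: unitmx_inj => w; rewrite mul_defect_slope -/c => E.
set q := conic_poly z in S1 S2 E.
have cop : coprimep q c by apply/Pdiv.ClosedField.coprimepP => v /S1.
have sc : (size c <= 4)%N by apply: size_chart_slope; exact: size_line_poly.
have {}E : line_poly w * c = conic_poly w * (q + q).
  apply/eqP; rewrite -subr_eq0; apply/eqP/polyP => j; rewrite coef0.
  have [j5|j5] := ltnP j 5; first by have := congr1 (fun u : 'rV_5 => u 0 (Ordinal j5)) E; rewrite !mxE.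
  apply/nth_default/(leq_trans _ j5); rewrite (leq_trans (size_polyD _ _)) //.
  rewrite geq_max (size_mul_bound (size_line_poly w) sc) //= size_polyN.
  apply: size_mul_bound (size_conic_poly w) _ _; last exact: leqnn.
  by rewrite (leq_trans (size_polyD _ _)) // geq_max size_conic_poly.
have q0 : q != 0.
  apply/eqP => q0; have : size c == 1%N by move: cop; rewrite q0 coprime0p -size_poly_eq1.
  have : c`_3 != 0 by apply: S2; rewrite q0 coef0.
  by move=> c3 /eqP s1; move: c3; rewrite nth_default ?eqxx // s1.
have qq0 : q + q != 0 by rewrite -mulr2n -scaler_nat scaler_eq0 pnatr_eq0.
suff h0 : line_poly w = 0.
  apply: chart_params_eq0 => //; apply/eqP; move: E; rewrite h0 mul0r => /esym/eqP.
  by rewrite mulf_eq0 (negbTE qq0) orbF.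
(* If q has degree below 2, then c has full degree 3 and, being coprime to q, divides
   [conic_poly w], which has degree at most 2 and so is zero. Otherwise the quadratic q, coprime to
   c, divides [line_poly w] of degree at most 1. *)
have [g2|g2] := eqVneq q`_2 0.
  have c3 := S2 g2.
  have c4 : size c = 4%N.
    apply/eqP; rewrite eqn_leq sc /= ltnNge; apply: contra c3 => c3.
    by rewrite nth_default.
  have : c %| conic_poly w.
    rewrite -(@Gauss_dvdpl _ _ (q + q)) -?E ?dvdp_mull //.
    by rewrite -mulr2n -scaler_nat coprimepZr ?pnatr_eq0 // coprimep_sym.
  have [cw0 _|cw0 /(dvdp_leq cw0)] := eqVneq (conic_poly w) 0.
    move: E; rewrite cw0 mul0r => /eqP; rewrite mulf_eq0 => /orP[/eqP//|].
    by rewrite -size_poly_eq0 c4.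
  by rewrite c4 => H; have := leq_trans H (size_conic_poly w).
have s3 : (2 < size q)%N.
  by rewrite ltnNge; apply: contra g2 => g2; rewrite nth_default.
have : q %| line_poly w.
  by rewrite -(@Gauss_dvdpl _ _ c) // E mulrDr dvdp_add ?dvdp_mull.
have [//|lw0 /(dvdp_leq lw0) H] := eqVneq (line_poly w) 0.
by have := leq_trans s3 (leq_trans H (size_line_poly w)).
Qed.

End SquareSystem.

(** * Squares among the restrictions of a quartic to lines *)

(** The polynomial [r] collects the points where the comparison would divide by zero. The difference
    times [r] vanishes at the natural numbers, hence identically. *)
Lemma poly_fun_eq (F : numDomainType) (p q r : {poly F}) :
  r != 0 -> (forall x, r.[x] != 0 -> p.[x] = q.[x]) -> p = q.
Proof.
move=> r0 H; apply/eqP; rewrite -subr_eq0.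
suff : (p - q) * r == 0 by rewrite mulf_eq0 (negbTE r0) orbF.
set d := _ * r; apply/eqP/(@roots_geq_poly_eq0 _ _ [seq i%:R | i <- iota 0 (size d)]).
- apply/allP => x _; rewrite rootE /d hornerM hornerD hornerN.
  by have [->|/H ->] := eqVneq r.[x] 0; rewrite ?mulr0 ?subrr ?mul0r.
- rewrite map_inj_uniq ?iota_uniq // => i j /eqP; rewrite eqr_nat; exact: eqP.
- by rewrite size_map size_iota.
Qed.

(* Vanishing of both expressions characterises the squares among the binary
   quartics with non-zero constant coefficient. *)
Definition square_obstruction3 (F : comNzRingType) (f : nat -> F) : F :=
  8 * f 0%N ^+ 2 * f 3%N - f 1%N * (4 * f 0%N * f 2%N - f 1%N ^+ 2).
Definition square_obstruction4 (F : comNzRingType) (f : nat -> F) : F :=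
  64 * f 0%N ^+ 3 * f 4%N - (4 * f 0%N * f 2%N - f 1%N ^+ 2) ^+ 2.

Section SquareOnLine.
Variable C : numClosedFieldType.
Implicit Types (g : nat -> nat -> C) (z w : 'rV[C]_5) (h u v : {poly C}).

(** The restriction of the quartic to (u : v : 1). This chart x_2 = 1 contains (0 : 0 : 1), so it
    can follow a line that degenerates to one of the pencil. *)
Definition chart_restr g u v : {poly C} :=
  \sum_(k < 5) \sum_(j < 5 - k) g k j *: (u ^+ (4 - k - j) * v ^+ j).

(** The linear relation says that (u : v : 1) runs along the line of [z]. The identity is f(1, t,
    h(t)) = q(t)^2 at t = v / u, multiplied by u^4. *)
Lemma chart_restr_square g z u v : square_defect g z = 0 -> u != 0 ->
  z 0 0 *: u + z 0 1 *: v = 1 ->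
  chart_restr g u v =
    (z 0 (inord 2) *: u ^+ 2 + z 0 (inord 3) *: (u * v) + z 0 (inord 4) *: v ^+ 2) ^+ 2.
Proof.
move=> /square_defect_eq0 E u0 uv; apply: (poly_fun_eq u0) => x ux.
have := congr1 (fun p => p.[x]) uv; rewrite hornerD !hornerZ hornerC => uvx.
have [t tE] : exists t, v.[x] = t * u.[x] by exists (v.[x] / u.[x]); rewrite divfK.
pose hE := (hornerD, hornerZ, hornerC, hornerX, hornerXn, hornerM, horner_exp).
have lt : (line_poly z).[t] = u.[x]^-1.
  rewrite line_polyE hornerD hornerZ hornerC hornerX; apply: (mulIf ux).
  by rewrite mulVf // -uvx tE; ring.
have := congr1 (fun p => p.[t]) E.
rewrite horner_exp conic_polyE !hE => Et.
rewrite tE.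
transitivity (u.[x] ^+ 4 * (chart_quartic g (line_poly z)).[t]); last first.
  by rewrite Et; ring.
rewrite /chart_restr /chart_quartic !horner_sum mulr_sumr; apply: eq_bigr => k _.
rewrite horner_sum hornerM horner_exp lt horner_poly mulr_suml mulr_sumr.
apply: eq_bigr => j _; rewrite !hE tE.
have kj : (j <= 4 - k)%N by have := ltn_ord j; have := ltn_ord k; lia.
have k4 : (k <= 4)%N by have := ltn_ord k; lia.
have -> : u.[x] ^+ 4 = u.[x] ^+ k * (u.[x] ^+ j * u.[x] ^+ (4 - k - j)).
  by rewrite -!exprD; congr (_ ^+ _); lia.
rewrite exprMn exprVn.
by field; rewrite expf_neq0.
Qed.

Lemma coef_square (p : {poly C}) : (size p <= 3)%N ->
  [/\ (p ^+ 2)`_0 = p`_0 ^+ 2, (p ^+ 2)`_1 = 2 * p`_0 * p`_1,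
      (p ^+ 2)`_2 = p`_1 ^+ 2 + 2 * p`_0 * p`_2,
      (p ^+ 2)`_3 = 2 * p`_1 * p`_2 & (p ^+ 2)`_4 = p`_2 ^+ 2].
Proof.
move=> p3; have n3 : p`_3 = 0 by rewrite nth_default.
have n4 : p`_4 = 0 by rewrite nth_default // (leq_trans p3).
by rewrite expr2 !coefM !big_ord_recr !big_ord0 /= !subn0 ?n3 ?n4; split; ring.
Qed.

Lemma square_obstructions (p : {poly C}) : (size p <= 3)%N ->
  square_obstruction3 (fun i => (p ^+ 2)`_i) = 0 /\
  square_obstruction4 (fun i => (p ^+ 2)`_i) = 0.
Proof.
move=> /coef_square [e0 e1 e2 e3 e4].
by rewrite /square_obstruction3 /square_obstruction4 e0 e1 e2 e3 e4; split; ring.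
Qed.

(* The coefficient of x^k y^(4-k) in the restriction of the quartic to the line
   through (0 : 0 : 1) and (u : v : 0), parametrised by (u x, v x, y). *)
Definition pencil_coef g (u v : C) k : C :=
  \sum_(j < k.+1) g (4 - k)%N j * u ^+ (k - j) * v ^+ j.

(** The first condition says that the curve misses (0 : 0 : 1). It is the constant coefficient of
    every form in the pencil, and its nonvanishing makes the two obstructions faithful. *)
Definition no_vertical_square g :=
  g 4%N 0%N != 0 /\ forall u v : C, (u, v) != (0, 0) ->
    square_obstruction3 (pencil_coef g u v) != 0 \/
    square_obstruction4 (pencil_coef g u v) != 0.

Lemma chart_restr_monomial g (a b : C) k : (k <= 4)%N ->
  (chart_restr g (a *: 'X) (b *: 'X))`_k = pencil_coef g a b k.
Proof.
move=> k4; rewrite /chart_restr coef_sum.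
have ok : (4 - k < 5)%N by lia.
rewrite (bigD1 (Ordinal ok)) //= [X in _ + X]big1 ?addr0 => [|i ik].
  rewrite coef_sum (_ : (5 - (4 - k) = k.+1)%N); last by lia.
  apply: eq_bigr => j _; have jk := ltn_ord j.
  rewrite coefZ !exprZn -scalerAl -scalerAr !coefZ -exprD coefXn.
  rewrite (_ : (4 - (4 - k) - j + j = k)%N); last by lia.
  by rewrite eqxx (_ : (4 - (4 - k) - j = k - j)%N) ?mulr1 ?mulrA //; lia.
rewrite coef_sum big1 // => j _; have ji := ltn_ord j.
rewrite coefZ !exprZn -scalerAl -scalerAr !coefZ -exprD coefXn.
case: eqP => [e|]; last by rewrite !mulr0.
case/eqP: ik; apply/val_inj => /=; lia.
Qed.

End SquareOnLine.

(** * Boundedness of the zeros along a path, and transport in the chart *)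

Module ChartTransport.

Import boolp classical_sets topology normedtype derive.
Import numFieldNormedType.Exports.
Import Transport ComplexTransport.
Local Open Scope classical_set_scope.
Local Open Scope ring_scope.

Section PolyContinuity.
Variables (R : realType) (X : topologicalType).
Local Notation C := R[i].
Implicit Types p q : X -> {poly C}.

Definition pcontinuous p := forall n, ccontinuous (fun x => (p x)`_n).

Lemma pcontinuous_cst (c : {poly C}) : pcontinuous (fun=> c).
Proof. by move=> n; exact: ccontinuous_cst. Qed.

Lemma pcontinuous_ext p q : p =1 q -> pcontinuous p -> pcontinuous q.
Proof. by move/funext ->. Qed.

Lemma pcontinuous_add p q :
  pcontinuous p -> pcontinuous q -> pcontinuous (fun x => p x + q x).
Proof.
move=> cp cq n; apply: (@ccontinuous_ext _ _ (fun x => (p x)`_n + (q x)`_n)).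
  by move=> x; rewrite coefD.
exact: ccontinuous_add.
Qed.

Lemma pcontinuous_mul p q :
  pcontinuous p -> pcontinuous q -> pcontinuous (fun x => p x * q x).
Proof.
move=> cp cq n.
apply: (@ccontinuous_ext _ _ (fun x => \sum_(i < n.+1) (p x)`_i * (q x)`_(n - i))).
  by move=> x; rewrite coefM.
by apply: ccontinuous_sum => i; exact: ccontinuous_mul.
Qed.

Lemma pcontinuous_scale (c : X -> C) p :
  ccontinuous c -> pcontinuous p -> pcontinuous (fun x => c x *: p x).
Proof.
move=> cc cp n; apply: (@ccontinuous_ext _ _ (fun x => c x * (p x)`_n)).
  by move=> x; rewrite coefZ.
exact: ccontinuous_mul.
Qed.

Lemma pcontinuous_opp p : pcontinuous p -> pcontinuous (fun x => - p x).
Proof.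
move=> cp; apply: (@pcontinuous_ext (fun x => (-1) *: p x)).
  by move=> x; rewrite scaleN1r.
by apply: pcontinuous_scale => //; exact: ccontinuous_cst.
Qed.

Lemma pcontinuous_sum (I : Type) (r : seq I) (P : pred I) (F : I -> X -> {poly C}) :
  (forall i, pcontinuous (F i)) ->
  pcontinuous (fun x => \sum_(i <- r | P i) F i x).
Proof.
move=> cF n; apply: (@ccontinuous_ext _ _ (fun x => \sum_(i <- r | P i) (F i x)`_n)).
  by move=> x; rewrite coef_sum.
by apply: ccontinuous_sum => i; exact: cF.
Qed.

Lemma pcontinuous_exp p k : pcontinuous p -> pcontinuous (fun x => p x ^+ k).
Proof.
move=> cp; elim: k => [|k IH].
  by apply: (@pcontinuous_ext (fun=> 1)) => //; exact: pcontinuous_cst.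
apply: (@pcontinuous_ext (fun x => p x * p x ^+ k)); first by move=> x; rewrite exprS.
exact: pcontinuous_mul.
Qed.

End PolyContinuity.

Section Family.
Variables (R : realType) (g : R -> nat -> nat -> R[i]).
Local Notation C := R[i].
Hypothesis g_cont : forall k j, ccontinuous (fun s => g s k j).

Section Continuity.
Variables (X : topologicalType) (s : X -> R).
Hypothesis s_cont : continuous s.

Lemma g_comp_continuous k j : ccontinuous (fun x => g (s x) k j).
Proof. by apply: (@ccontinuous_comp R X R s (fun s => g s k j)). Qed.

Lemma chart_coef_continuous k : pcontinuous (fun x => chart_coef (g (s x)) k).
Proof.
move=> n; have [nk|nk] := boolP (n < 5 - k)%N.
  apply: (@ccontinuous_ext _ _ (fun x => g (s x) k n)); last exact: g_comp_continuous.
  by move=> x; rewrite coef_poly nk.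
apply: (@ccontinuous_ext _ _ (fun=> 0)); last exact: ccontinuous_cst.
by move=> x; rewrite coef_poly (negbTE nk).
Qed.

Lemma chart_quartic_continuous (h : X -> {poly C}) : pcontinuous h ->
  pcontinuous (fun x => chart_quartic (g (s x)) (h x)).
Proof.
move=> ch; apply: pcontinuous_sum => k; apply: pcontinuous_mul.
  exact: chart_coef_continuous.
exact: pcontinuous_exp.
Qed.

Lemma chart_slope_continuous (h h' : X -> {poly C}) : pcontinuous h -> pcontinuous h' ->
  pcontinuous (fun x => chart_slope (g (s x)) (h x) (h' x)).
Proof.
move=> ch ch'; apply: pcontinuous_sum => k; apply: pcontinuous_mul.
  exact: chart_coef_continuous.
by apply: pcontinuous_sum => i; apply: pcontinuous_mul; exact: pcontinuous_exp.
Qed.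

Lemma chart_restr_continuous (u v : X -> {poly C}) : pcontinuous u -> pcontinuous v ->
  pcontinuous (fun x => chart_restr (g (s x)) (u x) (v x)).
Proof.
move=> cu cv; apply: pcontinuous_sum => k; apply: pcontinuous_sum => j.
apply: pcontinuous_scale; first exact: g_comp_continuous.
by apply: pcontinuous_mul; exact: pcontinuous_exp.
Qed.

Variables (z : X -> 'rV[C]_5).
Hypothesis z_cont : forall i, ccontinuous (fun x => z x 0 i).

Lemma line_poly_continuous : pcontinuous (fun x => line_poly (z x)).
Proof.
apply: pcontinuous_sum => i; apply: pcontinuous_scale; first exact: z_cont.
exact: pcontinuous_cst.
Qed.

Lemma conic_poly_continuous : pcontinuous (fun x => conic_poly (z x)).
Proof.
apply: pcontinuous_sum => i; apply: pcontinuous_scale; first exact: z_cont.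
exact: pcontinuous_cst.
Qed.

End Continuity.

Lemma square_defect_continuous i : param_continuous (fun s z => square_defect (g s) z 0 i).
Proof.
move=> X s z cs cz.
apply: (@ccontinuous_ext _ _ (fun x => (chart_quartic (g (s x)) (line_poly (z x))
   + - conic_poly (z x) ^+ 2)`_i)); first by move=> x; rewrite mxE.
apply: pcontinuous_add.
  by apply: chart_quartic_continuous => //; exact: line_poly_continuous.
by apply: pcontinuous_opp; apply: pcontinuous_exp; exact: conic_poly_continuous.
Qed.

Lemma defect_slope_continuous i j :
  param_continuous2 (fun s z z' => defect_slope (g s) z z' i j).
Proof.
move=> X s z z' cs cz cz'.
apply: (@ccontinuous_ext _ _ (fun x =>
  (line_basis C i * chart_slope (g (s x)) (line_poly (z x)) (line_poly (z' x))
     + - (conic_basis C i * (conic_poly (z x) + conic_poly (z' x))))`_j)).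
  by move=> x; rewrite mxE.
apply: pcontinuous_add.
  apply: pcontinuous_mul; first exact: pcontinuous_cst.
  by apply: chart_slope_continuous => //; exact: line_poly_continuous.
apply: pcontinuous_opp; apply: pcontinuous_mul; first exact: pcontinuous_cst.
by apply: pcontinuous_add; exact: conic_poly_continuous.
Qed.

Definition obstruction (p : {poly C}) : R :=
  sqnorm (square_obstruction3 (fun i => p`_i)) + sqnorm (square_obstruction4 (fun i => p`_i)).

Lemma obstruction_gt0 (p : {poly C}) :
  square_obstruction3 (fun i => p`_i) != 0 \/ square_obstruction4 (fun i => p`_i) != 0 ->
  0 < obstruction p.
Proof.
rewrite /obstruction -!sqnorm_gt0 => -[H|H].
  by rewrite ltr_pwDl // sqnorm_ge0.
by rewrite ltr_wpDl // sqnorm_ge0.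
Qed.

Lemma obstruction_continuous (X : topologicalType) (p : X -> {poly C}) :
  pcontinuous p -> continuous (fun x => obstruction (p x)).
Proof.
move=> cp.
have cD : ccontinuous (fun x => 4 * (p x)`_0 * (p x)`_2 + - (p x)`_1 ^+ 2).
  apply: ccontinuous_add.
    by apply: ccontinuous_mul; [apply: ccontinuous_mul; [exact: ccontinuous_cst|] | ]; exact: cp.
  by apply: ccontinuous_opp; apply: ccontinuous_exp; exact: cp.
apply: continuous_add; apply: continuous_sqnorm; apply: ccontinuous_add.
- apply: ccontinuous_mul; last exact: cp.
  by apply: ccontinuous_mul; [exact: ccontinuous_cst | apply: ccontinuous_exp; exact: cp].
- by apply: ccontinuous_opp; apply: ccontinuous_mul; [exact: cp | exact: cD].
- apply: ccontinuous_mul; last exact: cp.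
  by apply: ccontinuous_mul; [exact: ccontinuous_cst | apply: ccontinuous_exp; exact: cp].
- by apply: ccontinuous_opp; apply: ccontinuous_exp; exact: cD.
Qed.

Hypothesis no_vertical : forall s : R, 0 <= s <= 1 -> no_vertical_square (g s).

(** Parametrises the line a u + a' v = 1 (or a v + a' u = 1, according to [b]) with e = 1 / a and k
    = a' / a. When a is the larger coefficient, k stays in the unit disc, and as a grows e tends to
    0, where the line passes through (0 : 0 : 1). *)
Definition tilted (b : bool) (e k : C) : {poly C} * {poly C} :=
  if b then (e%:P - k *: 'X, 'X) else ('X, e%:P - k *: 'X).

Lemma tilted_obstruction0 b (s : R) k : 0 <= s <= 1 ->
  0 < obstruction (chart_restr (g s) (tilted b 0 k).1 (tilted b 0 k).2).
Proof.
move=> s01; have [_ H] := no_vertical s01.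
have E (u v : C) : (u, v) != (0, 0) ->
    0 < obstruction (chart_restr (g s) (u *: 'X) (v *: 'X)).
  move=> /H uv; apply: obstruction_gt0.
  by rewrite /square_obstruction3 /square_obstruction4 !chart_restr_monomial.
have n1 : (- k, 1 : C) != (0, 0) by apply/negP => /eqP [] _ /eqP; rewrite oner_eq0.
have n2 : (1 : C, - k) != (0, 0) by apply/negP => /eqP [] /eqP; rewrite oner_eq0.
have := E _ _ n1; have := E _ _ n2; rewrite scale1r scaleNr => E2 E1.
by case: b; rewrite /= sub0r.
Qed.

(** At e = 0 the obstruction is positive. Compactness of the range of (s, k) yields one radius [e0]
    for all of them. *)
Lemma tilted_obstruction b : exists2 e0 : R, 0 < e0 &
  forall (s : R) (e k : C), 0 <= s <= 1 -> sqnorm k <= 1 -> sqnorm e <= e0 ^+ 2 ->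
  0 < obstruction (chart_restr (g s) (tilted b e k).1 (tilted b e k).2).
Proof.
pose Y := (R * 'rV[R]_(1 + 1))%type.
pose c (v : 'rV[R]_(1 + 1)) : C := complex_row v 0 0.
pose f (x : 'rV[R]_(1 + 1) * Y) : R :=
  obstruction (chart_restr (g x.2.1) (tilted b (c x.1) (c x.2.2)).1
                             (tilted b (c x.1) (c x.2.2)).2).
have c1 : ccontinuous (fun x : 'rV[R]_(1 + 1) * Y => c x.1).
  apply: (@ccontinuous_comp _ _ 'rV[R]_(1 + 1) fst c); last exact: ccontinuous_complex_row.
  exact: continuous_fst.
have c2 : ccontinuous (fun x : 'rV[R]_(1 + 1) * Y => c x.2.2).
  apply: (@ccontinuous_comp _ _ 'rV[R]_(1 + 1) (fun x => x.2.2) c); last exact: ccontinuous_complex_row.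
  by move=> p; apply: (@continuous_comp _ _ _ snd snd); exact: continuous_snd.
have cl : pcontinuous (fun x : 'rV[R]_(1 + 1) * Y => (c x.1)%:P - c x.2.2 *: 'X).
  apply: (@pcontinuous_ext _ _ (fun x => c x.1 *: 1 + - (c x.2.2 *: 'X))).
    by move=> x; rewrite alg_polyC.
  apply: pcontinuous_add.
    by apply: pcontinuous_scale => //; exact: pcontinuous_cst.
  by apply: pcontinuous_opp; apply: pcontinuous_scale => //; exact: pcontinuous_cst.
have cf : continuous f.
  apply: obstruction_continuous; apply: chart_restr_continuous.
  - by move=> p; apply: (@continuous_comp _ _ _ snd fst); [exact: continuous_snd|exact: continuous_fst].
  - by case: (b); [exact: cl | exact: pcontinuous_cst].
  - by case: (b); [exact: pcontinuous_cst | exact: cl].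
have cK : compact (`[0, 1]%classic `*` [set z : 'rV[R]_(1 + 1) | `|z - 0| <= 1] : set Y).
  by apply: compact_setX; [exact: segment_compact | exact: compact_rV_ball].
have : \forall e \near (0 : 'rV[R]_(1 + 1)), forall y : Y,
    (`[0, 1]%classic `*` [set z : 'rV[R]_(1 + 1) | `|z - 0| <= 1]) y -> 0 < f (e, y).
  apply: (@near_compact 'rV[R]_(1 + 1) Y _ 0 (fun p => 0 < f p) cK) => -[s k] [/= s01 _].
  apply: near_gt0 => //; rewrite /f /=.
  have -> : c 0 = 0 by rewrite /c mxE /= !mxE.
  by apply: tilted_obstruction0; move: s01; rewrite in_itv.
move=> /nbhs_ballP [r /= r0 Hr]; exists (r / 2); first by rewrite divr_gt0.
move=> s e k s01 k1 er.
pose vec (a : C) := real_row (\row_(i < 1) a).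
have vecK a : c (vec a) = a by rewrite /c /vec real_rowK mxE.
have := Hr (vec e); rewrite -ball_normE /= sub0r normrN.
have ve : `|vec e| < r.
  apply: (@le_lt_trans _ _ `|r / 2|); last by rewrite gtr0_norm ?divr_gt0 //; lra.
  by apply: norm_real_row_le => i; rewrite mxE.
move=> /(_ ve (s, vec k)); rewrite /f /= !vecK; apply; split=> /=.
  by rewrite in_itv.
rewrite subr0 -[leRHS]normr1; apply: norm_real_row_le => i.
by rewrite mxE expr1n.
Qed.

Lemma tilted_square b (s : R) z e k : square_defect (g s) z = 0 ->
  z 0 0 *: (tilted b e k).1 + z 0 1 *: (tilted b e k).2 = 1 -> e != 0 ->
  obstruction (chart_restr (g s) (tilted b e k).1 (tilted b e k).2) = 0.
Proof.
move=> z0 uv e0; rewrite (chart_restr_square z0) //; last first.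
  case: (b) => /=; last by rewrite polyX_eq0.
  apply/eqP => /(congr1 (fun p => p.[0])); rewrite hornerD hornerN hornerC hornerZ hornerX mulr0 subr0 horner0.
  exact/eqP.
set p := _ + _ + _.
have p3 : (size p <= 3)%N.
  have lin : (size (e%:P - k *: 'X)%R <= 2)%N.
    rewrite (leq_trans (size_polyD _ _)) // geq_max size_polyN.
    rewrite (leq_trans (size_polyC_leq1 _)) //=.
    by rewrite (leq_trans (size_scale_leq _ _)) // size_polyX.
  have [su sv] : (size (tilted b e k).1 <= 2)%N /\ (size (tilted b e k).2 <= 2)%N.
    by case: (b) => /=; rewrite lin size_polyX.
  rewrite /p (leq_trans (size_polyD _ _)) // geq_max; apply/andP; split.
    rewrite (leq_trans (size_polyD _ _)) // geq_max; apply/andP; split;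
      rewrite (leq_trans (size_scale_leq _ _)) //.
      exact: size_line_exp.
    exact: size_mul_bound su sv _.
  by rewrite (leq_trans (size_scale_leq _ _)) //; exact: size_line_exp.
have [o3 o4] := square_obstructions p3.
by rewrite /obstruction o3 o4 /sqnorm /= expr0n !addr0.
Qed.

(** Let a be the larger of the two coefficients of the line. If |a| exceeded 1 / [e0], then e = 1 /
    a would lie where the obstruction is positive, although the restriction of f to the line is a
    square. *)
Lemma lines_bounded : exists A : R, forall (s : R) z, 0 <= s <= 1 ->
  square_defect (g s) z = 0 -> sqnorm (z 0 0) <= A ^+ 2 /\ sqnorm (z 0 1) <= A ^+ 2.
Proof.
have [e1 e1_gt0 H1] := tilted_obstruction true.
have [e2 e2_gt0 H2] := tilted_obstruction false.
have key b (e0 : R) : 0 < e0 -> (forall (s : R) (e k : C), 0 <= s <= 1 ->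
    sqnorm k <= 1 -> sqnorm e <= e0 ^+ 2 ->
    0 < obstruction (chart_restr (g s) (tilted b e k).1 (tilted b e k).2)) ->
  forall (s : R) z (a a' : C), 0 <= s <= 1 -> square_defect (g s) z = 0 ->
  (if b then (z 0 0, z 0 1) else (z 0 1, z 0 0)) = (a, a') ->
  sqnorm a' <= sqnorm a -> sqnorm a <= (e0^-1) ^+ 2.
  move=> e0_gt0 H s z a a' s01 z0 ab aa'; rewrite leNgt; apply/negP => ha.
  have sa : 0 < sqnorm a by apply: le_lt_trans ha; exact: sqr_ge0.
  have a0 : a != 0 by rewrite -sqnorm_gt0.
  have sV : sqnorm a^-1 = (sqnorm a)^-1.
    apply: (mulIf (lt0r_neq0 sa)); rewrite -sqnormM mulVf // mulVf ?gt_eqF //.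
    by rewrite /sqnorm /= expr1n expr0n addr0.
  have := H s a^-1 (a' / a) s01; rewrite (tilted_square z0) ?invr_eq0 //; last first.
    move: ab; case: (b) => -[-> ->] /=.
      by rewrite scalerBr scalerA mulrC divfK // subrK -mul_polyC -polyCM divff.
    by rewrite addrC scalerBr scalerA mulrC divfK // subrK -mul_polyC -polyCM divff.
  rewrite ltxx => H0; suff : false by []; apply: H0; rewrite ?sqnormM sV.
    by rewrite ler_pdivrMr // mul1r.
  by rewrite -[leRHS]invrK lef_pV2 ?posrE ?invr_gt0 ?exprn_gt0 // -exprVn ltW.
exists (e1^-1 + e2^-1) => s z s01 z0.
have p1 : 0 < e1^-1 by rewrite invr_gt0.
have p2 : 0 < e2^-1 by rewrite invr_gt0.
have [le|/ltW le] := leP (sqnorm (z 0 1)) (sqnorm (z 0 0)).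
  have := key true e1 e1_gt0 H1 s z _ _ s01 z0 erefl le; split; nra.
have := key false e2 e2_gt0 H2 s z _ _ s01 z0 erefl le; split; nra.
Qed.

(** Once the line is bounded, so are the coefficients of q^2. These bound the outer coefficients of
    q directly and the middle one through the coefficient of degree 2. *)
Lemma zeros_bounded : exists B : R, forall (s : R) z, 0 <= s <= 1 ->
  square_defect (g s) z = 0 -> forall i, sqnorm (z 0 i) <= B ^+ 2.
Proof.
have [A HA] := lines_bounded.
pose Y := (R * 'rV[R]_(2 + 2))%type.
pose l (y : Y) : {poly C} := (complex_row y.2 0 0)%:P + complex_row y.2 0 1 *: 'X.
pose f (y : Y) : R := \sum_(j < 5) sqnorm ((chart_quartic (g y.1) (l y))`_j).
have cc i : ccontinuous (fun y : Y => complex_row y.2 0 i).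
  apply: (@ccontinuous_comp _ _ 'rV[R]_(2 + 2) snd (fun v => complex_row v 0 i)).
    exact: continuous_snd.
  exact: ccontinuous_complex_row.
have cf : continuous f.
  apply: continuous_sum => j _; apply: continuous_sqnorm.
  apply: chart_quartic_continuous; first exact: continuous_fst.
  apply: (@pcontinuous_ext _ _ (fun y : Y => complex_row y.2 0 0 *: 1 + complex_row y.2 0 1 *: 'X)).
    by move=> x; rewrite alg_polyC.
  by apply: pcontinuous_add; apply: pcontinuous_scale => //; exact: pcontinuous_cst.
pose K : set Y := `[0, 1]%classic `*` [set z : 'rV[R]_(2 + 2) | `|z - 0| <= `|A|].
have cK : compact K.
  by apply: compact_setX; [exact: segment_compact | exact: compact_rV_ball].
have [N HN] : exists N : R, forall y, K y -> f y <= N.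
  have [y0|nK] := pselect (K !=set0).
    have [c _ Hc] := compact_EVT_max y0 cK (continuous_subspaceT cf).
    by exists (f c) => y Ky; apply: Hc; rewrite inE.
  by exists 0 => y Ky; case: nK; exists y.
have N0 (s : R) z : 0 <= s <= 1 -> square_defect (g s) z = 0 ->
    forall j, (j < 5)%N -> sqnorm ((conic_poly z ^+ 2)`_j) <= N.
  move=> s01 z0 j j5; have [h1 h2] := HA s z s01 z0.
  pose w := real_row (\row_(i < 2) z 0 (widen_ord (isT : (2 <= 5)%N) i)).
  have Kw : K (s, w).
    split; first by rewrite /= in_itv.
    rewrite /= subr0; apply: norm_real_row_le => i; rewrite mxE.
    by case: i => [[|[|i]] hi] //;
      [rewrite (_ : widen_ord _ _ = 0) | rewrite (_ : widen_ord _ _ = 1)] => //; apply/val_inj.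
  have lw : l (s, w) = line_poly z.
    rewrite line_polyE /l /w /= real_rowK !mxE.
    by congr ((z 0 _)%:P + z 0 _ *: 'X); apply/val_inj.
  apply: le_trans (HN _ Kw); rewrite /f /= lw; move/square_defect_eq0: z0 => ->.
  rewrite (bigD1 (Ordinal j5)) //= lerDl.
  by apply: sumr_ge0 => i _; exact: sqnorm_ge0.
(* [P] bounds the squared moduli of the outer coefficients of q and [Q] that of the middle one. The
   summands 1 come from the crude step from x^2 <= M to x <= M + 1; they also give P, Q >= 1, so
   that the square of the final constant dominates both. *)
pose P := N + 1.
pose Q := 2 * (N + 4 * (P * P)) + 1.
have sq (x : C) (M : R) : sqnorm (x ^+ 2) <= M -> sqnorm x <= M + 1.
  by rewrite expr2 sqnormM => H; have := sqnorm_ge0 x; nra.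
exists (`|A| + P + Q) => s z s01 z0.
have [h1 h2] := HA s z s01 z0; have h3 := N0 s z s01 z0.
have [e0 e1 e2 e3 e4] := coef_square (size_conic_poly z).
have cE : (conic_poly z)`_0 = z 0 (inord 2) /\ (conic_poly z)`_1 = z 0 (inord 3) /\
    (conic_poly z)`_2 = z 0 (inord 4).
  by rewrite conic_polyE !coefE /= !mulr0 !mulr1 !addr0 !add0r.
case: cE => c0 [c1 c2]; rewrite c0 c1 c2 in e0 e1 e2 e3 e4.
have b2 : sqnorm (z 0 (inord 2)) <= P by apply: sq; rewrite -e0; exact: h3.
have b4 : sqnorm (z 0 (inord 4)) <= P by apply: sq; rewrite -e4; exact: h3.
have b3 : sqnorm (z 0 (inord 3)) <= Q.
  apply: sq.
  have -> : z 0 (inord 3) ^+ 2 = (conic_poly z ^+ 2)`_2 + (- 2) * (z 0 (inord 2) * z 0 (inord 4)).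
    by rewrite e2; ring.
  apply: le_trans (sqnorm_le2 _ _) _; rewrite ler_wpM2l // lerD //; first exact: h3.
  rewrite !sqnormM; have -> : sqnorm (- 2 : C) = 4.
    by rewrite /sqnorm /= ; ring.
  by rewrite ler_wpM2l // ler_pM // sqnorm_ge0.
have Nge0 : 0 <= N by apply: le_trans (h3 0%N isT); exact: sqnorm_ge0.
have P1 : 1 <= P by rewrite lerDr.
have Q1 : 1 <= Q.
  by rewrite lerDr mulr_ge0 // addr_ge0 // mulr_ge0 // mulr_ge0 // (le_trans ler01).
have A0 : 0 <= `|A| by [].
have AA : A ^+ 2 = `|A| ^+ 2 by rewrite real_normK // num_real.
case => [[|[|[|[|[|i]]]]] hi] //.
- rewrite (_ : Ordinal hi = 0); last exact/val_inj.
  nra.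
- rewrite (_ : Ordinal hi = 1); last exact/val_inj.
  nra.
- rewrite (_ : Ordinal hi = inord 2); last by apply/val_inj; rewrite /= inordK.
  nra.
- rewrite (_ : Ordinal hi = inord 3); last by apply/val_inj; rewrite /= inordK.
  nra.
- rewrite (_ : Ordinal hi = inord 4); last by apply/val_inj; rewrite /= inordK.
  nra.
Qed.

Hypothesis slope_unit : forall (s : R) z, 0 <= s <= 1 -> square_defect (g s) z = 0 ->
  defect_slope (g s) z z \in unitmx.

Lemma chart_transport k :
  (exists w : 'I_k -> 'rV[C]_5, injective w /\ forall i, square_defect (g 0) (w i) = 0) ->
  exists w : 'I_k -> 'rV[C]_5, injective w /\ forall i, square_defect (g 1) (w i) = 0.
Proof.
have [B HB] := zeros_bounded.
apply: (zeros_transport (G := fun s => square_defect (g s))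
  (M := fun s => defect_slope (g s)) _ _ _ _ HB).
- exact: square_defect_continuous.
- exact: defect_slope_continuous.
- by move=> s z z'; exact: square_defectB.
- exact: slope_unit.
Qed.

End Family.

End ChartTransport.

(** * Cross products and quartic forms in three variables *)

Lemma sum3 (V : nmodType) (F : 'I_3 -> V) : \sum_i F i = F 0 + F 1 + F 2.
Proof.
rewrite !big_ord_recl big_ord0 addr0 addrA.
by congr (F _ + F _ + F _); apply/val_inj.
Qed.

Lemma prod3 (V : pzSemiRingType) (F : 'I_3 -> V) : \prod_i F i = F 0 * F 1 * F 2.
Proof.
rewrite !big_ord_recl big_ord0 mulr1 mulrA.
by congr (F _ * F _ * F _); apply/val_inj.
Qed.

Lemma ord3P (P : 'I_3 -> Prop) : P 0 -> P 1 -> P 2 -> forall i, P i.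
Proof.
move=> P0 P1 P2 [[|[|[|i]]] hi] //.
- by rewrite (_ : Ordinal hi = 0) //; apply/val_inj.
- by rewrite (_ : Ordinal hi = 1) //; apply/val_inj.
- by rewrite (_ : Ordinal hi = 2) //; apply/val_inj.
Qed.

Section Vectors.
Variable C : fieldType.
Implicit Types u v w x : 'rV[C]_3.

Definition vec3 (a b c : C) : 'rV[C]_3 := \row_i nth 0 [:: a; b; c] i.
Definition dot3 u v : C := \sum_i u 0 i * v 0 i.
Definition cross u v : 'rV[C]_3 :=
  vec3 (u 0 1 * v 0 2 - u 0 2 * v 0 1) (u 0 2 * v 0 0 - u 0 0 * v 0 2)
       (u 0 0 * v 0 1 - u 0 1 * v 0 0).

Lemma vec3E a b c : (vec3 a b c 0 0 = a) * (vec3 a b c 0 1 = b) * (vec3 a b c 0 2 = c).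
Proof. by rewrite !mxE. Qed.

Lemma dot3E u v : dot3 u v = u 0 0 * v 0 0 + u 0 1 * v 0 1 + u 0 2 * v 0 2.
Proof. exact: sum3. Qed.

Lemma crossE u v : (cross u v 0 0 = u 0 1 * v 0 2 - u 0 2 * v 0 1) *
  (cross u v 0 1 = u 0 2 * v 0 0 - u 0 0 * v 0 2) *
  (cross u v 0 2 = u 0 0 * v 0 1 - u 0 1 * v 0 0).
Proof. by rewrite !vec3E. Qed.

Lemma rV3P u v : u 0 0 = v 0 0 -> u 0 1 = v 0 1 -> u 0 2 = v 0 2 -> u = v.
Proof. by move=> h0 h1 h2; apply/rowP; apply: ord3P. Qed.

Lemma rV3_neq0 u : u != 0 -> exists i, u 0 i != 0.
Proof.
move=> u0; apply/existsP; apply: contraNT u0; rewrite negb_exists => /forallP h.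
by apply/eqP/rowP => i; rewrite mxE; apply/eqP; have := h i; rewrite negbK.
Qed.

Lemma meval_linform u v : (linform u).@[v 0] = dot3 u v.
Proof. by rewrite /linform raddf_sum; apply: eq_bigr => i _; rewrite /= mevalZ mevalXU. Qed.

Lemma dot3C u v : dot3 u v = dot3 v u.
Proof. by apply: eq_bigr => i _; rewrite mulrC. Qed.

Lemma dot3Dr u v w : dot3 u (v + w) = dot3 u v + dot3 u w.
Proof. by rewrite -big_split; apply: eq_bigr => i _; rewrite mxE mulrDr. Qed.

Lemma dot3Zr (a : C) u v : dot3 u (a *: v) = a * dot3 u v.
Proof. by rewrite mulr_sumr; apply: eq_bigr => i _; rewrite mxE mulrCA. Qed.

Lemma crossDr u v w : cross u (v + w) = cross u v + cross u w.
Proof. by apply: rV3P; rewrite !mxE /=; ring. Qed.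

Lemma crossZr (a : C) u v : cross u (a *: v) = a *: cross u v.
Proof. by apply: rV3P; rewrite !mxE /=; ring. Qed.

Lemma crossZl (a : C) u v : cross (a *: u) v = a *: cross u v.
Proof. by apply: rV3P; rewrite !mxE /=; ring. Qed.

Lemma crossNC u v : cross u v = - cross v u.
Proof. by apply: rV3P; rewrite !mxE /=; ring. Qed.

Lemma crossvv u : cross u u = 0.
Proof. by apply: rV3P; rewrite !mxE /=; ring. Qed.

Lemma dot3_cross_l u v : dot3 u (cross u v) = 0.
Proof. by rewrite dot3E !crossE; ring. Qed.

Lemma dot3_cross u v w : dot3 u (cross v w) = dot3 (cross u v) w.
Proof. by rewrite !dot3E !crossE; ring. Qed.

Lemma cross_cross u v w : cross u (cross v w) = dot3 u w *: v - dot3 u v *: w.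
Proof. by apply: rV3P; rewrite !crossE dot3E !mxE; rewrite dot3E; ring. Qed.

Lemma dot3_eq0 u : (forall v, dot3 u v = 0) -> u = 0.
Proof.
move=> H; apply: rV3P; rewrite mxE.
- by have := H (vec3 1 0 0); rewrite dot3E !vec3E !mulr0 mulr1 !addr0.
- by have := H (vec3 0 1 0); rewrite dot3E !vec3E !mulr0 mulr1 addr0 add0r.
- by have := H (vec3 0 0 1); rewrite dot3E !vec3E !mulr0 mulr1 !add0r.
Qed.

Lemma cross_eq0 u v : cross u v = 0 -> u != 0 -> exists c, v = c *: u.
Proof.
move=> H /rV3_neq0 [i ui]; exists (v 0 i / u 0 i).
apply/rowP => j; rewrite mxE; apply: (mulIf ui); rewrite mulrAC divfK //.
have h0 : u 0 1 * v 0 2 = u 0 2 * v 0 1.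
  by apply/eqP; rewrite -subr_eq0 -(crossE u v).1.1 H mxE.
have h1 : u 0 2 * v 0 0 = u 0 0 * v 0 2.
  by apply/eqP; rewrite -subr_eq0 -(crossE u v).1.2 H mxE.
have h2 : u 0 0 * v 0 1 = u 0 1 * v 0 0.
  by apply/eqP; rewrite -subr_eq0 -(crossE u v).2 H mxE.
move: i {ui}; apply: ord3P; move: j; apply: ord3P => //; first
  [by rewrite mulrC h0 mulrC | by rewrite mulrC h1 mulrC | by rewrite mulrC h2 mulrC
  | by rewrite mulrC -h0 mulrC | by rewrite mulrC -h1 mulrC | by rewrite mulrC -h2 mulrC | by rewrite mulrC].
Qed.

Lemma cross_orthogonal u x : u != 0 -> dot3 u x = 0 -> exists m, x = cross u m.
Proof.
move=> u0 ux.
have [v uv] : exists v, dot3 u v != 0.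
  case: (rV3_neq0 u0) => i ui; exists (delta_mx 0 i); rewrite /dot3 (bigD1 i) //= big1 ?addr0.
    by rewrite mxE !eqxx mulr1.
  by move=> j /negbTE ji; rewrite mxE eqxx ji mulr0.
exists ((dot3 u v)^-1 *: cross x v).
by rewrite crossZr cross_cross ux scale0r subr0 scalerA mulVf // scale1r.
Qed.

End Vectors.

Lemma sum_exp4_triples (V : comPzRingType) (F : nat -> nat -> nat -> V) :
  \sum_(t <- exp4_triples) F t.1.1 t.1.2 t.2 =
  \sum_(k < 5) \sum_(j < 5 - k) F (4 - k - j)%N j k.
Proof.
rewrite /exp4_triples /= !big_cons big_nil !big_ord_recl !big_ord0 /=.
ring.
Qed.

Section QuarticForms.
Variable C : numClosedFieldType.
Implicit Types f : {mpoly C[3]}.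

Definition chart_coefs f (k j : nat) : C := f@_(mnm3 (4 - k - j) j k).

Lemma mevalX_mnm3 (v : 'I_3 -> C) i j k :
  'X_[mnm3 i j k].@[v] = v 0 ^+ i * v 1 ^+ j * v 2 ^+ k.
Proof. by rewrite mevalX prod3 !mnmE. Qed.

Lemma meval_quartic f (v : 'I_3 -> C) : f \is 4.-homog ->
  f.@[v] = \sum_(k < 5) \sum_(j < 5 - k)
    chart_coefs f k j * (v 0 ^+ (4 - k - j) * v 1 ^+ j * v 2 ^+ k).
Proof.
move=> hf; rewrite {1}(mpoly_exps hf) raddf_sum /=.
under eq_bigr do rewrite mevalZ.
rewrite exps4E big_map.
under eq_bigr do rewrite mevalX_mnm3.
exact: (sum_exp4_triples (fun i j k => f@_(mnm3 i j k) * (v 0 ^+ i * v 1 ^+ j * v 2 ^+ k))).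
Qed.

End QuarticForms.

Lemma mpoly_ring_ind (R : comNzRingType) n (P : {mpoly R[n]} -> Prop) :
  (forall c, P c%:MP) -> (forall i, P 'X_i) ->
  (forall p q, P p -> P q -> P (p + q)) -> (forall p q, P p -> P q -> P (p * q)) ->
  forall p, P p.
Proof.
move=> Pc PX PD PM p; rewrite [p]mpolyE; apply: (big_ind P) => //.
  by rewrite -mpolyC0.
move=> m _; rewrite -mul_mpolyC; apply: (PM) => //.
rewrite mpolyXE_id; apply: (big_ind P) => // [|i _]; first by rewrite -mpolyC1.
elim: (m i) => [|k IH]; first by rewrite expr0 -mpolyC1.
by rewrite exprS; exact: PM.
Qed.

Lemma coef1_deriv (R : comNzRingType) (p : {poly R}) : p`_1 = p^`().[0].
Proof. by rewrite horner_coef0 coef_deriv mulr1n. Qed.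

Lemma coef1_XaddC_exp (R : comNzRingType) (c : R) n :
  (('X + c%:P) ^+ n)`_1 = n%:R * c ^+ n.-1.
Proof.
rewrite coef1_deriv deriv_exp derivD derivX derivC addr0 mul1r hornerMn horner_exp.
by rewrite hornerD hornerX hornerC add0r mulr_natl.
Qed.

(** * Restriction to lines, first derivatives and Euler's relation *)

Section Restriction.
Variable C : numClosedFieldType.
Implicit Types (f : {mpoly C[3]}) (x r v : 'rV[C]_3).

Lemma line_restr_horner n (F : {mpoly C[n]}) (x r : 'I_n -> C) t :
  (mmap polyC (fun i => (x i)%:P + r i *: 'X) F).[t] = F.@[fun i => x i + t * r i].
Proof.
elim/mpoly_ring_ind: F => [c|i|p q IHp IHq|p q IHp IHq].
- by rewrite mmapC hornerC mevalC.
- by rewrite mmapX mmap1U mevalXU hornerD hornerC hornerZ hornerX mulrC.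
- by rewrite mmapD hornerD IHp IHq mevalD.
- by rewrite rmorphM /= hornerM IHp IHq mevalM.
Qed.

Lemma line_restr_deriv n (F : {mpoly C[n]}) (x r : 'I_n -> C)
    (L := fun i => (x i)%:P + r i *: 'X) :
  (mmap polyC L F)^`() = \sum_i r i *: mmap polyC L F^`M(i).
Proof.
elim/mpoly_ring_ind: F => [c|i|p q IHp IHq|p q IHp IHq].
- rewrite mmapC derivC big1 // => i _; by rewrite mderivC raddf0 scaler0.
- rewrite mmapX mmap1U derivD derivC derivZ derivX add0r (bigD1 i) //= big1.
    rewrite mderivX mnm1E eqxx (_ : (U_(i) - U_(i) = 0)%MM); last first.
      by apply/mnmP => j; rewrite mnmBE subnn mnm0E.
    by rewrite mpolyX0 scale1r rmorph1 addr0.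
  by move=> j ji; rewrite mderivX mnm1E eq_sym (negbTE ji) scale0r raddf0 scaler0.
- rewrite mmapD derivD IHp IHq -big_split; apply: eq_bigr => i _ /=.
  by rewrite mderivD mmapD scalerDr.
- rewrite rmorphM /= derivM IHp IHq mulr_suml mulr_sumr -big_split; apply: eq_bigr => i _ /=.
  by rewrite mderivM mmapD !rmorphM /= scalerDr -!scalerAl -scalerAr.
Qed.

Lemma line_restr_coef1 n (F : {mpoly C[n]}) (x r : 'I_n -> C) :
  (mmap polyC (fun i => (x i)%:P + r i *: 'X) F)`_1 = \sum_i r i * (F^`M(i)).@[x].
Proof.
rewrite coef1_deriv line_restr_deriv horner_sum; apply: eq_bigr => i _.
rewrite hornerZ line_restr_horner; congr (_ * _); apply: meval_eq => j.
by rewrite mul0r addr0.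
Qed.

Lemma restr_horner f x r t : (restr f x r).[t] = f.@[(x + t *: r) 0].
Proof. by rewrite /restr line_restr_horner; apply: meval_eq => i; rewrite !mxE. Qed.

Lemma restr_coef0 f x r : (restr f x r)`_0 = f.@[x 0].
Proof. by rewrite -horner_coef0 restr_horner scale0r addr0. Qed.

Lemma restr_coef1 f x r : (restr f x r)`_1 = \sum_i r 0 i * (f^`M(i)).@[x 0].
Proof. exact: line_restr_coef1. Qed.

Lemma meval_homogZ d f v (c : C) : f \is d.-homog ->
  f.@[(c *: v) 0] = c ^+ d * f.@[v 0].
Proof.
move=> hf; rewrite (mpoly_exps hf) !raddf_sum mulr_sumr big_seq [RHS]big_seq.
apply: eq_bigr => m; rewrite mem_exps => /eqP md /=; rewrite !mevalZ !mevalX mulrCA; congr (_ * _).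
rewrite -md mdegE -prodrXr -big_split; apply: eq_bigr => i _ /=.
by rewrite mxE exprMn.
Qed.

Lemma euler_quartic f v : f \is 4.-homog ->
  \sum_i v 0 i * (f^`M(i)).@[v 0] = 4 * f.@[v 0].
Proof.
move=> hf; rewrite -restr_coef1.
have -> : restr f v v = f.@[v 0] *: (1 + 'X) ^+ 4.
  apply: (@poly_fun_eq _ _ _ 1); first exact: oner_neq0.
  move=> t _; rewrite restr_horner hornerZ horner_exp hornerD hornerC hornerX.
  by rewrite -{1}[v]scale1r -scalerDl (meval_homogZ _ _ hf) mulrC.
by rewrite coefZ addrC -polyC1 coef1_XaddC_exp expr1n mulr1 mulrC.
Qed.

Lemma partial_homogZ f v (c : C) i : f \is 4.-homog -> c != 0 ->
  (f^`M(i)).@[(c *: v) 0] = c ^+ 3 * (f^`M(i)).@[v 0].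
Proof.
move=> hf c0; pose r : 'rV[C]_3 := delta_mx 0 i.
have P (x : 'rV[C]_3) (a : C) : \sum_j (a *: r) 0 j * (f^`M(j)).@[x 0] = a * (f^`M(i)).@[x 0].
  rewrite (bigD1 i) //= big1 ?addr0; first by rewrite !mxE !eqxx mulr1.
  by move=> j /negbTE ji; rewrite !mxE eqxx ji mulr0 mul0r.
have E1 := restr_coef1 f (c *: v) (c *: r); rewrite P in E1.
have E2 := restr_coef1 f v (1 *: r); rewrite P mul1r scale1r in E2.
apply: (mulfI c0); rewrite -E1 -E2.
have -> : restr f (c *: v) (c *: r) = c ^+ 4 *: restr f v r.
  apply: (@poly_fun_eq _ _ _ 1); first exact: oner_neq0.
  move=> t _; rewrite hornerZ !restr_horner scalerA mulrC -scalerA -scalerDr.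
  exact: meval_homogZ.
rewrite coefZ; ring.
Qed.

Definition smooth f := forall v, v != 0 -> exists i, (f^`M(i)).@[v 0] != 0.

End Restriction.

(** * Smoothness makes the linearised square system invertible *)

Section ChartEvaluation.
Variable C : numClosedFieldType.
Variable f : {mpoly C[3]}.
Hypothesis hf : f \is 4.-homog.
Local Notation g := (chart_coefs f).
Implicit Types (h : {poly C}) (t : C).

Lemma chart_quartic_horner h t : (chart_quartic g h).[t] = f.@[vec3 1 t h.[t] 0].
Proof.
rewrite (meval_quartic _ hf) /chart_quartic horner_sum; apply: eq_bigr => k _.
rewrite hornerM horner_exp horner_poly mulr_suml; apply: eq_bigr => j _.
by rewrite !vec3E expr1n mul1r mulrA.
Qed.

Lemma chart_restr_horner (u v : {poly C}) t :
  (chart_restr g u v).[t] = f.@[vec3 u.[t] v.[t] 1 0].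
Proof.
rewrite (meval_quartic _ hf) /chart_restr horner_sum; apply: eq_bigr => k _.
rewrite horner_sum; apply: eq_bigr => j _.
by rewrite hornerZ hornerM !horner_exp !vec3E expr1n mulr1.
Qed.

Lemma chart_slope_horner h t : (chart_slope g h h).[t] = (f^`M(2)).@[vec3 1 t h.[t] 0].
Proof.
have -> : (f^`M(2)).@[vec3 1 t h.[t] 0] = (restr f (vec3 1 t h.[t]) (vec3 0 0 1))`_1.
  by rewrite restr_coef1 sum3 !vec3E !mul0r mul1r !add0r.
have -> : restr f (vec3 1 t h.[t]) (vec3 0 0 1) =
    \sum_(k < 5) (chart_coef g k).[t] *: ('X + h.[t]%:P) ^+ k.
  apply: (@poly_fun_eq _ _ _ 1); first exact: oner_neq0.
  move=> s _; rewrite restr_horner (meval_quartic _ hf) horner_sum; apply: eq_bigr => k _.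
  rewrite hornerZ horner_exp hornerD hornerX hornerC horner_poly mulr_suml; apply: eq_bigr => j _.
  by rewrite !mxE /= mulr0 !addr0 mulr1 expr1n mul1r mulrA [s + _]addrC.
rewrite coef_sum /chart_slope horner_sum; apply: eq_bigr => k _.
rewrite coefZ coef1_XaddC_exp hornerM; congr (_ * _); rewrite horner_sum.
under eq_bigr => i _ do rewrite hornerM !horner_exp -exprD.
rewrite (eq_bigr (fun=> h.[t] ^+ k.-1)) => [|i _]; last first.
  by congr (_ ^+ _); have := ltn_ord i; lia.
by rewrite sumr_const card_ord mulr_natl.
Qed.

(** The slope has degree at most 3, so its top coefficient is the value of the cubic form at the
    point at infinity (0 : 1 : b) of the line. The proof reverses the polynomial by the parameter s
    = 1 / t. *)
Lemma chart_slope_coef3 (a b : C) (h := a%:P + b *: 'X) :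
  (chart_slope g h h)`_3 = (f^`M(2)).@[vec3 0 1 b 0].
Proof.
set c := chart_slope g h h.
have sc : (size c <= 4)%N.
  apply: size_chart_slope; rewrite (leq_trans (size_polyD _ _)) // geq_max;
  by rewrite (leq_trans (size_polyC_leq1 _)) //= (leq_trans (size_scale_leq _ _)) // size_polyX.
have E : restr f^`M(2) (vec3 0 1 b) (vec3 1 0 a) = \sum_(j < 4) c`_j *: 'X^(3 - j).
  apply: (@poly_fun_eq _ _ _ 'X); first by rewrite polyX_eq0.
  move=> s; rewrite hornerX => s0; rewrite restr_horner.
  have -> : vec3 0 1 b + s *: vec3 1 0 a = s *: vec3 1 s^-1 (a + b * s^-1).
    by apply: rV3P; rewrite !mxE /=; field.
  rewrite partial_homogZ // -/(f^`M(2)).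
  have -> : a + b * s^-1 = h.[s^-1] by rewrite hornerD hornerC hornerZ hornerX.
  rewrite -chart_slope_horner -/c (horner_coef_wide _ sc) mulr_sumr horner_sum.
  apply: eq_bigr => j _; rewrite hornerZ hornerXn exprVn.
  have -> : s ^+ 3 = s ^+ (3 - j) * s ^+ j by rewrite -exprD subnK // -ltnS.
  by field; rewrite expf_neq0.
have := congr1 (fun p => p.[0]) E; rewrite restr_horner scale0r addr0 => ->.
rewrite horner_sum (bigD1 (Ordinal (isT : (3 < 4)%N))) //= big1 ?addr0.
  by rewrite hornerZ hornerXn expr0 mulr1.
by case=> [[|[|[|[|j]]]] hj] // _; rewrite hornerZ hornerXn /= expr0n /= mulr0.
Qed.

(* A zero of the square system at which the curve were not transversal to the
   pencil through (0 : 0 : 1) would be a singular point. *)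
Lemma smooth_slope_unit z : smooth f -> square_defect g z = 0 ->
  defect_slope g z z \in unitmx.
Proof.
move=> sm /square_defect_eq0 E; apply: defect_slope_unit.
  (* At a root of q the restriction of f to the line vanishes doubly, so the derivative along the
     line is zero. Together with [d2] this kills the partial in x_1, and Euler's relation then kills
     the partial in x_0. *)
  move=> t qt; rewrite chart_slope_horner; apply/negP => /eqP d2.
  set P := vec3 1 t _ in d2.
  have R : restr f P (vec3 0 1 (z 0 1)) = (conic_poly z ^+ 2) \Po ('X + t%:P).
    apply: (@poly_fun_eq _ _ _ 1); first exact: oner_neq0.
    move=> s _; rewrite restr_horner horner_comp -E chart_quartic_horner.
    rewrite hornerD hornerX hornerC; congr (f.@[(_ : 'rV_3) 0]).
    by rewrite line_polyE !(hornerD, hornerC, hornerZ, hornerX); apply: rV3P;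
      rewrite !mxE /= ?line_polyE ?(hornerD, hornerC, hornerZ, hornerX); ring.
  have Rd : (restr f P (vec3 0 1 (z 0 1)))^`().[0] = 0.
    rewrite R deriv_comp hornerM horner_comp deriv_exp /= hornerMn hornerM.
    rewrite hornerD hornerX hornerC add0r.
    by move: qt; rewrite /root => /eqP ->; rewrite mulr0 mul0rn mul0r.
  have := restr_coef1 f P (vec3 0 1 (z 0 1)).
  rewrite coef1_deriv Rd.
  rewrite sum3 !vec3E d2 mul0r mul1r mulr0 add0r addr0 => /esym d1.
  have := euler_quartic P hf; rewrite sum3 !vec3E d1 d2 !mulr0 !addr0 mul1r.
  rewrite /P -chart_quartic_horner E horner_exp.
  move: qt; rewrite /root => /eqP ->; rewrite expr0n mulr0 => d0.
  have [|i] := sm P.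
    by apply/eqP => /rowP /(_ 0); rewrite vec3E mxE => /eqP; rewrite oner_eq0.
  by move: i; apply: ord3P; rewrite ?d0 ?d1 ?d2 eqxx.
(* The same argument at the point at infinity, where q of degree below 2 has its root; the parameter
   is now s = 1 / t. *)
move=> q2; rewrite line_polyE chart_slope_coef3; apply/negP => /eqP d2.
set P := vec3 0 1 _ in d2.
set l := conic_poly z in q2 E.
have lE : l = (l`_0)%:P + l`_1 *: 'X.
  have : (size l <= 2)%N.
    have s3 := size_conic_poly z; rewrite leqNgt; apply/negP => s2.
    have sl : size l = 3%N by apply/eqP; rewrite eqn_leq s3.
    have : lead_coef l = 0 by rewrite /lead_coef sl.
    by move/eqP; rewrite lead_coef_eq0 => /eqP l0; rewrite l0 size_poly0 in sl.
  move=> s2; apply/polyP => -[|[|j]]; rewrite coefD coefC coefZ coefX /= ?mulr0 ?mulr1 ?addr0 ?add0r //.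
  by rewrite nth_default // (leq_trans s2).
have lh t : l.[t] = l`_0 + l`_1 * t.
  by rewrite {1}lE hornerD hornerC hornerZ hornerX.
have R : restr f P (vec3 1 0 (z 0 0)) = 'X^2 * (l`_0 *: 'X + (l`_1)%:P) ^+ 2.
  apply: (@poly_fun_eq _ _ _ 'X); first by rewrite polyX_eq0.
  move=> s; rewrite hornerX => s0; rewrite restr_horner.
  have -> : P + s *: vec3 1 0 (z 0 0) = s *: vec3 1 s^-1 (line_poly z).[s^-1].
    by apply: rV3P; rewrite line_polyE hornerD hornerC hornerZ hornerX !mxE /=; field.
  rewrite (meval_homogZ _ _ hf) -chart_quartic_horner E horner_exp lh.
  by rewrite !(hornerM, horner_exp, hornerD, hornerC, hornerZ, hornerX, hornerXn); field.
have Rd : (restr f P (vec3 1 0 (z 0 0)))`_0 = 0 /\ (restr f P (vec3 1 0 (z 0 0)))`_1 = 0.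
  by rewrite R !coefXnM.
case: Rd; rewrite restr_coef0 restr_coef1 sum3 !vec3E d2 => fP.
rewrite mul1r mul0r mulr0 !addr0 => d0.
have := euler_quartic P hf; rewrite sum3 !vec3E fP d0 d2 !mulr0 addr0 add0r mul1r => d1.
have [|i] := sm P.
  by apply/eqP => /rowP /(_ 1); rewrite vec3E mxE => /eqP; rewrite oner_eq0.
by move: i; apply: ord3P; rewrite ?d0 ?d1 ?d2 eqxx.
Qed.

End ChartEvaluation.

(** * Bitangents as lines on which the quartic is a square *)

Section RowVectors.
Variable C : fieldType.
Implicit Types u v x r p : 'rV[C]_3.

Lemma crossDl u v x : cross (u + v) x = cross u x + cross v x.
Proof. by apply: rV3P; rewrite !mxE /=; ring. Qed.

Lemma cross0r u : cross u 0 = 0.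
Proof. by rewrite -[X in cross u X](scale0r (0 : 'rV_3)) crossZr scale0r. Qed.

Lemma cross0l u : cross 0 u = 0.
Proof. by rewrite crossNC cross0r oppr0. Qed.

Lemma row_free_col_mx2 x r : row_free (col_mx x r) = (cross x r != 0).
Proof.
apply/idP/idP => [fr|xr0].
  have inj (a b : C) : a *: x + b *: r = 0 -> a = 0 /\ b = 0.
    move=> E; have : row_mx a%:M b%:M *m col_mx x r = (0 : 'rV_(1 + 1)) *m col_mx x r.
      by rewrite mul_row_col !mul_scalar_mx E mul0mx.
    move/(row_free_inj fr) => E2.
    have := congr1 lsubmx E2; have := congr1 rsubmx E2; rewrite row_mxKl row_mxKr !linear0.
    by move=> /rowP /(_ 0) + /rowP /(_ 0); rewrite !mxE /= !mulr1n.
  apply/eqP => xr; have [x0|x0] := eqVneq x 0.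
    by have [|/eqP] := inj 1 0; rewrite ?x0 ?scaler0 ?scale0r ?addr0 // oner_eq0.
  have [c rc] := cross_eq0 xr x0.
  by have [|_ /eqP] := inj (- c) 1; rewrite ?scale1r ?rc ?scaleNr ?addNr // oner_eq0.
rewrite -kermx_eq0; apply/rowV0P => w /sub_kermxP.
rewrite -[w]hsubmxK (mx11_scalar (lsubmx w)) (mx11_scalar (rsubmx w)).
set a := lsubmx w 0 0; set b := rsubmx w 0 0.
rewrite mul_row_col !mul_scalar_mx => E.
have ab (c : C) : c *: cross x r = 0 -> c = 0.
  by move/eqP; rewrite scaler_eq0 (negbTE xr0) orbF => /eqP.
have b0 : b = 0.
  by apply: ab; rewrite -crossZr -[RHS](cross0r x) -E crossDr [cross x (a *: x)]crossZr crossvv scaler0 add0r.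
have a0 : a = 0.
  apply: ab; rewrite -crossZl; move: E; rewrite b0 scale0r addr0 => ->.
  by rewrite cross0l.
by rewrite a0 b0 !raddf0 row_mx0.
Qed.

Lemma cross_line p l m : dot3 l p = 0 -> cross p (cross l m) = dot3 p m *: l.
Proof. by move=> lp; rewrite cross_cross [dot3 p l]dot3C lp scale0r subr0. Qed.

Lemma eqmx_cross x p : x != 0 -> p != 0 -> (x == p)%MS = (cross p x == 0).
Proof.
move=> x0 p0; apply/idP/eqP => [/andP[/sub_rVP [c ->] _]|/cross_eq0 /(_ p0) [c xc]].
  by rewrite crossZr crossvv scaler0.
have c0 : c != 0 by apply: contra x0 => /eqP c0; rewrite xc c0 scale0r.
apply/andP; split; apply/sub_rVP; first by exists c.
by exists c^-1; rewrite xc scalerA mulVf // scale1r.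
Qed.

Lemma dot3_neq0_common p p' : p != 0 -> p' != 0 -> exists m, dot3 p m != 0 /\ dot3 p' m != 0.
Proof.
have ex u : u != 0 -> exists m, dot3 u m != 0.
  move=> /rV3_neq0 [i ui]; exists (delta_mx 0 i); rewrite /dot3 (bigD1 i) //= big1 ?addr0.
    by rewrite mxE !eqxx mulr1.
  by move=> j /negbTE ji; rewrite mxE eqxx ji mulr0.
move=> /ex [m pm] /ex [m' pm'].
have [p'm|p'm] := eqVneq (dot3 p' m) 0; last by exists m.
have [pm'0|pm'0] := eqVneq (dot3 p m') 0; last by exists m'.
by exists (m + m'); rewrite !dot3Dr p'm pm'0 addr0 add0r.
Qed.

Lemma mup_linear (a b : C) : (a, b) != (0, 0) ->
  mup 0 (a%:P + b *: 'X) = (a == 0) :> nat.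
Proof.
have [-> ab|a0 _] := eqVneq a 0.
  have b0 : b != 0 by apply: contra ab => /eqP ->.
  rewrite polyC0 add0r -mul_polyC mupMr; last by rewrite /root hornerC.
  by rewrite -['X]subr0 -polyC0 -['X - _]expr1 mup_XsubCX eqxx.
by rewrite mupNroot // /root hornerD hornerC hornerZ hornerX mulr0 addr0.
Qed.

End RowVectors.

Lemma mup_poly0 (F : fieldType) (x : F) : mup x 0 = 0%N.
Proof.
rewrite /mup; case: arg_maxnP => [|i _ _]; first by rewrite expr0 dvdp0.
by have := ltn_ord i; rewrite [X in (_ < X.+1)%N]size_poly0 ltnS leqn0 => /eqP.
Qed.

Section Bitangents.
Variable C : numClosedFieldType.
Variable f : {mpoly C[3]}.
Hypothesis hf : f \is 4.-homog.
Implicit Types l p x r m : 'rV[C]_3.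

(** The points of the line l are the [cross l m]. For p on l, [cross_line] shows that [dot3 p m]
    vanishes exactly when [cross l m] is a multiple of p. The divisor condition thus becomes a
    polynomial identity in m. *)
Definition square_on_line l p p' :=
  [/\ l != 0, p != 0, p' != 0, dot3 l p = 0 /\ dot3 l p' = 0 &
    exists2 c, c != 0 & forall m, f.@[cross l m 0] = c * (dot3 p m * dot3 p' m) ^+ 2].

Lemma size_restr x r : (size (restr f x r) <= 5)%N.
Proof.
pose L i : {poly C} := (x 0 i)%:P + r 0 i *: 'X.
have sL i : (size (L i) <= 2)%N.
  rewrite (leq_trans (size_polyD _ _)) // geq_max (leq_trans (size_polyC_leq1 _)) //=.
  by rewrite (leq_trans (size_scale_leq _ _)) // size_polyX.
have -> : restr f x r = \sum_(k < 5) \sum_(j < 5 - k)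
    chart_coefs f k j *: (L 0 ^+ (4 - k - j) * L 1 ^+ j * L 2 ^+ k).
  apply: (@poly_fun_eq _ _ _ 1); first exact: oner_neq0.
  move=> t _; rewrite restr_horner (meval_quartic _ hf) horner_sum; apply: eq_bigr => k _.
  rewrite horner_sum; apply: eq_bigr => j _; rewrite hornerZ !hornerM !horner_exp.
  have E i : (L i).[t] = (x + t *: r) 0 i.
    by rewrite !mxE hornerD hornerC hornerZ hornerX mulrC.
  by rewrite !E.
apply: (leq_trans (size_sum _ _ _)); apply/bigmax_leqP => k _.
apply: (leq_trans (size_sum _ _ _)); apply/bigmax_leqP => j _.
apply: (leq_trans (size_scale_leq _ _)).
have := ltn_ord k; have := ltn_ord j => jk k5.
apply: (@size_mul_bound _ _ _ (4 - k - j + j).+1 k.+1).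
- by apply: size_mul_bound (size_line_exp _ (sL 0)) (size_line_exp _ (sL 1)) _; lia.
- exact: size_line_exp.
- by lia.
Qed.

(** The multiplicities make the restriction to l divisible by a polynomial of degree 4, and a
    restriction has degree at most 4, so only a nonzero constant is left. *)
Lemma bitangent_square l p p' : bitangent_at f l p p' -> square_on_line l p p'.
Proof.
move=> [l0 p0 p'0]; rewrite !meval_linform => -[lp lp'] mu; split=> //.
(* Choosing n off both conditions makes r = [cross l n] a point of l different from p and p', so
   that both tangency points have a finite parameter. *)
have [n [pn p'n]] := dot3_neq0_common p0 p'0.
set r := cross l n.
have lr : dot3 l r = 0 by exact: dot3_cross_l.
have pr : cross p r = dot3 p n *: l by exact: cross_line.
have p'r : cross p' r = dot3 p' n *: l by exact: cross_line.
have fr q : dot3 q n != 0 -> dot3 l q = 0 -> row_free (col_mx q r).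
  by move=> qn lq; rewrite row_free_col_mx2 cross_line // scaler_eq0 negb_or qn.
have mup_p : mup 0 (restr f p r) = (2 + 2 * (p == p')%MS)%N.
  by rewrite mu ?meval_linform // ?fr // (introT eqmxP (eqmx_refl p)) muln1.
have mup_p' : mup 0 (restr f p' r) = (2 * (p' == p)%MS + 2)%N.
  by rewrite mu ?meval_linform // ?fr // (introT eqmxP (eqmx_refl p')) muln1.
(* The factor for which p' - g p is a multiple of r, so that p' has parameter [t0] on the line
   through p in direction r. *)
pose g := dot3 p' n / dot3 p n.
have g0 : g != 0 by rewrite mulf_neq0 // invr_eq0.
have r0 : r != 0.
  by apply: contra pn => /eqP r0; move/eqP: pr; rewrite r0 cross0r eq_sym scaler_eq0 (negbTE l0) orbF.
have [t0 p'E] : exists t, p' = g *: (p + t *: r).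
  have : cross (p' - g *: p) r = 0.
    by rewrite crossDl -scaleNr crossZl p'r pr scalerA -scalerDl /g mulNr divfK // subrr scale0r.
  rewrite crossNC => /eqP; rewrite oppr_eq0 => /eqP /cross_eq0 /(_ r0) [c cE].
  exists (c / g); rewrite scalerDr scalerA mulrCA divff // mulr1 -cE addrC subrK.
  by [].
set P := restr f p r in mup_p.
have P0 : P != 0.
  by apply/eqP => P0; move: mup_p; rewrite P0 mup_poly0.
have dP : 'X^2 * ('X - t0%:P) ^+ 2 %| P.
  (* For a hyperflex [t0] is 0 and the multiplicity 4 is used at once; otherwise the two double
     roots are coprime factors. *)
  have [pp'|pp'] := boolP (p == p')%MS.
    have t00 : t0 = 0.
      move: pp'; rewrite eqmx_cross // crossNC oppr_eq0 p'E crossZr crossDr crossvv add0r crossZr pr.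
      by rewrite !scaler_eq0 (negbTE g0) (negbTE l0) (negbTE pn) !orbF => /eqP.
    have : (4 <= mup 0 P)%N by rewrite mup_p pp'.
    by rewrite mup_geq // t00 polyC0 subr0 -exprD.
  have t00 : t0 != 0.
    apply: contra pp' => /eqP t00; rewrite p'E t00 scale0r addr0 eqmx_cross //; last by rewrite scaler_eq0 negb_or g0.
    by rewrite crossZl crossvv scaler0.
  rewrite Gauss_dvdp; last first.
    by rewrite coprimep_expl // coprimep_expr // coprimep_XsubC /root hornerX.
  apply/andP; split.
    have : (2 <= mup 0 P)%N by rewrite mup_p leq_addr.
    by rewrite mup_geq // polyC0 subr0.
  have P'0 : restr f p' r != 0.
    by apply/eqP => P0'; move: mup_p'; rewrite P0' mup_poly0 addnC.
  have : (2 <= mup 0 (restr f p' r))%N by rewrite mup_p' leq_addl.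
  rewrite mup_geq // polyC0 subr0 => /dvdpP [A PA].
  (* The double root is known in the parameter centred at p'. The substitution s to g (s - t0) moves
     it to [t0] in the parameter centred at p. *)
  have -> : P = (g ^- 2 *: (A \Po (g *: ('X - t0%:P)))) * ('X - t0%:P) ^+ 2.
    apply: (@poly_fun_eq _ _ _ 1); first exact: oner_neq0.
    move=> s _; have := restr_horner f p' r (g * (s - t0)).
    have -> : p' + (g * (s - t0)) *: r = g *: (p + s *: r).
      by rewrite p'E !scalerDr !scalerA -addrA -scalerDl; congr (_ + _ *: r); ring.
    rewrite PA hornerM hornerXn (meval_homogZ _ _ hf).
    have -> : f.@[(p + s *: r) 0] = P.[s] by rewrite restr_horner.
    move=> E; rewrite hornerM hornerZ horner_comp hornerZ horner_exp hornerXsubC.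
    apply: (mulfI (expf_neq0 4 g0)); rewrite -E; field.
    by [].
  exact: dvdp_mull.
have [c c0 PE] : exists2 c, c != 0 & P = c *: ('X^2 * ('X - t0%:P) ^+ 2).
  move: dP => /dvdpP [A PA].
  have D0 : 'X^2 * ('X - t0%:P) ^+ 2 != 0 :> {poly C}.
    by rewrite mulf_neq0 ?expf_neq0 ?polyX_eq0 ?polyXsubC_eq0.
  have A0 : A != 0 by apply: contra P0 => /eqP A0; rewrite PA A0 mul0r.
  have sD : size ('X^2 * ('X - t0%:P) ^+ 2 : {poly C}) = 5%N.
    by rewrite size_monicM ?monicXn ?expf_neq0 ?polyXsubC_eq0 // size_polyXn size_exp_XsubC.
  have : (size A <= 1)%N.
    have := size_restr p r; rewrite -/P PA size_mul // sD.
    by rewrite addnS /= -[5%N]/(1 + 4)%N leq_add2r.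
  move=> /size1_polyC AE; exists A`_0; last by rewrite PA {1}AE mul_polyC.
  by apply: contra A0 => /eqP A0; rewrite AE A0.
(* Homogeneity gives the formula for a nonzero; the remaining point r itself follows because both
   sides are polynomial in a. *)
have fE a b : f.@[(a *: p + b *: r) 0] = c * (b * (b - t0 * a)) ^+ 2.
  have H s : s != 0 -> f.@[(s *: p + b *: r) 0] = c * (b * (b - t0 * s)) ^+ 2.
    move=> s0; have -> : s *: p + b *: r = s *: (p + (b / s) *: r).
      by rewrite scalerDr scalerA mulrCA divff // mulr1.
    rewrite (meval_homogZ _ _ hf) -restr_horner -/P PE.
    rewrite hornerZ hornerM hornerXn horner_exp hornerXsubC; field.
    by [].
  have E : restr f (b *: r) p = c *: (b *: (b%:P - t0 *: 'X)) ^+ 2.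
    apply: (@poly_fun_eq _ _ _ 'X); first by rewrite polyX_eq0.
    move=> s; rewrite hornerX => s0; rewrite restr_horner addrC (H s s0).
    by rewrite hornerZ horner_exp hornerZ hornerD hornerN hornerC hornerZ hornerX.
  have := restr_horner f (b *: r) p a; rewrite addrC => <-.
  by rewrite E !(hornerZ, horner_exp, hornerD, hornerN, hornerC, hornerX).
have [k k0 {}pr] : exists2 k, k != 0 & cross p r = k *: l by exists (dot3 p n).
exists (c / (g ^+ 2 * k ^+ 4)); first by rewrite mulf_neq0 // invr_eq0 mulf_neq0 ?expf_neq0.
move=> m; have kX : k *: cross l m = dot3 p m *: r - dot3 r m *: p.
  by rewrite -crossZl -pr crossNC cross_cross opprB ![dot3 m _]dot3C.
have p'm : dot3 p' m = g * (dot3 p m + t0 * dot3 r m).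
  by rewrite p'E ![dot3 _ m]dot3C dot3Zr dot3Dr dot3Zr.
have := meval_homogZ (cross l m) k hf; rewrite kX addrC -scaleNr fE p'm => E.
apply: (mulfI (expf_neq0 4 k0)); rewrite -E; field.
by rewrite g0 k0.
Qed.

Lemma square_bitangent l p p' : square_on_line l p p' -> bitangent_at f l p p'.
Proof.
move=> [l0 p0 p'0 [lp lp'] [c c0 fE]]; split; rewrite ?meval_linform //.
move=> x r; rewrite row_free_col_mx2 !meval_linform => xr lx lr.
have x0 : x != 0 by apply: contra xr => /eqP ->; rewrite cross0l.
have [m xE] := cross_orthogonal l0 lx; have [n rE] := cross_orthogonal l0 lr.
have E : restr f x r = c *: (((dot3 p m)%:P + dot3 p n *: 'X) ^+ 2 *
                             ((dot3 p' m)%:P + dot3 p' n *: 'X) ^+ 2).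
  apply: (@poly_fun_eq _ _ _ 1); first exact: oner_neq0.
  move=> t _; rewrite restr_horner xE rE -crossZr -crossDr fE !dot3Dr !dot3Zr.
  by rewrite !(hornerZ, hornerM, horner_exp, hornerD, hornerC, hornerX); ring.
have nz q : q != 0 -> dot3 l q = 0 -> (dot3 q m, dot3 q n) != (0, 0).
  move=> q0 lq; apply: contra xr => /eqP [qm qn].
  have := cross_line m lq; have := cross_line n lq; rewrite qm qn !scale0r -xE -rE.
  move=> /cross_eq0 /(_ q0) [b ->] /cross_eq0 /(_ q0) [a ->].
  by rewrite crossZl crossZr crossvv !scaler0.
have mq q : q != 0 -> dot3 l q = 0 -> (dot3 q m == 0) = (x == q)%MS.
  move=> q0 lq; rewrite eqmx_cross // xE cross_line // scaler_eq0 (negbTE l0) orbF.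
  by [].
have lin q : q != 0 -> dot3 l q = 0 -> (dot3 q m)%:P + dot3 q n *: 'X != 0.
  move=> q0 lq; apply: contra (nz q q0 lq) => /eqP E0.
  have := congr1 (fun P : {poly C} => P`_0) E0; have := congr1 (fun P : {poly C} => P`_1) E0.
  by rewrite !coefD !coefC !coefZ !coefX /= mulr0 mulr1 add0r addr0 => -> ->.
rewrite E -mul_polyC mupMr; last by rewrite /root hornerC.
rewrite mupM ?expf_neq0 ?lin // !expr2 !mupM ?lin // !mup_linear ?nz // !mq //.
by lia.
Qed.

Lemma bitangent_atP l p p' : bitangent_at f l p p' <-> square_on_line l p p'.
Proof. by split=> [/bitangent_square|/square_bitangent]. Qed.

End Bitangents.

(* Kronecker substitution. *)
Lemma mpoly3_eval_eq0 (C : numClosedFieldType) (p : {mpoly C[3]}) :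
  (forall v : 'I_3 -> C, p.@[v] = 0) -> p = 0.
Proof.
move=> p0; pose D := msize p.
pose code (m : 'X_{1..3}) := (m 0%R + D * (m 1%R + D * m 2%R))%N.
have code_inj m m' : m \in msupp p -> m' \in msupp p -> code m = code m' -> m = m'.
  move=> /msize_mdeg_lt; rewrite -/D mdegE sum3 => H; have {H}mD : (m 0%R + m 1%R + m 2%R < D)%N := H.
  move=> /msize_mdeg_lt; rewrite -/D mdegE sum3 => H; have {H}mD' : (m' 0%R + m' 1%R + m' 2%R < D)%N := H.
  have dig (a a' b b' : nat) :
      (a < D)%N -> (a' < D)%N -> (a + D * b = a' + D * b')%N -> a = a' /\ b = b'.
    move=> aD aD' E; have bb : b = b' by nia.
    by split=> //; move: E; rewrite bb => /addIn.
  rewrite /code => /dig [||e0 /dig [||e1 e2]]; try lia.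
  by apply/mnmP; apply: ord3P.
pose Q : {poly C} := \sum_(m <- msupp p) p@_m *: 'X^(code m).
have Q0 : Q = 0.
  apply: (@poly_fun_eq _ _ _ 1); first exact: oner_neq0.
  move=> x _; rewrite horner0 -(p0 (fun i => x ^+ (D ^ i))) /Q horner_sum.
  rewrite [in RHS](mpolyE p) raddf_sum; apply: eq_bigr => m _ /=.
  rewrite hornerZ hornerXn mevalZ mevalX prod3 -!exprM -!exprD; congr (_ * x ^+ _).
  by rewrite /code /= expn0 expn1 -mulnn; lia.
apply/mpolyP => m; rewrite mcoeff0.
have [mp|mp] := boolP (m \in msupp p); last exact: memN_msupp_eq0.
have := congr1 (fun P : {poly C} => P`_(code m)) Q0; rewrite coef0 coef_sum.
rewrite (bigD1_seq m) ?msupp_uniq //= big_seq_cond big1 ?addr0.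
  by rewrite coefZ coefXn eqxx mulr1.
move=> m' /andP[m'p mm']; rewrite coefZ coefXn; case: eqP => [/code_inj e|]; last by rewrite mulr0.
by rewrite e ?eqxx // in mm'.
Qed.

Lemma mpoly3_eval_eq (C : numClosedFieldType) (p q : {mpoly C[3]}) :
  (forall v : 'rV[C]_3, p.@[v 0] = q.@[v 0]) -> p = q.
Proof.
move=> E; apply/eqP; rewrite -subr_eq0; apply/eqP/mpoly3_eval_eq0 => v.
have rowE (f : {mpoly C[3]}) : f.@[v] = f.@[(\row_i v i : 'rV[C]_3) 0].
  by apply: meval_eq => i; rewrite mxE.
by rewrite mevalB !rowE E subrr.
Qed.

(** * The cubic invariant contracted with fourth powers *)

Section QuarticIdentity.
Variable C : numClosedFieldType.
Implicit Types (f g q : {mpoly C[3]}) (l m p : 'rV[C]_3).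

(** By [bar_linform_pow4] this is [bar (linform m ^+ 4)]. The same vector therefore represents the
    fourth power of the line m and evaluation of coefficient vectors at m. *)
Definition monomials m : 'cV[C]_15 := \col_k \prod_i m 0 i ^+ exp4 k i.

Definition form_of_coefs (u : 'cV[C]_15) : {mpoly C[3]} := \sum_k u k 0 *: 'X_[exp4 k].

Lemma form_of_coefs_homog u : form_of_coefs u \is 4.-homog.
Proof.
apply: rpred_sum => k _; apply: rpredZ; rewrite dhomogX.
by rewrite -(mem_exps 4) mem_nth // size_exps4.
Qed.

Lemma exp4_inj : injective exp4.
Proof.
move=> i j /eqP; rewrite nth_uniq ?size_exps4 ?uniq_exps // => /eqP; exact: val_inj.
Qed.

Lemma mcoeff_form_of_coefs u k : (form_of_coefs u)@_(exp4 k) = u k 0.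
Proof.
rewrite /form_of_coefs raddf_sum /= (bigD1 k) //= big1 ?addr0.
  by rewrite mcoeffZ mcoeffX eqxx mulr1.
by move=> i ik; rewrite mcoeffZ mcoeffX (inj_eq exp4_inj) (negbTE ik) mulr0.
Qed.

Lemma meval_form_of_coefs u m : (form_of_coefs u).@[m 0] = \sum_k u k 0 * monomials m k 0.
Proof.
rewrite /form_of_coefs raddf_sum; apply: eq_bigr => k _.
by rewrite /= mevalZ mevalX mxE.
Qed.

Lemma meval_exp4 f m : f \is 4.-homog -> f.@[m 0] = \sum_k f@_(exp4 k) * monomials m k 0.
Proof.
move=> hf; rewrite {1}(mpoly_exps hf) big_exp4 raddf_sum; apply: eq_bigr => k _.
by rewrite /= mevalZ mevalX mxE.
Qed.

Lemma coefs_eval_eq (u v : 'cV[C]_15) :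
  (forall m, \sum_k u k 0 * monomials m k 0 = \sum_k v k 0 * monomials m k 0) -> u = v.
Proof.
move=> E; apply/colP => k; rewrite -!mcoeff_form_of_coefs; congr (_@_ _).
by apply: mpoly3_eval_eq => m; rewrite !meval_form_of_coefs.
Qed.

Lemma linform_homog l : linform l \is 1.-homog.
Proof.
apply: rpred_sum => i _; apply: rpredZ; rewrite dhomogX; apply/eqP; exact: mdeg1.
Qed.

Lemma det_col_mx3 (a b c : 'rV[C]_3) : \det (col_mx a (col_mx b c) : 'M[C]_3) = dot3 b (cross c a).
Proof.
pose M : 'M[C]_3 := col_mx a (col_mx b c).
have E0 : (0 : 'I_3) = @lshift 1 (1 + 1) (0 : 'I_1) by apply/val_inj.
have E1 : (1 : 'I_3) = @rshift 1 (1 + 1) (@lshift 1 1 (0 : 'I_1)) by apply/val_inj.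
have E2 : (2 : 'I_3) = @rshift 1 (1 + 1) (@rshift 1 1 (0 : 'I_1)) by apply/val_inj.
have M0 i : M 0 i = a 0 i by rewrite E0; exact: (col_mxEu a).
have M1 i : M 1 i = b 0 i by rewrite E1; exact: etrans (col_mxEd a _ _ _) (col_mxEu b _ _ _).
have M2 i : M 2 i = c 0 i by rewrite E2; exact: etrans (col_mxEd a _ _ _) (col_mxEd b _ _ _).
have o0 : inord 0 = 0 :> 'I_3 by apply/val_inj; rewrite /= inordK.
have o1 : inord 1 = 1 :> 'I_3 by apply/val_inj; rewrite /= inordK.
have o2 : inord 2 = 2 :> 'I_3 by apply/val_inj; rewrite /= inordK.
rewrite -/M detE o0 o1 o2 !M0 !M1 !M2 dot3E !crossE; ring.
Qed.

(* Contracting the cubic invariant with two fourth powers of linear forms is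
   evaluation at their intersection point. *)
Lemma cubicA_eval f l m : f \is 4.-homog ->
  \sum_i \sum_j \sum_k Acoef C i j k * monomials m i 0 * bar f j 0 * monomials l k 0
  = f.@[cross l m 0].
Proof.
move=> hf; set x := cross l m.
(* The contraction with m^4 and l^4 as a form in the middle slot. At b it takes the value det(m, b,
   l)^4 = (x . b)^4, so it is the fourth power of the linear form x. *)
pose K : 'cV[C]_15 := \col_j \sum_i \sum_k Acoef C i j k * monomials m i 0 * monomials l k 0.
have KE : K = \col_j (linform x ^+ 4)@_(exp4 j).
  apply: coefs_eval_eq => b.
  have h4 : linform x ^+ 4 \is 4.-homog by exact: (dhomogMn 4 (linform_homog x)).
  under [RHS]eq_bigr do rewrite mxE.
  rewrite -meval_exp4 // rmorphXn /= meval_linform.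
  have := cubicA_pow4 m b l; rewrite det_col_mx3 dot3C => <-.
  rewrite /cubicA exchange_big /=; apply: eq_bigr => j _; rewrite mxE mulr_suml.
  apply: eq_bigr => i _; rewrite mulr_suml; apply: eq_bigr => k _.
  by rewrite !bar_linform_pow4 ![monomials _ _ _]mxE; ring.
rewrite exchange_big /= (meval_exp4 _ hf); apply: eq_bigr => j _.
have -> : \sum_i \sum_k Acoef C i j k * monomials m i 0 * bar f j 0 * monomials l k 0
    = K j 0 * bar f j 0.
  rewrite [K j 0]mxE mulr_suml; apply: eq_bigr => i _; rewrite mulr_suml; apply: eq_bigr => k _.
  ring.
rewrite KE mxE [bar f j 0]mxE [monomials x j 0]mxE.
have n4 : (4`!%:R : C) != 0 by rewrite pnatr_eq0.
have H := pow4E (x 0) j; rewrite -/(linform x) in H.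
by apply: (mulIf n4); rewrite mulrA divfK // mulrCA H; ring.
Qed.

Lemma Lmx_monomials f l m : f \is 4.-homog ->
  \sum_i (Lmx f *m monomials l) i 0 * monomials m i 0 = f.@[cross l m 0].
Proof.
move=> hf; rewrite -cubicA_eval //; apply: eq_bigr => i _.
rewrite mxE mulr_suml exchange_big /=; apply: eq_bigr => k _.
rewrite [Lmx f i k]mxE !mulr_suml; apply: eq_bigr => j _; ring.
Qed.

(** Takes the place of the symmetry of [Lmx f]: exchanging l and m changes only the sign of their
    cross product, which even degree does not see. *)
Lemma monomials_Lmx f l m : f \is 4.-homog ->
  \sum_k ((monomials l)^T *m Lmx f) 0 k * monomials m k 0 = f.@[cross l m 0].
Proof.
move=> hf; have -> : cross l m = (-1) *: cross m l by rewrite crossNC scaleN1r.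
rewrite (meval_homogZ _ _ hf) -cubicA_eval // -signr_odd /= expr0 mul1r.
under eq_bigr => k _ do rewrite mxE mulr_suml.
rewrite exchange_big /=; apply: eq_bigr => i _.
rewrite exchange_big /=; apply: eq_bigr => k _.
rewrite mxE [Lmx f i k]mxE mulr_sumr mulr_suml; apply: eq_bigr => j _.
ring.
Qed.

End QuarticIdentity.

Lemma trmx_1 (R : Type) (A : 'M[R]_1) : A^T = A.
Proof. by apply/matrixP => i j; rewrite !ord1 mxE. Qed.

(** * Bitangent conics are singular points of the White--Miller quartic *)

Section SingularPoint.
Variable C : numClosedFieldType.
Variable f : {mpoly C[3]}.
Hypothesis hf : f \is 4.-homog.
Implicit Types (l p m : 'rV[C]_3) (q : {mpoly C[3]}).

Lemma conic_homog p p' : linform p * linform p' \is 2.-homog.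
Proof. exact: (dhomogM (linform_homog p) (linform_homog p')). Qed.

Lemma sqr_homog q : q \is 2.-homog -> q ^+ 2 \is 4.-homog.
Proof. by move=> hq; rewrite expr2; exact: (dhomogM hq hq). Qed.

Lemma quartic_coefs_eval q m : q \is 4.-homog ->
  \sum_k quartic_coefs q k 0 * monomials m k 0 = q.@[m 0].
Proof. by move=> hq; rewrite meval_exp4 //; apply: eq_bigr => k _; rewrite mxE. Qed.

Lemma Lmx_bitangent l p p' c (q := linform p * linform p') :
  (forall m, f.@[cross l m 0] = c * (dot3 p m * dot3 p' m) ^+ 2) ->
  Lmx f *m monomials l = c *: quartic_coefs (q ^+ 2) /\
  (monomials l)^T *m Lmx f = c *: (quartic_coefs (q ^+ 2))^T.
Proof.
move=> fE; have hq := sqr_homog (conic_homog p p').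
have qE m : \sum_k (c *: quartic_coefs (q ^+ 2)) k 0 * monomials m k 0 = f.@[cross l m 0].
  transitivity (c * (q ^+ 2).@[m 0]).
    by rewrite -quartic_coefs_eval // mulr_sumr; apply: eq_bigr => k _; rewrite mxE mulrA.
  by rewrite fE rmorphXn rmorphM /= !meval_linform.
split; first by apply: coefs_eval_eq => m; rewrite qE Lmx_monomials.
apply: trmx_inj; rewrite linearZ /= trmxK; apply: coefs_eval_eq => m; rewrite qE.
by rewrite -(monomials_Lmx _ _ hf); apply: eq_bigr => k _; rewrite mxE.
Qed.

Section BorderedDeterminant.
Variables (n : nat) (L : 'M[C]_n) (v0 v1 v2 w : 'cV[C]_n) (c : C).
Hypotheses (c0 : c != 0) (Lw : L *m w = c *: v0) (wL : w^T *m L = c *: v0^T).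
Hypotheses (w0 : w^T *m v0 = 0) (w1 : w^T *m v1 = 0).

Local Notation P := (map_mx (@polyC C)).

(* Adding the kernel direction (w, -c) of the bordered matrix at v0 to the last
   row and column makes both divisible by 'X, and their common entry by 'X^2. *)
Lemma bordered_det_double_root (v := P v0 + 'X *: (P v1 + 'X *: P v2)) :
  (\det (block_mx (P L) v v^T 0))`_1 = 0.
Proof.
set N := block_mx _ _ _ _.
have c0' : (- c%:P) != 0 :> {poly C} by rewrite oppr_eq0 polyC_eq0.
pose E : 'M[{poly C}]_(n + 1) := block_mx 1%:M (P w) 0 (- c%:P)%:M.
pose F : 'M[{poly C}]_(n + 1) := block_mx 1%:M 0 (P w)^T (- c%:P)%:M.
pose D : 'M[{poly C}]_(n + 1) := block_mx 1%:M 0 0 'X%:M.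
pose v' := P v1 + 'X *: P v2.
pose A := - (c%:P *: v').
pose B := - ((c%:P + c%:P) *: ((P w)^T *m P v2)).
have hLw : P L *m P w = c%:P *: P v0 by rewrite -map_mxM Lw map_mxZ.
have hwL : (P w)^T *m P L = c%:P *: (P v0)^T by rewrite map_trmx -map_mxM wL map_mxZ map_trmx.
have hw0 : (P w)^T *m P v0 = 0 by rewrite map_trmx -map_mxM w0 map_mx0.
have hw1 : (P w)^T *m P v1 = 0 by rewrite map_trmx -map_mxM w1 map_mx0.
have FNE : F *m N *m E = D *m block_mx (P L) A A^T B *m D.
  rewrite /F /N /E /D !mulmx_block !(mul1mx, mulmx1, mul0mx, mulmx0, addr0, add0r).
  rewrite !mul_scalar_mx !mul_mx_scalar.
  have hwv : (P w)^T *m v = 'X *: ('X *: ((P w)^T *m P v2)).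
    by rewrite /v mulmxDr hw0 add0r -scalemxAr mulmxDr hw1 add0r -scalemxAr.
  have hvw : v^T *m P w = 'X *: ('X *: ((P w)^T *m P v2)).
    by rewrite -[LHS]trmx_1 trmx_mul trmxK.
  have TR : P L *m P w - c%:P *: v = 'X *: A.
    by rewrite hLw /v scalerDr opprD addrA subrr add0r /A scalerN !scalerA mulrC.
  have BL : (P w)^T *m P L - c%:P *: v^T = 'X *: A^T.
    have -> : 'X *: A^T = ('X *: A)^T by apply/matrixP => a b; rewrite !mxE.
    by rewrite -TR hLw hwL; apply/matrixP => a b; rewrite !mxE.
  congr block_mx.
  - by rewrite scaleNr TR.
  - by rewrite scaleNr BL.
  - rewrite mulmxDl -mulmxA hLw -scalemxAr hw0 scaler0 add0r -scalemxAl hvw hwv.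
    by rewrite /B -[in RHS]scaleNr !scalerA -scalerDl; congr (_ *: _); ring.
have dE : \det E = - c%:P by rewrite det_ublock det1 mul1r det_scalar1.
have dF : \det F = - c%:P by rewrite det_lblock det1 mul1r det_scalar1.
have dD : \det D = 'X by rewrite det_ublock det1 mul1r det_scalar1.
have := congr1 determinant FNE; rewrite !det_mulmx dE dF dD => H.
have : c ^+ 2 *: \det N = 'X^2 * \det (block_mx (P L) A A^T B).
  rewrite -mul_polyC rmorphXn /=; transitivity (- c%:P * \det N * - c%:P); first by ring.
  by rewrite H; ring.
move/(congr1 (fun p : {poly C} => p`_1)); rewrite coefZ coefXnM /= => /eqP.
by rewrite mulf_eq0 expf_eq0 (negbTE c0) andbF => /eqP.
Qed.

End BorderedDeterminant.

(** The i-th partial at q is the linear coefficient of t in the bordered determinant at q + t e, e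
    the i-th monomial. The border is then v0 + t v1 + t^2 v2 with v1 from 2 q e, and q vanishes at l
    because l passes through p; hence v0 and v1 are orthogonal to [monomials l]. *)
Lemma WM_singular l p p' : square_on_line f l p p' ->
  singular_point (WM f) (conic_coefs (linform p * linform p')).
Proof.
move=> [l0 p0 p'0 [lp lp'] [c c0 fE]].
set q := linform p * linform p'.
have hq : q \is 2.-homog := conic_homog p p'.
split.
  have [m [pm p'm]] := dot3_neq0_common p0 p'0.
  have : q.@[m 0] != 0 by rewrite rmorphM /= !meval_linform mulf_neq0.
  move=> qm; apply/existsP; apply: contraNT qm; rewrite negb_exists => /forallP nq.
  rewrite (mpoly_exps hq) big_exp2 big1 ?meval0 // => k _.
  by have := nq k; rewrite negbK /conic_coefs => /eqP ->; rewrite scale0r.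
move=> i.
pose r (k : 'I_6) : C := (k == i)%:R.
have -> : ((WM f)^`M(i)).@[conic_coefs q] =
    (mmap polyC (fun k => (conic_coefs q k)%:P + r k *: 'X) (WM f))`_1.
  rewrite line_restr_coef1 (bigD1 i) //= big1 ?addr0; first by rewrite /r eqxx mul1r.
  by move=> j /negbTE ji; rewrite /r ji mul0r.
pose e : {mpoly C[3]} := 'X_[exp2 i].
have he : e \is 2.-homog.
  by rewrite dhomogX -(mem_exps 2) mem_nth // size_exps2.
pose v0 := quartic_coefs (q ^+ 2).
pose v1 := quartic_coefs (2 *: (q * e)).
pose v2 := quartic_coefs (e ^+ 2).
have [Lw wL] := Lmx_bitangent fE.
have wv g : g \is 4.-homog -> g.@[l 0] = 0 -> (monomials l)^T *m quartic_coefs g = 0.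
  move=> hg gl; apply/matrixP => a b; rewrite !ord1 [RHS]mxE -[RHS]gl mxE -(quartic_coefs_eval _ hg).
  by apply: eq_bigr => k _; rewrite mxE mulrC.
have ql : q.@[l 0] = 0.
  by rewrite rmorphM /= !meval_linform ![dot3 _ l]dot3C lp mul0r.
have w0 : (monomials l)^T *m v0 = 0.
  by apply: wv; [exact: sqr_homog | rewrite rmorphXn /= ql expr0n].
have w1 : (monomials l)^T *m v1 = 0.
  apply: wv; first by apply: rpredZ; exact: (dhomogM hq he).
  by rewrite mevalZ rmorphM /= ql mul0r mulr0.
rewrite -[RHS](bordered_det_double_root v2 c0 Lw wL w0 w1).
congr (polyseq _)`_1; apply: (@poly_fun_eq _ _ _ 1); first exact: oner_neq0.
move=> t _; rewrite line_restr_horner.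
have hqe : q + t *: e \is 2.-homog by rewrite rpredD // rpredZ.
have -> : (WM f).@[fun k => conic_coefs q k + t * r k] = (WM f).@[conic_coefs (q + t *: e)].
  apply: meval_eq => k; rewrite /conic_coefs mcoeffD mcoeffZ mcoeffX /r; congr (_ + _ * _).
  by rewrite /exp2 nth_uniq ?size_exps2 ?uniq_exps // eq_sym.
have vE : quartic_coefs ((q + t *: e) ^+ 2) = map_mx (horner_eval t)
    (map_mx (@polyC C) v0 + 'X *: (map_mx (@polyC C) v1 + 'X *: map_mx (@polyC C) v2)).
  apply/matrixP => a b.
  rewrite !mxE /= /horner_eval !(hornerD, hornerC, hornerM, hornerX).
  have -> : (q + t *: e) ^+ 2 = q ^+ 2 + t *: (2 *: (q * e)) + t ^+ 2 *: (e ^+ 2).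
    by rewrite sqrrD exprZn -scalerAr scaler_nat scalerMnr.
  by rewrite !mcoeffD !mcoeffZ; ring.
rewrite WM_eval // -/(horner_eval t _) -det_map_mx map_block_mx.
congr (\det _); congr block_mx.
- by apply/matrixP => a b; rewrite !mxE /= /horner_eval hornerC.
- exact: vE.
- by rewrite -map_trmx vE.
- by rewrite map_mx0.
Qed.

End SingularPoint.

(** * Lines and conics determine each other *)

Section TangencyPoints.
Variable C : numClosedFieldType.
Variable f : {mpoly C[3]}.
Hypotheses (hf : f \is 4.-homog) (sm : smooth f).
Implicit Types (l p m : 'rV[C]_3) (q : {mpoly C[3]}).

Definition gradient p : 'rV[C]_3 := \row_i (f^`M(i)).@[p 0].

Lemma square_on_line_sym l p p' : square_on_line f l p p' -> square_on_line f l p' p.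
Proof.
move=> [l0 p0 p'0 [lp lp'] [c c0 fE]]; split=> //; exists c => // m.
by rewrite fE [dot3 p m * _]mulrC.
Qed.

(** The restriction of f to l vanishes doubly at p, so the gradient at p annihilates every point of
    l; it is nonzero by smoothness, hence proportional to l. *)
Lemma bitangent_gradient l p p' : square_on_line f l p p' ->
  exists2 c, c != 0 & l = c *: gradient p.
Proof.
move=> [l0 p0 p'0 [lp lp'] [c c0 fE]].
have g0 : gradient p != 0.
  have [i gi] := sm p0; apply: contra gi => /eqP /rowP /(_ i).
  by rewrite !mxE => ->.
have [n pE] := cross_orthogonal l0 lp.
have pn : dot3 p n = 0.
  have := cross_line n lp; rewrite -pE crossvv => /esym/eqP.
  by rewrite scaler_eq0 (negbTE l0) orbF => /eqP.
have H : cross (gradient p) l = 0.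
  apply: dot3_eq0 => m; rewrite -dot3_cross.
  have -> : dot3 (gradient p) (cross l m) = (restr f p (cross l m))`_1.
    by rewrite restr_coef1; apply: eq_bigr => i _; rewrite mxE mulrC.
  have -> : restr f p (cross l m) =
      'X^2 * (c *: (dot3 p m *: ((dot3 p' n)%:P + dot3 p' m *: 'X)) ^+ 2).
    apply: (@poly_fun_eq _ _ _ 1); first exact: oner_neq0.
    move=> t _; rewrite restr_horner {1}pE -crossZr -crossDr fE !dot3Dr !dot3Zr pn.
    by rewrite !(hornerM, hornerXn, hornerZ, horner_exp, hornerD, hornerC, hornerX); ring.
  by rewrite coefXnM.
have [a lE] := cross_eq0 H g0; exists a => //.
by apply: contra l0 => /eqP a0; rewrite lE a0 scale0r.
Qed.

Lemma gradientZ c p : c != 0 -> gradient (c *: p) = c ^+ 3 *: gradient p.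
Proof. by move=> c0; apply/rowP => i; rewrite !mxE partial_homogZ. Qed.

Lemma common_tangency_point l p p' l1 p1 p1' :
  square_on_line f l p p' -> square_on_line f l1 p1 p1' -> cross p1 p = 0 -> proj_eq l l1.
Proof.
move=> S S1; have [_ p0 _ _ _] := S; have [_ p10 _ _ _] := S1.
move=> /cross_eq0 /(_ p10) [c pE].
have c0 : c != 0 by apply: contra p0 => /eqP c0; rewrite pE c0 scale0r.
have [a a0 lE] := bitangent_gradient S; have [b b0 l1E] := bitangent_gradient S1.
exists (b / (a * c ^+ 3)); first by rewrite mulf_neq0 // invr_eq0 mulf_neq0 ?expf_neq0.
rewrite lE pE gradientZ // l1E !scalerA; congr (_ *: _); field.
by rewrite a0 c0.
Qed.

Lemma same_conic_same_line l p p' l1 p1 p1' :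
  square_on_line f l p p' -> square_on_line f l1 p1 p1' ->
  proj_eq (linform p * linform p') (linform p1 * linform p1') -> proj_eq l l1.
Proof.
move=> S S1 [k k0 qE].
have E m : dot3 p1 m * dot3 p1' m = k * (dot3 p m * dot3 p' m).
  by rewrite -!meval_linform -!rmorphM /= qE mevalZ.
have [p1p|p1p] := eqVneq (cross p1 p) 0; first exact: common_tangency_point S S1 p1p.
have [p1'p|p1'p] := eqVneq (cross p1' p) 0.
  exact: common_tangency_point S (square_on_line_sym S1) p1'p.
(* If p were neither p1 nor p1', some line [cross p n] through p would miss both of them. There the
   conic of p, p' vanishes and that of p1, p1' does not. *)
have [n [n1 n1']] := dot3_neq0_common p1p p1'p.
have := E (cross p n); rewrite dot3_cross_l mul0r mulr0 !dot3_cross => /eqP.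
by rewrite mulf_eq0 (negbTE n1) (negbTE n1').
Qed.

Lemma same_line_same_conic l p p' l1 p1 p1' :
  square_on_line f l p p' -> square_on_line f l1 p1 p1' ->
  proj_eq l l1 -> proj_eq (linform p * linform p') (linform p1 * linform p1').
Proof.
move=> [_ _ _ _ [c c0 fE]] [_ _ _ _ [c1 c10 f1E]] [a a0 lE].
set q := linform p * linform p'; set q1 := linform p1 * linform p1'.
(* The restrictions of f to l and to a l differ by a^4, so the squares of the two conics are
   proportional; s is a square root of the ratio. *)
have [s s2] : exists s : C, s ^+ 2 = a ^+ 4 * c / c1 by exists (sqrtC (a ^+ 4 * c / c1)); rewrite sqrtCK.
have s0 : s != 0.
  have : s ^+ 2 != 0; last by rewrite expf_eq0.
  by rewrite s2 mulf_neq0 ?invr_eq0 // mulf_neq0 ?expf_neq0.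
have E : q1 ^+ 2 = s ^+ 2 *: q ^+ 2.
  apply: mpoly3_eval_eq => m; rewrite mevalZ !rmorphXn !rmorphM /= !meval_linform.
  apply: (mulfI c10); rewrite -f1E lE crossZl (meval_homogZ _ _ hf) fE s2; field.
  by [].
have : (q1 - s *: q) * (q1 + s *: q) = 0.
  by rewrite -subr_sqr E exprZn subrr.
move/eqP; rewrite mulf_eq0 subr_eq0 addr_eq0 => /orP[] /eqP qE; first by exists s.
by exists (- s); rewrite ?oppr_eq0 // scaleNr.
Qed.

End TangencyPoints.

(** * Zeros of the square system correspond to bitangents, two to each *)

Section ZerosAndLines.
Variable C : numClosedFieldType.
Implicit Types (z y : 'rV[C]_5) (l p m : 'rV[C]_3).

Definition chart_line (a b : C) : 'rV[C]_3 := vec3 a b (-1).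

Lemma binary_quadratic_split (a b c : C) : (a, b, c) != (0, 0, 0) ->
  exists s s' : C * C, [/\ s != (0, 0), s' != (0, 0) &
    forall x y : C, a * x ^+ 2 + b * (x * y) + c * y ^+ 2
                = (s.1 * x + s.2 * y) * (s'.1 * x + s'.2 * y)].
Proof.
have [->|c0] := eqVneq c 0 => abc.
  exists (1, 0), (a, b); split=> [||x y] /=; last by ring.
    by apply/negP => /eqP [] /eqP; rewrite oner_eq0.
  by apply: contra abc => /eqP [-> ->].
pose d := sqrtC (b ^+ 2 - 4 * a * c).
have dE : d ^+ 2 = b ^+ 2 - 4 * a * c by rewrite sqrtCK.
exists ((b + d) / 2, c), ((b - d) / (2 * c), 1); split=> [||x y] /=.
- by apply/negP => /eqP [] _ /eqP; rewrite (negbTE c0).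
- by apply/negP => /eqP [] _ /eqP; rewrite oner_eq0.
have -> : a = (b ^+ 2 - d ^+ 2) / (4 * c).
  by rewrite dE; field.
by field.
Qed.

Variable f : {mpoly C[3]}.
Hypothesis hf : f \is 4.-homog.
Local Notation g := (chart_coefs f).

Definition on_conic z (x y : C) : C :=
  z 0 (inord 2) * x ^+ 2 + z 0 (inord 3) * (x * y) + z 0 (inord 4) * y ^+ 2.

(** The homogeneous form of the equation, which also covers the point at infinity x = 0 of the
    line. *)
Lemma square_defect_on_line z : square_defect g z = 0 -> forall x y : C,
  f.@[vec3 x y (z 0 0 * x + z 0 1 * y) 0] = on_conic z x y ^+ 2.
Proof.
move=> z0 x y.
have E : restr f (y *: vec3 0 1 (z 0 1)) (vec3 1 0 (z 0 0)) =
    (z 0 (inord 2) *: 'X^2 + (z 0 (inord 3) * y) *: 'X + (z 0 (inord 4) * y ^+ 2)%:P) ^+ 2.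
  apply: (@poly_fun_eq _ _ _ 'X); first by rewrite polyX_eq0.
  move=> s; rewrite hornerX => s0; rewrite restr_horner.
  have -> : y *: vec3 0 1 (z 0 1) + s *: vec3 1 0 (z 0 0)
      = s *: vec3 1 (y / s) (line_poly z).[y / s].
    by apply: rV3P; rewrite line_polyE hornerD hornerC hornerZ hornerX !mxE /=; field.
  rewrite (meval_homogZ _ _ hf) -chart_quartic_horner //.
  have /square_defect_eq0 -> := z0.
  rewrite conic_polyE !(horner_exp, hornerD, hornerC, hornerZ, hornerX, hornerXn); field.
  by [].
have -> : vec3 x y (z 0 0 * x + z 0 1 * y) = y *: vec3 0 1 (z 0 1) + x *: vec3 1 0 (z 0 0).
  by apply: rV3P; rewrite !mxE /=; ring.
rewrite -restr_horner E !(horner_exp, hornerD, hornerC, hornerZ, hornerX, hornerXn) /on_conic.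
ring.
Qed.

(** A smooth quartic contains no line. Here this is read off the linearised system: if q = 0, the
    row of [defect_slope g z z] for the constant coefficient of q vanishes. *)
Lemma zero_conic_neq0 z : smooth f -> square_defect g z = 0 -> conic_poly z != 0.
Proof.
move=> sm z0; apply/eqP => q0.
have u := smooth_slope_unit hf sm z0.
pose w : 'rV[C]_5 := delta_mx 0 (inord 2).
have lw : line_poly w = 0.
  by rewrite line_polyE !mxE /= -!val_eqE /= inordK //= scale0r addr0.
have : w *m defect_slope g z z = 0.
  by rewrite mul_defect_slope q0 addr0 lw mul0r mulr0 subr0; apply/rowP => j; rewrite !mxE coef0.
move/(congr1 (mulmx^~ (invmx (defect_slope g z z)))); rewrite mulmxK // mul0mx.
by move/rowP/(_ (inord 2)); rewrite !mxE eqxx /= => /eqP; rewrite eqxx oner_eq0.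
Qed.

Lemma zero_bitangent z : smooth f -> square_defect g z = 0 ->
  bitangent f (chart_line (z 0 0) (z 0 1)).
Proof.
move=> sm z0; have q0 := zero_conic_neq0 sm z0.
have abc : (z 0 (inord 2), z 0 (inord 3), z 0 (inord 4)) != (0, 0, 0).
  apply: contra q0 => /eqP [e2 e3 e4]; rewrite conic_polyE e2 e3 e4 !scale0r !addr0.
  by rewrite polyC0.
have [s [s' [s0 s'0 sE]]] := binary_quadratic_split abc.
set l := chart_line _ _.
(* A linear factor s_1 x + s_2 y of q vanishes where l meets the line (s_1, s_2, 0), which is the
   tangency point. *)
pose tang (s : C * C) := cross (vec3 s.1 s.2 0) l.
have tang0 (r : C * C) : r != (0, 0) -> tang r != 0.
  move=> r0; apply: contra r0 => /eqP E; apply/eqP.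
  have := congr1 (fun v : 'rV[C]_3 => v 0 0) E; have := congr1 (fun v : 'rV[C]_3 => v 0 1) E.
  rewrite !crossE !vec3E !mxE !mul0r sub0r subr0 !mulrN1 => /eqP e1 /eqP e0.
  move: e0 e1; rewrite !oppr_eq0; case: (r) => r1 r2 /= /eqP -> /eqP ->.
  by [].
exists (tang s), (tang s'); apply/(bitangent_atP hf); split; try exact: tang0.
- by apply/eqP => /rowP /(_ 2); rewrite vec3E mxE => /eqP; rewrite oppr_eq0 oner_eq0.
- by split; rewrite dot3C /tang -dot3_cross crossvv dot3E !mxE !mulr0 !addr0.
exists 1; first exact: oner_neq0.
move=> m; rewrite mul1r; set x := cross l m.
have -> : x = vec3 (x 0 0) (x 0 1) (z 0 0 * x 0 0 + z 0 1 * x 0 1).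
  by apply: rV3P; rewrite !vec3E //= ?crossE ?vec3E; ring.
rewrite square_defect_on_line // /on_conic sE; congr (_ ^+ 2).
by rewrite /tang -!dot3_cross -/x !dot3E !vec3E !mul0r !addr0.
Qed.

Lemma bitangent_zero l : no_vertical_square g -> bitangent f l ->
  exists2 z, square_defect g z = 0 & proj_eq (chart_line (z 0 0) (z 0 1)) l.
Proof.
move=> nv [p [p' /(bitangent_atP hf) [l0 p0 p'0 [lp lp'] [c c0 fE]]]].
(* A line with l_2 = 0 passes through (0 : 0 : 1). The restriction of f to it would be a square,
   which [no_vertical_square] forbids. *)
have [l2|l2] := eqVneq (l 0 2) 0.
  exfalso; have uv0 : (l 0 1, - l 0 0) != (0, 0).
    apply: contra l0 => /eqP [l1 /eqP l00]; rewrite oppr_eq0 in l00.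
    by apply/eqP/rV3P; rewrite mxE ?l1 ?l2 // (eqP l00).
  (* The normalisation makes [cross l (vec3 n.1 n.2 t)] equal to (l_1 t, - l_0 t, 1), the
     parametrisation used by [chart_restr]. *)
  have [n nE] : exists n : C * C, l 0 0 * n.2 - l 0 1 * n.1 = 1.
    have [l00|l00] := eqVneq (l 0 0) 0.
      have l1 : l 0 1 != 0 by apply: contra uv0 => /eqP ->; rewrite l00 oppr0.
      by exists (- (l 0 1)^-1, 0) => /=; rewrite mulrN divff // mulr0 sub0r opprK.
    by exists (0, (l 0 0)^-1) => /=; rewrite divff // mulr0 subr0.
  pose lin q : {poly C} := (dot3 q (vec3 n.1 n.2 0))%:P + q 0 2 *: 'X.
  pose Q := sqrtC c *: (lin p * lin p').
  have sQ : (size Q <= 3)%N.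
    have sl q : (size (lin q) <= 2)%N.
      rewrite (leq_trans (size_polyD _ _)) // geq_max (leq_trans (size_polyC_leq1 _)) //=.
      by rewrite (leq_trans (size_scale_leq _ _)) // size_polyX.
    by rewrite (leq_trans (size_scale_leq _ _)) // (size_mul_bound (sl p) (sl p')).
  have QE : chart_restr g (l 0 1 *: 'X) ((- l 0 0) *: 'X) = Q ^+ 2.
    apply: (@poly_fun_eq _ _ _ 1); first exact: oner_neq0.
    move=> t _; transitivity (f.@[vec3 (l 0 1 * t) (- l 0 0 * t) 1 0]).
      by rewrite chart_restr_horner // !hornerZ !hornerX.
    have -> : vec3 (l 0 1 * t) (- l 0 0 * t) 1 = cross l (vec3 n.1 n.2 t).
      by apply: rV3P; rewrite crossE !vec3E ?l2 -?nE; ring.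
    rewrite fE /Q /lin !(horner_exp, hornerZ, hornerM, hornerD, hornerC, hornerX).
    by rewrite -{1}(sqrtCK c) !dot3E !vec3E; ring.
  have [o3 o4] := square_obstructions sQ.
  case: nv => _ /(_ _ _ uv0); rewrite /square_obstruction3 /square_obstruction4.
  rewrite -!chart_restr_monomial // QE.
  by rewrite -/(square_obstruction3 (fun i => (Q ^+ 2)`_i)) -/(square_obstruction4 (fun i => (Q ^+ 2)`_i)) o3 o4 eqxx => -[].
pose k := - l 0 2; have k0 : k != 0 by rewrite oppr_eq0.
pose a := l 0 0 / k; pose b := l 0 1 / k.
have lE : l = k *: chart_line a b.
  by apply: rV3P; rewrite !mxE /= ?mulrN1 ?opprK // mulrC divfK.
pose s := sqrtC c / k ^+ 2.
(* Since (1, t, h(t)) is [cross l (vec3 (- t) 1 0)] divided by k, the coefficients of q are those of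
   s (p_1 - p_0 t)(p'_1 - p'_0 t). *)
pose z : 'rV[C]_5 := \row_i nth 0 [:: a; b; s * (p 0 1 * p' 0 1);
  - s * (p 0 1 * p' 0 0 + p 0 0 * p' 0 1); s * (p 0 0 * p' 0 0)] i.
have z0 : z 0 0 = a by rewrite mxE.
have z1 : z 0 1 = b by rewrite mxE.
exists z; last by exists k => //; rewrite z0 z1.
apply/square_defect_eq0; apply: (@poly_fun_eq _ _ _ 1); first exact: oner_neq0.
move=> t _; rewrite chart_quartic_horner // line_polyE z0 z1.
have -> : vec3 1 t (a%:P + b *: 'X).[t] = k^-1 *: cross l (vec3 (- t) 1 0).
  rewrite lE crossZl scalerA mulVf // scale1r.
  by rewrite hornerD hornerC hornerZ hornerX; apply: rV3P; rewrite crossE !vec3E; ring.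
rewrite (meval_homogZ _ _ hf) fE conic_polyE horner_exp.
have -> : z 0 (inord 2) = s * (p 0 1 * p' 0 1) by rewrite mxE inordK.
have -> : z 0 (inord 3) = - s * (p 0 1 * p' 0 0 + p 0 0 * p' 0 1) by rewrite mxE inordK.
have -> : z 0 (inord 4) = s * (p 0 0 * p' 0 0) by rewrite mxE inordK.
rewrite !(hornerD, hornerC, hornerZ, hornerX, hornerXn) !dot3E !vec3E.
have -> : c = s ^+ 2 * k ^+ 4 by rewrite /s expr_div_n sqrtCK; field.
by field.
Qed.

Lemma chart_line_inj a b a' b' : proj_eq (chart_line a b) (chart_line a' b') ->
  (a, b) = (a', b').
Proof.
move=> [c _ E]; have := congr1 (fun v : 'rV[C]_3 => v 0 2) E.
have := congr1 (fun v : 'rV[C]_3 => v 0 1) E; have := congr1 (fun v : 'rV[C]_3 => v 0 0) E.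
rewrite !mxE /= mulrN1 => -> -> /oppr_inj <-.
by rewrite !mul1r.
Qed.

Definition negate_conic z : 'rV[C]_5 := \row_i (if (i < 2)%N then z 0 i else - z 0 i).

Lemma line_negate z : line_poly (negate_conic z) = line_poly z.
Proof. by rewrite !line_polyE !mxE. Qed.

Lemma conic_negate z : conic_poly (negate_conic z) = - conic_poly z.
Proof.
rewrite !conic_polyE !mxE !inordK //= !opprD polyCN !scaleNr.
by [].
Qed.

Lemma chart_params_eq y z : line_poly y = line_poly z -> conic_poly y = conic_poly z -> y = z.
Proof.
move=> e1 e2; apply/eqP; rewrite -subr_eq0; apply/eqP/chart_params_eq0.
  by rewrite line_polyB e1 subrr.
by rewrite conic_polyB e2 subrr.
Qed.

(* Each line carries exactly two zeros of the square system, one for each sign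
   of the conic. *)
Lemma zeros_of_lines (s : seq (C * C)) : smooth f -> uniq s ->
  (forall ab, ab \in s -> exists2 z, square_defect g z = 0 & (z 0 0, z 0 1) = ab) ->
  exists t : seq 'rV[C]_5, [/\ uniq t, size t = (2 * size s)%N &
    forall z, z \in t <-> square_defect g z = 0 /\ (z 0 0, z 0 1) \in s].
Proof.
move=> sm; elim: s => [|ab s IH] /=; first by exists [::]; split=> // z; split=> // -[].
move=> /andP[abs us] H.
have [|t [ut st tE]] := IH us; first by move=> cd cds; apply: H; rewrite in_cons cds orbT.
have [z z0 zab] := H ab (mem_head _ _).
have n0 : square_defect g (negate_conic z) = 0.
  apply/square_defect_eq0; rewrite line_negate conic_negate sqrrN.
  exact/square_defect_eq0.
have nab : (negate_conic z 0 0, negate_conic z 0 1) = ab by rewrite !mxE.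
have zn : z != negate_conic z.
  apply: contra (zero_conic_neq0 sm z0) => /eqP E.
  have := congr1 (@conic_poly C) E; rewrite conic_negate => /eqP.
  by rewrite -addr_eq0 -mulr2n -scaler_nat scaler_eq0 pnatr_eq0.
have two y : square_defect g y = 0 -> (y 0 0, y 0 1) = ab -> y = z \/ y = negate_conic z.
  move=> y0 yab; have e1 : line_poly y = line_poly z.
    by move: yab; rewrite -zab !line_polyE => -[-> ->].
  have /square_defect_eq0 ey := y0; have /square_defect_eq0 ez := z0.
  have : (conic_poly y - conic_poly z) * (conic_poly y + conic_poly z) = 0.
    by rewrite -subr_sqr -ey -ez e1 subrr.
  move/eqP; rewrite mulf_eq0 subr_eq0 addr_eq0 => /orP[/eqP|/eqP] eq.
    by left; exact: chart_params_eq.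
  by right; apply: chart_params_eq; rewrite ?line_negate ?conic_negate.
have nt y : (y 0 0, y 0 1) = ab -> y \notin t.
  by move=> yab; apply: contra abs => /tE [_]; rewrite yab.
exists (z :: negate_conic z :: t); split=> [||y] /=.
- by rewrite in_cons negb_or zn !nt // ut.
- by rewrite st mulnS.
rewrite !in_cons; split.
  case/or3P => [/eqP ->|/eqP ->|/tE [y0 ys]].
  - by rewrite zab eqxx.
  - by rewrite nab eqxx.
  - by rewrite ys orbT.
case=> y0 /orP[/eqP yab|ys]; last first.
  by have -> : y \in t; [apply/tE | rewrite !orbT].
by case: (two y y0 yab) => ->; rewrite eqxx ?orbT.
Qed.

End ZerosAndLines.

(** * The 28 bitangents of the Fermat quartic *)

Section FermatBitangents.
Variable C : numClosedFieldType.
Implicit Types (a b c x y t : C) (l : C * C * C).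

Lemma quartic_coef_eq (c0 c1 c2 c3 c4 d0 d1 d2 d3 d4 : C) :
  (forall x, c0 + c1 * x + c2 * x ^+ 2 + c3 * x ^+ 3 + c4 * x ^+ 4 =
             d0 + d1 * x + d2 * x ^+ 2 + d3 * x ^+ 3 + d4 * x ^+ 4) ->
  [/\ c0 = d0, c1 = d1, c2 = d2, c3 = d3 & c4 = d4].
Proof.
move=> H; have /polyP E : Poly [:: c0; c1; c2; c3; c4] = Poly [:: d0; d1; d2; d3; d4].
  apply: (@poly_fun_eq _ _ _ 1); first exact: oner_neq0.
  move=> x _; rewrite !horner_Poly /= !mul0r !add0r.
  have := H x => Hx; transitivity (c0 + c1 * x + c2 * x ^+ 2 + c3 * x ^+ 3 + c4 * x ^+ 4); first ring.
  by rewrite Hx; ring.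
by move: (E 0%N) (E 1%N) (E 2%N) (E 3%N) (E 4%N); rewrite !coef_Poly /=.
Qed.

(** Treats the lines y_2 = a y_0 + b y_1. The first two cases are hyperflex tangents, where two
    fourth powers cancel; the third gives the 16 bitangents with distinct tangency points. *)
Lemma fermat_square a b (al be ga : C) :
  (forall x y, x ^+ 4 + y ^+ 4 + (a * x + b * y) ^+ 4
               = (al * x ^+ 2 + be * (x * y) + ga * y ^+ 2) ^+ 2) ->
  [\/ a = 0 /\ b ^+ 4 = -1, b = 0 /\ a ^+ 4 = -1 | a ^+ 4 = 1 /\ b ^+ 4 = 1].
Proof.
move=> H.
have [h0 h1 h2 h3 h4] : [/\ 1 + b ^+ 4 = ga ^+ 2, 4 * a * b ^+ 3 = 2 * be * ga,
    6 * a ^+ 2 * b ^+ 2 = be ^+ 2 + 2 * al * ga, 4 * a ^+ 3 * b = 2 * al * be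
    & 1 + a ^+ 4 = al ^+ 2].
  apply: quartic_coef_eq => x; have Hx := H x 1.
  transitivity (x ^+ 4 + 1 ^+ 4 + (a * x + b * 1) ^+ 4); first by ring.
  by rewrite Hx; ring.
have two : (2 : C) != 0 by rewrite pnatr_eq0.
have [a0|a0] := eqVneq a 0.
  apply: Or31; split=> //; move: h1 h2 h3 h4; rewrite a0 !(expr0n, mulr0, mul0r) /= addr0.
  move=> /esym/eqP; rewrite !mulf_eq0 (negbTE two) /= => /orP[] /eqP e.
    rewrite e expr0n /= add0r => h2 _ a1.
    have al0 : al != 0 by apply/eqP => al0; move/eqP: a1; rewrite al0 expr0n oner_eq0.
    have : ga = 0.
      by move/esym/eqP: h2; rewrite !mulf_eq0 (negbTE two) (negbTE al0) => /eqP.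
    by move=> g0; move: h0; rewrite g0 expr0n /= addrC => /eqP; rewrite addr_eq0 => /eqP.
  by move=> _ _ _; move: h0; rewrite e expr0n /= addrC => /eqP; rewrite addr_eq0 => /eqP.
have [b0|b0] := eqVneq b 0.
  apply: Or32; split=> //; move: h1 h2 h3 h0; rewrite b0 !(expr0n, mulr0, mul0r) /= addr0.
  move=> _ h2 /esym/eqP; rewrite !mulf_eq0 (negbTE two) /= => /orP[] /eqP e.
    by move=> _; move: h4; rewrite e expr0n /= addrC => /eqP; rewrite addr_eq0 => /eqP.
  move=> g1; have ga0 : ga != 0 by apply/eqP => al0; move/eqP: g1; rewrite al0 expr0n oner_eq0.
  have al0 : al = 0.
    move/esym/eqP: h2; rewrite e expr0n /= add0r !mulf_eq0 (negbTE two) (negbTE ga0) orbF.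
    by move/eqP.
  by move: h4; rewrite al0 expr0n /= addrC => /eqP; rewrite addr_eq0 => /eqP.
apply: Or33.
have E4 : a ^+ 4 = b ^+ 4.
  apply: (mulfI (_ : 16 * (a * b) ^+ 2 != 0)).
    by rewrite mulf_neq0 ?pnatr_eq0 ?expf_neq0 ?mulf_neq0.
  (* Both sides equal 4 al^2 be^2 ga^2; after removing 16 a^2 b^2 the difference is a^4 - b^4. *)
  have e1 : (1 + b ^+ 4) * (4 * a ^+ 3 * b) ^+ 2 = (1 + a ^+ 4) * (4 * a * b ^+ 3) ^+ 2.
    by rewrite h0 h1 h3 h4; ring.
  by apply/eqP; rewrite -subr_eq0; move/eqP: e1; rewrite -subr_eq0 => /eqP <-; apply/eqP; ring.
have al0 : al != 0.
  have : 4 * a ^+ 3 * b != 0 by rewrite !mulf_neq0 ?expf_neq0 ?pnatr_eq0.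
  by apply: contra => /eqP al0; rewrite h3 al0 mulr0 mul0r.
(* be and ga are now determined by al, and the middle coefficient gives A = 1
   for A = a ^+ 4. *)
have be_al : be * al = 2 * a ^+ 3 * b.
  by apply: (mulfI two); transitivity (2 * al * be); [ring | rewrite -h3; ring].
have gE : ga * a ^+ 2 = al * b ^+ 2.
  apply: (mulfI (_ : 2 * be * al != 0)).
    by rewrite -mulrA mulf_neq0 // be_al !mulf_neq0 ?expf_neq0.
  transitivity (2 * be * ga * (al * a ^+ 2)); first by ring.
  rewrite -h1; transitivity (2 * (be * al) * (al * b ^+ 2)); last by ring.
  by rewrite be_al; ring.
have g2 : ga ^+ 2 = al ^+ 2 by rewrite -h0 -h4 E4.
have key : 4 * (a ^+ 4) ^+ 2 + 2 * (1 + a ^+ 4) ^+ 2 = 6 * a ^+ 4 * (1 + a ^+ 4).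
  apply: (mulIf (_ : a ^+ 2 * b ^+ 2 != 0)); first by rewrite mulf_neq0 ?expf_neq0.
  have e2 : 6 * a ^+ 2 * b ^+ 2 * al ^+ 2 * a ^+ 4 = (be * al) ^+ 2 * a ^+ 4
      + 2 * al ^+ 2 * (al * (ga * a ^+ 2)) * a ^+ 2.
    by rewrite h2; ring.
  move: e2; rewrite be_al gE => e2.
  have e3 : 2 * al ^+ 2 * (al * (al * b ^+ 2)) * a ^+ 2
     = 2 * (1 + a ^+ 4) ^+ 2 * (a ^+ 2 * b ^+ 2) by rewrite h4; ring.
  move: e2; rewrite e3 -h4 => e2.
  transitivity ((2 * a ^+ 3 * b) ^+ 2 * a ^+ 4 + 2 * (1 + a ^+ 4) ^+ 2 * (a ^+ 2 * b ^+ 2)).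
    by ring.
  by rewrite -e2; ring.
suff A1 : a ^+ 4 = 1 by rewrite -E4.
apply/eqP; rewrite -subr_eq0; apply/eqP/(mulfI two).
rewrite mulr0; apply/eqP; move/eqP: key; rewrite -subr_eq0 => /eqP key; apply/eqP.
rewrite -[RHS]oppr0 -[in RHS]key; ring.
Qed.

Definition roots4 : seq C := [:: 1; -1; 'i; - 'i].
Definition roots8 : seq C := [seq x * sqrtC 'i | x <- roots4].

Lemma mem_roots4 x : (x \in roots4) = (x ^+ 4 == 1).
Proof.
have i2 : 'i ^+ 2 = -1 :> C := sqrCi C.
rewrite -subr_eq0; have -> : x ^+ 4 - 1 = (x - 1) * ((x - - 1) * ((x - 'i) * (x - - 'i))).
  transitivity ((x ^+ 2 - 1) * (x ^+ 2 - 'i ^+ 2)); last by ring.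
  by rewrite i2; ring.
by rewrite !mulf_eq0 !subr_eq0 !in_cons in_nil orbF.
Qed.

Lemma uniq_roots4 : uniq roots4.
Proof.
have i2 : 'i ^+ 2 = -1 :> C := sqrCi C.
have n11 : (1 : C) != -1 by rewrite -subr_eq0 opprK -mulr2n pnatr_eq0.
have n1 x : x ^+ 2 = 1 -> x != 'i /\ x != - 'i.
  by move=> x2; split; apply: contra n11 => /eqP E; rewrite -i2 -x2 E ?sqrrN.
have [a1 a2] := n1 1 (expr1n _ _).
have [a3 a4] : (-1 : C) != 'i /\ (-1 : C) != - 'i by apply: n1; rewrite sqrrN expr1n.
have a5 : ('i : C) != - 'i.
  by rewrite -subr_eq0 opprK -mulr2n mulrn_eq0 /= neq0Ci.
by rewrite /roots4 /= !in_cons !in_nil !orbF !negb_or n11 a1 a2 a3 a4 a5.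
Qed.

Lemma sqrt_i_exp4 : sqrtC ('i : C) ^+ 4 = -1.
Proof. by rewrite (exprM _ 2 2) sqrtCK sqrCi. Qed.

Lemma sqrt_i_neq0 : sqrtC ('i : C) != 0.
Proof. by rewrite sqrtC_eq0 neq0Ci. Qed.

Lemma mem_roots8 x : (x \in roots8) = (x ^+ 4 == -1).
Proof.
apply/mapP/eqP => [[y]|x4].
  by rewrite mem_roots4 => /eqP y4 ->; rewrite exprMn y4 sqrt_i_exp4 mul1r.
exists (x / sqrtC 'i); last by rewrite divfK // sqrt_i_neq0.
by rewrite mem_roots4 expr_div_n x4 sqrt_i_exp4 divff // oppr_eq0 oner_eq0.
Qed.

Lemma uniq_roots8 : uniq roots8.
Proof.
by rewrite map_inj_uniq ?uniq_roots4 //; exact: (mulIf sqrt_i_neq0).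
Qed.

(** Twelve hyperflex tangents, in three groups of four, and 16 further bitangents. In every triple
    the first nonzero entry is 1, so proportional triples are equal. *)
Definition fermat_triples : seq (C * C * C) :=
  [seq (1, - x, 0) | x <- roots8] ++ [seq (1, 0, - x) | x <- roots8] ++
  [seq (0, 1, - x) | x <- roots8] ++ [seq (1, x, y) | x <- roots4, y <- roots4].

Lemma size_fermat_triples : size fermat_triples = 28%N.
Proof. by []. Qed.

Lemma fermat_triplesP l : l \in fermat_triples <->
  [\/ exists2 x, x ^+ 4 = -1 & l = (1, - x, 0), exists2 x, x ^+ 4 = -1 & l = (1, 0, - x),
      exists2 x, x ^+ 4 = -1 & l = (0, 1, - x) |
      exists x y, [/\ x ^+ 4 = 1, y ^+ 4 = 1 & l = (1, x, y)]].
Proof.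
rewrite 3!mem_cat; split.
  case/or4P => [/mapP [x]|/mapP [x]|/mapP [x]|/allpairsPdep [x [y []]]].
  - by rewrite mem_roots8 => /eqP ? ->; apply: Or41; exists x.
  - by rewrite mem_roots8 => /eqP ? ->; apply: Or42; exists x.
  - by rewrite mem_roots8 => /eqP ? ->; apply: Or43; exists x.
  - by rewrite !mem_roots4 => /eqP ? /eqP ? ->; apply: Or44; exists x, y.
case=> [[x x4 ->]|[x x4 ->]|[x x4 ->]|[x [y [x4 y4 ->]]]]; apply/or4P.
- by apply: Or41; apply: map_f; rewrite mem_roots8 x4.
- by apply: Or42; apply: map_f; rewrite mem_roots8 x4.
- by apply: Or43; apply: map_f; rewrite mem_roots8 x4.
- by apply: Or44; apply: allpairs_f; rewrite mem_roots4 ?x4 ?y4.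
Qed.

Lemma uniq_fermat_triples : uniq fermat_triples.
Proof.
have r8 x : x \in roots8 -> x != 0.
  by rewrite mem_roots8; apply: contraTneq => ->; rewrite expr0n /= eq_sym oppr_eq0 oner_eq0.
have r4 x : x \in roots4 -> x != 0.
  by rewrite mem_roots4; apply: contraTneq => ->; rewrite expr0n /= eq_sym oner_eq0.
rewrite /fermat_triples 3!cat_uniq; apply/and3P; split; [|apply/hasPn|apply/and3P; split].
- by rewrite map_inj_uniq ?uniq_roots8 // => x y [/oppr_inj].
- move=> l; rewrite 2!mem_cat => H; apply/mapP => -[x /r8 x0 lE]; move: H; rewrite lE.
  case/or3P => [/mapP [y _ []]|/mapP [y _ []]|/allpairsPdep [y [z [_ /r4 z0 []]]]].
  + by move/eqP; rewrite oppr_eq0 (negbTE x0).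
  + by move/eqP; rewrite oner_eq0.
  + by move=> _ e; move: z0; rewrite -e eqxx.
- by rewrite map_inj_uniq ?uniq_roots8 // => x y [/oppr_inj].
- apply/hasPn => l; rewrite mem_cat => H; apply/mapP => -[x /r8 x0 lE]; move: H; rewrite lE.
  case/orP => [/mapP [y _ []]|/allpairsPdep [y [z [/r4 y0 _ []]]]].
  + by move/eqP; rewrite oner_eq0.
  + by move=> e _; move: y0; rewrite -e eqxx.
- apply/and3P; split.
  + by rewrite map_inj_uniq ?uniq_roots8 // => x y [/oppr_inj].
  + apply/hasPn => l /allpairsPdep [y [z [_ _ ->]]]; apply/mapP => -[x _ []].
    by move/eqP; rewrite oner_eq0.
  + by rewrite allpairs_uniq ?uniq_roots4 // => -[x y] [x' y'] _ _ [-> ->].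
Qed.

Definition triple_sum l : C := l.1.1 + l.1.2 + l.2.

(** No bitangent of the Fermat quartic passes through (1 : 1 : 1), the point that the change of
    coordinates moves to (0 : 0 : 1). *)
Lemma triple_sum_neq0 l : l \in fermat_triples -> triple_sum l != 0.
Proof.
have n11 : (1 : C) != -1 by rewrite -subr_eq0 opprK -mulr2n pnatr_eq0.
have n8 x : x ^+ 4 = -1 -> 1 - x != 0.
  by move=> x4; rewrite subr_eq0; apply: contra n11 => /eqP x1; rewrite -x4 -x1 expr1n.
move/fermat_triplesP => [[x x4 ->]|[x x4 ->]|[x x4 ->]|[x [y [x4 y4 ->]]]]; rewrite /triple_sum /=.
- by rewrite addr0 n8.
- by rewrite addr0 n8.
- by rewrite add0r n8.
have i2 : 'i ^+ 2 = -1 :> C := sqrCi C.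
apply/eqP => E; have yE : y = - (1 + x) by apply/eqP; rewrite -addr_eq0 addrC E.
(* A vanishing sum would make x and 1 + x both fourth roots of unity. For x = 1, -1, i, -i the
   fourth power of 1 + x is 16, 0, -4, -4. *)
have : (1 + x) ^+ 4 = 1 by rewrite -[RHS]y4 yE; ring.
have ne k : (k.+1%:R : C) != 0 by rewrite pnatr_eq0.
move/eqP: x4; rewrite -mem_roots4 !in_cons in_nil orbF => /or4P[] /eqP -> /eqP.
- rewrite -subr_eq0 (_ : (1 + 1) ^+ 4 - 1 = 15%:R); last by ring.
  by rewrite (negbTE (ne _)).
- by rewrite subrr expr0n /= eq_sym oner_eq0.
- rewrite -subr_eq0 (_ : (1 + 'i) ^+ 4 - 1 = - 5%:R); last first.
    have -> : (1 + 'i) ^+ 4 - 1 = 4 * 'i * (1 + 'i ^+ 2) + 6 * 'i ^+ 2 + ('i ^+ 2) ^+ 2 :> C by ring.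
    by rewrite i2; ring.
  by rewrite oppr_eq0 (negbTE (ne _)).
- rewrite -subr_eq0 (_ : (1 - 'i) ^+ 4 - 1 = - 5%:R); last first.
    have -> : (1 - 'i) ^+ 4 - 1 = - 4 * 'i * (1 + 'i ^+ 2) + 6 * 'i ^+ 2 + ('i ^+ 2) ^+ 2 :> C by ring.
    by rewrite i2; ring.
  by rewrite oppr_eq0 (negbTE (ne _)).
Qed.

(* The line l_0 Y_0 + l_1 Y_1 + l_2 Y_2 = 0 in the coordinates
   Y = (x_0 + x_2, x_1 + x_2, x_2), solved for x_2. *)
Definition shifted_line l : C * C := (- (l.1.1 / triple_sum l), - (l.1.2 / triple_sum l)).

Definition fermat_lines : seq (C * C) := [seq shifted_line l | l <- fermat_triples].

Lemma size_fermat_lines : size fermat_lines = 28%N.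
Proof. by rewrite size_map size_fermat_triples. Qed.

Lemma uniq_fermat_lines : uniq fermat_lines.
Proof.
rewrite map_inj_in_uniq ?uniq_fermat_triples // => l l' lin lin'.
have s0 := triple_sum_neq0 lin; have s0' := triple_sum_neq0 lin'.
move=> [/oppr_inj e0 /oppr_inj e1].
pose k := triple_sum l / triple_sum l'.
have k0 : k != 0 by rewrite mulf_neq0 ?invr_eq0.
have l0 : l.1.1 = k * l'.1.1.
  by rewrite -[LHS](divfK s0) e0 /k; field.
have l1 : l.1.2 = k * l'.1.2.
  by rewrite -[LHS](divfK s0) e1 /k; field.
have l2 : l.2 = k * l'.2.
  have : triple_sum l = k * triple_sum l' by rewrite /k divfK.
  rewrite /triple_sum l0 l1 !mulrDr => /addrI. by [].
have lead m : m \in fermat_triples -> m.1.1 = 1 \/ m.1.1 = 0 /\ m.1.2 = 1.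
  by case/fermat_triplesP => [[x x4 ->]|[x x4 ->]|[x x4 ->]|[x [y [x4 y4 ->]]]] /=; auto.
have k1 : k = 1.
  move: l0 l1; case: (lead l lin) => [->|[-> ->]]; case: (lead l' lin') => [->|[-> ->]].
  - by rewrite mulr1.
  - by rewrite mulr0 => /eqP; rewrite oner_eq0.
  - by rewrite mulr1 => /esym/eqP; rewrite (negbTE k0).
  - by rewrite mulr1.
move: l0 l1 l2; rewrite k1 !mul1r; case: (l) (l') => [[? ?] ?] [[? ?] ?] /= -> -> ->.
by [].
Qed.

(** In this form (0 : 0 : 1) has Y-coordinates (1 : 1 : 1) and lies on no bitangent, whereas in the
    standard coordinates it lies on four hyperflex tangents. *)
Definition shifted_fermat : {mpoly C[3]} :=
  ('X_0 + 'X_2) ^+ 4 + ('X_1 + 'X_2) ^+ 4 + 'X_2 ^+ 4.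

Lemma shifted_fermat_homog : shifted_fermat \is 4.-homog.
Proof.
have hX (i : 'I_3) : ('X_i : {mpoly C[3]}) \is 1.-homog by rewrite dhomogX; apply/eqP; exact: mdeg1.
have h4 (p : {mpoly C[3]}) : p \is 1.-homog -> p ^+ 4 \is 4.-homog by move=> hp; exact: (dhomogMn 4 hp).
by rewrite !rpredD // h4 // rpredD.
Qed.

Lemma meval_shifted_fermat (v : 'I_3 -> C) :
  shifted_fermat.@[v] = (v 0 + v 2) ^+ 4 + (v 1 + v 2) ^+ 4 + v 2 ^+ 4.
Proof. by rewrite !(mevalD, rmorphXn) /= !mevalD !mevalXU. Qed.

Lemma conic_substitution z (u1 u2 v1 v2 : C) : exists al be ga, forall x y,
  on_conic z (u1 * x + u2 * y) (v1 * x + v2 * y) =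
  al * x ^+ 2 + be * (x * y) + ga * y ^+ 2.
Proof.
rewrite /on_conic; set q0 := z 0 _; set q1 := z 0 (inord 3); set q2 := z 0 (inord 4).
exists (q0 * u1 ^+ 2 + q1 * (u1 * v1) + q2 * v1 ^+ 2),
  (2 * q0 * u1 * u2 + q1 * (u1 * v2 + u2 * v1) + 2 * q2 * v1 * v2),
  (q0 * u2 ^+ 2 + q1 * (u2 * v2) + q2 * v2 ^+ 2) => x y; ring.
Qed.

Lemma shifted_fermat_lines z : square_defect (chart_coefs shifted_fermat) z = 0 ->
  (z 0 0, z 0 1) \in fermat_lines.
Proof.
move=> /(square_defect_on_line shifted_fermat_homog) H.
move: H; move: (z 0 0) (z 0 1) => a b H.
(* In the coordinates Y the line x_2 = a x_0 + b x_1 is a Y_0 + b Y_1 + c Y_2 = 0. *)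
have [c cE] : exists c, c = - (1 + a + b) by eexists.
have Y y0 y1 y2 : a * y0 + b * y1 + c * y2 = 0 ->
    y0 ^+ 4 + y1 ^+ 4 + y2 ^+ 4 = on_conic z (y0 - y2) (y1 - y2) ^+ 2.
  move=> E; rewrite -H meval_shifted_fermat !vec3E.
  have -> : a * (y0 - y2) + b * (y1 - y2) = y2.
    apply/eqP; rewrite -subr_eq0; apply/eqP; rewrite -[RHS]E cE; ring.
  by rewrite !subrK.
have prop k l : k != 0 -> l \in fermat_triples -> a = k * l.1.1 -> b = k * l.1.2 ->
    c = k * l.2 -> (a, b) \in fermat_lines.
  move=> k0 lin ea eb ec; apply/mapP; exists l => //; rewrite /shifted_line.
  have s0 := triple_sum_neq0 lin.
  have kE : k * triple_sum l = -1.
    by rewrite /triple_sum !mulrDr -ea -eb -ec cE; ring.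
  have e x : k * x = - (x / triple_sum l).
    by apply: (mulIf s0); rewrite mulNr divfK // mulrAC kE mulN1r.
  by rewrite ea eb !e.
have inv4 x e : e != 0 -> x ^+ 4 = e -> e ^+ 2 = 1 -> x != 0 /\ (x^-1) ^+ 4 = e.
  move=> e0 xe e2; split; first by apply/eqP => x0; move: e0; rewrite -xe x0 expr0n eqxx.
  by rewrite exprVn xe; apply: (mulIf e0); rewrite mulVf // -expr2 e2.
have m10 : (-1 : C) != 0 by rewrite oppr_eq0 oner_eq0.
have m12 : (-1 : C) ^+ 2 = 1 by rewrite sqrrN expr1n.
have no0 : (0 : C) ^+ 4 <> 1 by rewrite expr0n /= => /eqP; rewrite eq_sym oner_eq0.
have no1 : (0 : C) ^+ 4 <> -1 by rewrite expr0n /= => /eqP; rewrite eq_sym (negbTE m10).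
(* For c = 0 the line cannot be solved for Y_2. It is then solved for Y_1, or it is Y_0 = 0, on
   which the Fermat quartic is not a square. *)
have [c0|c0] := eqVneq c 0.
  have [b0|b0] := eqVneq b 0.
    have [al [be [ga E]]] := conic_substitution z 0 (-1) 1 (-1).
    have [|||] := @fermat_square 0 0 al be ga.
    - move=> x y; rewrite -E; transitivity (0 ^+ 4 + x ^+ 4 + y ^+ 4); first by ring.
      rewrite (Y 0 x y); last by rewrite b0 c0; ring.
      by congr (on_conic z _ _ ^+ 2); ring.
    - by case.
    - by case.
    - by case.
  pose k := - (a / b).
  have kE : a + b * k = 0 by rewrite /k; field.
  have [al [be [ga E]]] := conic_substitution z 1 (-1) k (-1).
  have := @fermat_square k 0 al be ga; case.
  - move=> x y; rewrite -E; transitivity (x ^+ 4 + (k * x) ^+ 4 + y ^+ 4); first by ring.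
    rewrite (Y x (k * x) y); last by rewrite c0; transitivity ((a + b * k) * x); [ring | rewrite kE mul0r].
    by congr (on_conic z _ _ ^+ 2); ring.
  - by case.
  - case=> _ k4; have [k0 kV] := inv4 k (-1) m10 k4 m12.
    have a0 : a != 0.
      by apply/eqP => a0; move/eqP: k0; rewrite /k a0 mul0r oppr0.
    apply: (prop a (1, - (k^-1), 0)) => //=; rewrite ?mulr1 ?mulr0 //.
      by apply/fermat_triplesP; apply: Or41; exists k^-1.
    by rewrite /k; field; rewrite b0 a0.
  - by case.
have [a' aE] : exists a', a = - c * a' by exists (- (a / c)); rewrite mulrNN mulrC divfK.
have [b' bE] : exists b', b = - c * b' by exists (- (b / c)); rewrite mulrNN mulrC divfK.
have [al [be [ga E]]] := conic_substitution z (1 - a') (- b') (- a') (1 - b').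
have := @fermat_square a' b' al be ga; case.
- move=> x y; rewrite -E (Y x y (a' * x + b' * y)); last by rewrite aE bE; ring.
  by congr (on_conic z _ _ ^+ 2); ring.
- case=> a0 b4; have [b0 bV] := inv4 b' (-1) m10 b4 m12.
  have nb : b != 0 by rewrite bE mulf_neq0 ?oppr_eq0.
  apply: (prop b (0, 1, - (b'^-1))) => //=; rewrite ?mulr1 ?mulr0 //.
  + by apply/fermat_triplesP; apply: Or43; exists b'^-1.
  + by rewrite aE a0 mulr0.
  + by rewrite bE; field.
- case=> b0 a4; have [a0 aV] := inv4 a' (-1) m10 a4 m12.
  have na : a != 0 by rewrite aE mulf_neq0 ?oppr_eq0.
  apply: (prop a (1, 0, - (a'^-1))) => //=; rewrite ?mulr1 ?mulr0 //.
  + by apply/fermat_triplesP; apply: Or42; exists a'^-1.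
  + by rewrite bE b0 mulr0.
  + by rewrite aE; field.
case=> a4 b4; have [a0 aV] := inv4 a' 1 (oner_neq0 _) a4 (expr1n _ _).
have na : a != 0 by rewrite aE mulf_neq0 ?oppr_eq0.
apply: (prop a (1, b' / a', - (a'^-1))) => //=; rewrite ?mulr1 //.
- apply/fermat_triplesP; apply: Or44; exists (b' / a'), (- (a'^-1)); split=> //.
    by rewrite expr_div_n a4 b4 divr1.
  by rewrite -aV; ring.
- by rewrite aE bE; field.
- by rewrite aE; field.
Qed.

Lemma zero_of_square (f : {mpoly C[3]}) a b (al be ga : C) : f \is 4.-homog ->
  (forall t, f.@[vec3 1 t (a + b * t) 0] = (al + be * t + ga * t ^+ 2) ^+ 2) ->
  exists2 z, square_defect (chart_coefs f) z = 0 & (z 0 0, z 0 1) = (a, b).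
Proof.
move=> hf H; pose z : 'rV[C]_5 := \row_i nth 0 [:: a; b; al; be; ga] i.
have z0 : z 0 0 = a by rewrite mxE.
have z1 : z 0 1 = b by rewrite mxE.
exists z; last by rewrite z0 z1.
apply/square_defect_eq0; apply: (@poly_fun_eq _ _ _ 1); first exact: oner_neq0.
move=> t _; rewrite chart_quartic_horner // line_polyE z0 z1 conic_polyE.
rewrite !(hornerD, hornerC, hornerZ, hornerX, hornerXn, horner_exp) H.
by rewrite !mxE !inordK.
Qed.

Lemma shifted_fermat_zero ab : ab \in fermat_lines ->
  exists2 z, square_defect (chart_coefs shifted_fermat) z = 0 & (z 0 0, z 0 1) = ab.
Proof.
case/mapP => l lin ->; have s0 := triple_sum_neq0 lin.
(* The scale that makes the coefficient of x_2 equal to -1, since that coefficient of l in the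
   coordinates x is [triple_sum l]. *)
rewrite /shifted_line; set k := - (triple_sum l)^-1.
have kE : k * triple_sum l = -1 by rewrite /k mulNr mulVf.
have [-> ->] : - (l.1.1 / triple_sum l) = k * l.1.1 /\ - (l.1.2 / triple_sum l) = k * l.1.2.
  by rewrite /k; split; ring.
set a := k * l.1.1; set b := k * l.1.2.
have k0 : k != 0 by rewrite oppr_eq0 invr_eq0.
(* The point (1 : t : h) of the line in the coordinates Y. *)
have on t (h := a + b * t) : l.1.1 * (1 + h) + l.1.2 * (t + h) + l.2 * h = 0.
  apply: (mulfI k0); rewrite mulr0.
  transitivity (k * triple_sum l * h + (a + b * t)); first by rewrite /triple_sum /a /b; ring.
  by rewrite kE /h; ring.
case/fermat_triplesP: lin on => [[x x4 E]|[x x4 E]|[x x4 E]|[x [y [x4 y4 E]]]]; rewrite E /= => on.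
(* On a hyperflex tangent two fourth powers cancel and the third is the square of the square of a
   linear polynomial; the three coefficients given are those of the latter square. The next two
   cases are alike. *)
- apply: (@zero_of_square _ a b (a ^+ 2) (2 * a * b) (b ^+ 2) shifted_fermat_homog) => t.
  rewrite meval_shifted_fermat !vec3E; have := on t; set h := a + b * t => oh.
  have -> : 1 + h = x * (t + h).
    by apply/eqP; rewrite -subr_eq0; apply/eqP; rewrite -[RHS]oh; ring.
  rewrite exprMn x4 mulN1r addNr add0r.
  by rewrite /h; ring.
- apply: (@zero_of_square _ a b (a ^+ 2) (2 * a * (1 + b)) ((1 + b) ^+ 2) shifted_fermat_homog) => t.
  rewrite meval_shifted_fermat !vec3E; have := on t; set h := a + b * t => oh.
  have -> : 1 + h = x * h.
    by apply/eqP; rewrite -subr_eq0; apply/eqP; rewrite -[RHS]oh; ring.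
  rewrite exprMn x4 mulN1r addrAC addNr add0r.
  by rewrite /h; ring.
- apply: (@zero_of_square _ a b ((1 + a) ^+ 2) (2 * (1 + a) * b) (b ^+ 2) shifted_fermat_homog) => t.
  rewrite meval_shifted_fermat !vec3E; have := on t; set h := a + b * t => oh.
  have -> : t + h = x * h.
    by apply/eqP; rewrite -subr_eq0; apply/eqP; rewrite -[RHS]oh; ring.
  rewrite exprMn x4 mulN1r -addrA addNr addr0.
  by rewrite /h; ring.
(* A + B + C = 0 implies A^4 + B^4 + C^4 = 2 (B^2 + B C + C^2)^2. *)
pose r := sqrtC (2 : C); have r2 : r ^+ 2 = 2 by rewrite sqrtCK.
pose m := y * b + x * (1 + b).
apply: (@zero_of_square _ a b (r * ((x * a) ^+ 2 + (x * a) * (y * a) + (y * a) ^+ 2))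
   (r * (2 * (x * a) * (x * (1 + b)) + (x * a) * (y * b) + (x * (1 + b)) * (y * a) + 2 * (y * a) * (y * b)))
   (r * ((x * (1 + b)) ^+ 2 + (x * (1 + b)) * (y * b) + (y * b) ^+ 2)) shifted_fermat_homog) => t.
rewrite meval_shifted_fermat !vec3E; have := on t; set h := a + b * t => oh.
have -> : 1 + h = - (x * (t + h) + y * h).
  by apply/eqP; rewrite -subr_eq0; apply/eqP; rewrite -[RHS]oh; ring.
transitivity (r ^+ 2 * ((x * (t + h)) ^+ 2 + x * (t + h) * (y * h) + (y * h) ^+ 2) ^+ 2).
  rewrite r2; transitivity ((x * (t + h) + y * h) ^+ 4 + (x * (t + h)) ^+ 4 + (y * h) ^+ 4).
    by rewrite [(x * (t + h)) ^+ 4]exprMn [(y * h) ^+ 4]exprMn x4 y4; ring.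
  by ring.
by rewrite /h; ring.
Qed.

End FermatBitangents.

(** * Homogeneous components and open nonvanishing conditions *)

Section HomogeneousComponents.
Variables (C : numClosedFieldType) (n : nat).
Implicit Types (p : {mpoly C[n]}) (v : 'I_n -> C).

Definition scaling_poly p v : {poly C} :=
  \sum_(m <- msupp p) (p@_m * \prod_i v i ^+ m i) *: 'X^(mdeg m).

Lemma scaling_poly_horner p v c : (scaling_poly p v).[c] = p.@[fun i => c * v i].
Proof.
rewrite /scaling_poly horner_sum [in RHS](mpolyE p) raddf_sum; apply: eq_bigr => m _.
rewrite /= mevalZ mevalX hornerZ hornerXn mdegE -prodrXr -mulrA -big_split /=.
by congr (_ * _); apply: eq_bigr => i _; rewrite exprMn mulrC.
Qed.

Lemma scaling_poly_coef p v d : (scaling_poly p v)`_d = (pihomog mdeg d p).@[v].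
Proof.
rewrite pihomogE raddf_sum coef_sum [RHS]big_mkcond; apply: eq_bigr => m _ /=.
by rewrite coefZ coefXn eq_sym; case: eqP; rewrite ?mulr1 ?mulr0 // mevalZ mevalX.
Qed.

Lemma mcoeff_pihomog p m : (pihomog mdeg (mdeg m) p)@_m = p@_m.
Proof.
have [k pk] : exists k, (mmeasure mdeg p <= k)%N /\ (mdeg m < k)%N.
  by exists (mmeasure mdeg p + (mdeg m).+1)%N; split; lia.
case: pk => pk mk; have E := congr1 (mcoeff m) (pihomog_partitionE pk).
rewrite [RHS]E [RHS]raddf_sum (bigD1 (Ordinal mk)) //=.
rewrite big1 ?addr0 // => i im; apply: memN_msupp_eq0; apply: contra im => mi.
by rewrite -val_eqE /= eq_sym -(dhomogP _ _ _ (pihomogP mdeg i p) m mi).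
Qed.

Lemma vanishing_component p v d : (forall c, p.@[fun i => c * v i] = 0) ->
  (pihomog mdeg d p).@[v] = 0.
Proof.
move=> H; rewrite -scaling_poly_coef.
suff -> : scaling_poly p v = 0 by rewrite coef0.
apply: (@poly_fun_eq _ _ _ 1); first exact: oner_neq0.
by move=> c _; rewrite scaling_poly_horner H horner0.
Qed.

(** Lets a homogeneous component stand in for a polynomial that need not be homogeneous, when the
    condition it guards is invariant under scaling. *)
Lemma component_scaling p v d : (pihomog mdeg d p).@[v] != 0 ->
  exists2 c, c != 0 & p.@[fun i => c * v i] != 0.
Proof.
move=> pd; suff : ~ (forall c, c != 0 -> p.@[fun i => c * v i] = 0).
  move=> H; have [//|nex] := boolp.pselect (exists2 c, c != 0 & p.@[fun i => c * v i] != 0).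
  by case: H => c c0; apply/eqP; apply/negPn/negP => pc; apply: nex; exists c.
move=> H; move: pd; rewrite -scaling_poly_coef.
suff -> : scaling_poly p v = 0 by rewrite coef0 eqxx.
apply: (@poly_fun_eq _ _ _ 'X); first by rewrite polyX_eq0.
by move=> c; rewrite hornerX => c0; rewrite scaling_poly_horner H // horner0.
Qed.

Lemma some_component p v : p.@[v] != 0 -> exists d, (pihomog mdeg d p).@[v] != 0.
Proof.
move=> pv; apply: boolp.contrapT => H; move: pv.
rewrite (pihomog_partitionE (leqnn (mmeasure mdeg p))) raddf_sum big1 ?eqxx // => d _ /=.
by apply/eqP/negPn/negP => hd; apply: H; exists d.
Qed.

End HomogeneousComponents.

Section OpenNonvanishing.
Variable C : numClosedFieldType.
Local Notation A := {mpoly C[15]}.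
Variables (Fg : 'I_3 -> {mpoly A[3]}) (d : 'I_3 -> nat) (N : nat) (u0 : 'I_15 -> C).
Let sp u i : {mpoly C[3]} := map_mpoly (meval u) (Fg i).
Hypothesis sp_homog : forall u i, sp u i \is (d i).-homog.
Hypothesis monomial_in_ideal : forall m, mdeg m = N ->
  exists B : 'I_3 -> {mpoly C[3]}, 'X_[m] = \sum_i B i * sp u0 i.

(* Writing every monomial of degree N in the ideal generated by the forms at u0
   and keeping the cofactors, the same combinations at u still span the forms of
   degree N as long as their coefficient matrix is invertible. *)
Lemma open_no_common_zero : exists2 P : A, P.@[u0] != 0 &
  forall u, P.@[u] != 0 -> forall v : 'I_3 -> C, (exists i, v i != 0) ->
  exists i, (sp u i).@[v] != 0.
Proof.
pose e (a : 'I_(size (exps N))) := nth 0%MM (exps N) a.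
have eN a : mdeg (e a) = N by apply/eqP; rewrite -mem_exps mem_nth.
have /boolp.choice [B HB] := fun a => monomial_in_ideal (eN a).
pose H a : {mpoly A[3]} := \sum_i map_mpoly (@mpolyC 15 C) (B a i) * Fg i.
pose M : 'M[A]_(size (exps N)) := \matrix_(a, b) (H a)@_(e b).
have spH u a : map_mpoly (meval u) (H a) = \sum_i B a i * sp u i.
  rewrite rmorph_sum; apply: eq_bigr => i _; rewrite rmorphM; congr (_ * _).
  by apply/mpolyP => m; rewrite !mcoeff_map_mpoly /= mevalC.
have Mu u : (\det M).@[u] = \det (\matrix_(a, b) (\sum_i B a i * sp u i)@_(e b)).
  rewrite -det_map_mx; congr (\det _); apply/matrixP => a b.
  by rewrite !mxE -spH mcoeff_map_mpoly.
exists (\det M).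
  rewrite Mu (_ : \matrix_(a, b) _ = 1%:M) ?det1 ?oner_neq0 //.
  apply/matrixP => a b; rewrite !mxE -HB mcoeffX /e nth_uniq ?uniq_exps //.
move=> u Pu v v0; have [//|nex] := boolp.pselect (exists i, (sp u i).@[v] != 0).
have z i c : (sp u i).@[fun j => c * v j] = 0.
  have vi : (sp u i).@[v] = 0 by apply/eqP/negPn/negP => si; apply: nex; exists i.
  have E w : (sp u i).@[w] = (sp u i).@[(\row_j w j : 'rV_3) 0].
    by apply: meval_eq => j; rewrite mxE.
  rewrite E (_ : \row_j _ = c *: \row_j v j); last by apply/rowP => j; rewrite !mxE.
  by rewrite (meval_homogZ _ _ (sp_homog u i)) -E vi mulr0.
(* The values at v of all monomials of degree N. The matrix kills this vector at a common zero, yet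
   one of its entries is the N-th power of a nonzero coordinate. *)
pose w : 'cV[C]_(size (exps N)) := \col_b \prod_i v i ^+ e b i.
have Mw : (\matrix_(a, b) (\sum_i B a i * sp u i)@_(e b)) *m w = 0.
  apply/colP => a; rewrite mxE [RHS]mxE; pose p := \sum_i B a i * sp u i.
  have : (pihomog mdeg N p).@[v] = 0.
    (* The cofactors need not be homogeneous, so only the degree N component of the combination
       matters; it vanishes at v because the combination vanishes on all multiples of v. *)
    apply: vanishing_component => c; rewrite raddf_sum big1 // => i _ /=.
    by rewrite mevalM z mulr0.
  rewrite (mpoly_exps (pihomogP mdeg N p)) raddf_sum (big_nth 0%MM) big_mkord => pN.
  rewrite -[RHS]pN; apply: eq_bigr => b _; rewrite !mxE /= mevalZ mevalX; congr (_ * _).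
  by have := mcoeff_pihomog p (e b); rewrite eN => <-.
have U : (\matrix_(a, b) (\sum_i B a i * sp u i)@_(e b)) \in unitmx.
  by rewrite unitmxE unitfE -Mu.
have w0 : w = 0 by rewrite -[w](mulKmx U) Mw mulmx0.
case: v0 => i vi.
have /(nthP 0%MM) [b bs be] : (U_(i) *+ N)%MM \in exps N by rewrite mem_exps mdegMn mdeg1 mul1n.
move/colP: w0 => /(_ (Ordinal bs)); rewrite !mxE /e /= be => /eqP.
rewrite (bigD1 i) //= big1 ?mulr1 => [|j ji].
  by rewrite mulmnE mnm1E eqxx mul1n expf_eq0 (negbTE vi) andbF.
by rewrite mulmnE mnm1E eq_sym (negbTE ji) mul0n expr0.
Qed.

End OpenNonvanishing.

Section Ideals.
Variable R : comNzRingType.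
Variable F : 'I_3 -> R.

Definition in_ideal p := exists B : 'I_3 -> R, p = \sum_i B i * F i.

Lemma in_ideal_add p q : in_ideal p -> in_ideal q -> in_ideal (p + q).
Proof.
move=> [B ->] [B' ->]; exists (fun i => B i + B' i).
by rewrite -big_split; apply: eq_bigr => i _; rewrite mulrDl.
Qed.

Lemma in_ideal_mul p q : in_ideal q -> in_ideal (p * q).
Proof.
move=> [B ->]; exists (fun i => p * B i).
by rewrite mulr_sumr; apply: eq_bigr => i _; rewrite mulrA.
Qed.

Lemma in_ideal_gen i : in_ideal (F i).
Proof.
exists (fun j => (j == i)%:R); rewrite (bigD1 i) //= eqxx mul1r big1 ?addr0 //.
by move=> j /negbTE ->; rewrite mul0r.
Qed.

(* A change of variables x, y, z = u - w, v - w, w does not affect the span of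
   the products of n variables. *)
Lemma in_shifted_power (u v w : R) n :
  forall J : R -> Prop, (forall p q, J p -> J q -> J (p + q)) -> (forall p q, J q -> J (p * q)) ->
  (forall i j k, (i + j + k = n)%N -> J (u ^+ i * v ^+ j * w ^+ k)) ->
  forall a b c, (a + b + c = n)%N -> J ((u - w) ^+ a * (v - w) ^+ b * w ^+ c).
Proof.
elim: n => [|n IH] J JD JM H a b c abc.
  have [-> [-> ->]] : a = 0%N /\ b = 0%N /\ c = 0%N by lia.
  exact: (H 0%N 0%N 0%N).
have step y : (forall i j k, (i + j + k = n)%N -> J (y * (u ^+ i * v ^+ j * w ^+ k))) ->
    forall a b c, (a + b + c = n)%N -> J (y * ((u - w) ^+ a * (v - w) ^+ b * w ^+ c)).
  move=> Hy; apply: (IH (fun q => J (y * q))) => [p q Jp Jq|p q Jq|//].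
    by rewrite mulrDr; exact: JD.
  by rewrite mulrCA; exact: JM.
have Ju := step u _; have Jv := step v _; have Jw := step w _.
have {}Ju : forall a b c, (a + b + c = n)%N -> J (u * ((u - w) ^+ a * (v - w) ^+ b * w ^+ c)).
  by apply: Ju => i j k ijk; rewrite !mulrA -exprS; apply: H; lia.
have {}Jv : forall a b c, (a + b + c = n)%N -> J (v * ((u - w) ^+ a * (v - w) ^+ b * w ^+ c)).
  apply: Jv => i j k ijk; rewrite (_ : v * _ = u ^+ i * v ^+ j.+1 * w ^+ k); first by apply: H; lia.
  by rewrite exprS; ring.
have {}Jw : forall a b c, (a + b + c = n)%N -> J (w * ((u - w) ^+ a * (v - w) ^+ b * w ^+ c)).
  apply: Jw => i j k ijk; rewrite (_ : w * _ = u ^+ i * v ^+ j * w ^+ k.+1); first by apply: H; lia.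
  by rewrite exprS; ring.
have JN p : J p -> J (- p) by move=> Jp; rewrite -mulN1r; exact: JM.
case: a abc => [|a] abc; last first.
  rewrite (_ : _ * _ * _ = u * ((u - w) ^+ a * (v - w) ^+ b * w ^+ c)
      + - (w * ((u - w) ^+ a * (v - w) ^+ b * w ^+ c))).
    by apply: JD; [apply: Ju; lia | apply: JN; apply: Jw; lia].
  by rewrite exprS; ring.
case: b abc => [|b] abc; last first.
  rewrite (_ : _ * _ * _ = v * ((u - w) ^+ 0 * (v - w) ^+ b * w ^+ c)
      + - (w * ((u - w) ^+ 0 * (v - w) ^+ b * w ^+ c))).
    by apply: JD; [apply: Jv; lia | apply: JN; apply: Jw; lia].
  by rewrite exprS; ring.
case: c abc => [|c] abc; first by lia.
rewrite (_ : _ * _ * _ = w * ((u - w) ^+ 0 * (v - w) ^+ 0 * w ^+ c)); first by apply: Jw; lia.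
by rewrite exprS; ring.
Qed.

End Ideals.

(** * Nondegeneracy near the shifted Fermat quartic *)

Section GenericQuartic.
Variable C : numClosedFieldType.
Local Notation A := {mpoly C[15]}.

Definition multinomial (k : 'I_15) : C := 4`!%:R / (\prod_i (exp4 k i)`!)%:R.

Definition generic_quartic : {mpoly A[3]} :=
  \sum_k ((multinomial k)%:MP * 'X_k) *: 'X_[exp4 k].

Definition quartic_of (u : 'I_15 -> C) : {mpoly C[3]} :=
  map_mpoly (meval u) generic_quartic.

Lemma quartic_ofE u : quartic_of u = form_of_coefs (\col_k (multinomial k * u k)).
Proof.
rewrite /quartic_of /generic_quartic raddf_sum; apply: eq_bigr => k _; rewrite mxE /=.
have E : ((multinomial k)%:MP * 'X_k : A).@[u] = multinomial k * u k.
  by rewrite mevalM mevalC mevalXU.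
apply/mpolyP => m; rewrite mcoeff_map_mpoly !mcoeffZ !mcoeffX -E.
exact: etrans (rmorphM _ _ _) (congr1 _ (rmorph_nat _ _)).
Qed.

Lemma quartic_of_homog u : quartic_of u \is 4.-homog.
Proof. by rewrite quartic_ofE; exact: form_of_coefs_homog. Qed.

Lemma quartic_of_bar (f : {mpoly C[3]}) : f \is 4.-homog -> quartic_of (fun k => bar f k 0) = f.
Proof.
move=> hf; rewrite quartic_ofE {2}(mpoly_exps hf) big_exp4; apply: eq_bigr => k _.
rewrite !mxE /multinomial; congr (_ *: _); field.
rewrite !pnatr_eq0 /= -lt0n; apply: prodn_gt0 => i; exact: fact_gt0.
Qed.

Lemma map_mderiv (R S : comNzRingType) (h : {rmorphism R -> S}) (p : {mpoly R[3]}) i :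
  map_mpoly h p^`M(i) = (map_mpoly h p)^`M(i).
Proof.
by apply/mpolyP => m; rewrite mcoeff_map_mpoly !mcoeff_deriv mcoeff_map_mpoly raddfMn.
Qed.

Lemma mderiv_homog (f : {mpoly C[3]}) i : f \is 4.-homog -> f^`M(i) \is 3.-homog.
Proof.
move=> hf; apply/dhomogP => m; rewrite mcoeff_msupp mcoeff_deriv => m0.
have : (m + U_(i))%MM \in msupp f.
  by rewrite mcoeff_msupp; apply: contra m0 => /eqP ->; rewrite mul0rn.
by move/(dhomogP _ _ _ hf) => /=; rewrite mdegD mdeg1 addn1 => -[].
Qed.

Lemma mderiv_exp4 (p : {mpoly C[3]}) i : (p ^+ 4)^`M(i) = 4%:R * p ^+ 3 * p^`M(i).
Proof. rewrite !exprS expr0 mulr1 !mderivM; ring. Qed.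

Lemma mderiv_var i j : ('X_j : {mpoly C[3]})^`M(i) = (i == j)%:R.
Proof.
rewrite mderivX mnm1E eq_sym; case: eqP => [->|_]; last by rewrite scale0r.
rewrite (_ : (U_(j) - U_(j) = 0)%MM); last by apply/mnmP => k; rewrite mnmBE subnn mnm0E.
by rewrite mpolyX0 scale1r.
Qed.

Let X (i : 'I_3) : {mpoly C[3]} := 'X_i.

Lemma mpolyX_3 m : 'X_[m] = X 0 ^+ m 0 * X 1 ^+ m 1 * X 2 ^+ m 2.
Proof. by rewrite (mpolyXE_id _ m) prod3. Qed.

Lemma shifted_fermat_partials : [/\ (shifted_fermat C)^`M(0) = 4%:R * (X 0 + X 2) ^+ 3,
  (shifted_fermat C)^`M(1) = 4%:R * (X 1 + X 2) ^+ 3 &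
  (shifted_fermat C)^`M(2) = 4%:R * ((X 0 + X 2) ^+ 3 + (X 1 + X 2) ^+ 3 + X 2 ^+ 3)].
Proof.
by rewrite /shifted_fermat !mderivD !mderiv_exp4 !mderivD !mderiv_var /X; split=> /=; ring.
Qed.

Lemma in_ideal_natl n (F : 'I_3 -> {mpoly C[3]}) p : (0 < n)%N ->
  in_ideal F (n%:R * p) -> in_ideal F p.
Proof.
move=> n0 /(in_ideal_mul (n%:R^-1)%:MP); rewrite mulrA (_ : _ * n%:R = 1) ?mul1r //.
by rewrite -(rmorph_nat (@mpolyC 3 C)) -mpolyCM mulVf // pnatr_eq0 -lt0n.
Qed.

Lemma open_smooth : exists2 P : A, P.@[fun k => bar (shifted_fermat C) k 0] != 0 &
  forall u, P.@[u] != 0 -> smooth (quartic_of u).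
Proof.
(* The ideal of the partials contains the cubes of three linear forms spanning all linear forms. A
   product of 7 = 2 + 2 + 2 + 1 of these forms contains one of the cubes. *)
have [|m m7|P P0 HP] := @open_no_common_zero C (fun i => generic_quartic^`M(i)) (fun=> 3%N) 7
  (fun k => bar (shifted_fermat C) k 0).
- by move=> u i; rewrite map_mderiv; apply: mderiv_homog; exact: quartic_of_homog.
- pose F i := (shifted_fermat C)^`M(i).
  suff [B E] : in_ideal F 'X_[m].
    exists B; rewrite {1}E; apply: eq_bigr => i _.
    by rewrite map_mderiv -/(quartic_of _) (quartic_of_bar (shifted_fermat_homog C)).
  have [F0 F1 F2] := shifted_fermat_partials.
  have Iu : in_ideal F ((X 0 + X 2) ^+ 3) by apply: (@in_ideal_natl 4) => //; rewrite -F0; exact: in_ideal_gen.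
  have Iv : in_ideal F ((X 1 + X 2) ^+ 3) by apply: (@in_ideal_natl 4) => //; rewrite -F1; exact: in_ideal_gen.
  have Iw : in_ideal F (X 2 ^+ 3).
    have -> : X 2 ^+ 3 = ((X 0 + X 2) ^+ 3 + (X 1 + X 2) ^+ 3 + X 2 ^+ 3)
        + (-1) * (X 0 + X 2) ^+ 3 + (-1) * (X 1 + X 2) ^+ 3 by ring.
    apply: in_ideal_add; last exact: in_ideal_mul.
    apply: in_ideal_add; last exact: in_ideal_mul.
    by apply: (@in_ideal_natl 4) => //; rewrite -F2; exact: in_ideal_gen.
  have := @in_shifted_power _ (X 0 + X 2) (X 1 + X 2) (X 2) 7 (in_ideal F)
    (@in_ideal_add _ F) (@in_ideal_mul _ F) _ (m 0) (m 1) (m 2).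
  rewrite !addrK -mpolyX_3; apply; last by rewrite -m7 mdegE sum3.
  move=> i j k ijk; have [i3|i3] := leqP 3 i.
    rewrite -(subnK i3) exprD (_ : _ * _ * _ = (X 0 + X 2) ^+ (i - 3) * (X 1 + X 2) ^+ j * X 2 ^+ k
      * (X 0 + X 2) ^+ 3); [exact: in_ideal_mul | ring].
  have [j3|j3] := leqP 3 j.
    rewrite -(subnK j3) exprD (_ : _ * _ * _ = (X 0 + X 2) ^+ i * (X 1 + X 2) ^+ (j - 3) * X 2 ^+ k
      * (X 1 + X 2) ^+ 3); [exact: in_ideal_mul | ring].
  have k3 : (3 <= k)%N by lia.
  by rewrite -(subnK k3) exprD mulrA; exact: in_ideal_mul.
exists P => // u /HP {}HP v v0.
have [i vi] := rV3_neq0 v0.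
have [|j] := HP (v 0); first by exists i.
by rewrite map_mderiv => Hj; exists j.
Qed.

Section PencilForms.
Variable R : comNzRingType.

(** [pencil_coef] with indeterminates for (u, v) and over any coefficient ring, so that it can be
    specialised from the generic quartic. The exponent is left unsimplified to agree literally with
    [chart_coefs]. *)
Definition pencil_form (f : {mpoly R[3]}) k : {mpoly R[3]} :=
  \sum_(j < k.+1) f@_(mnm3 (4 - (4 - k) - j) j (4 - k)) *: ('X_0 ^+ (k - j) * 'X_1 ^+ j).

(** The obstructions are binary forms; adding ['X_2] makes their common zeros on the line X_2 = 0
    the common zeros of three ternary forms, as [open_no_common_zero] expects. *)
Definition vertical_forms (f : {mpoly R[3]}) (i : 'I_3) : {mpoly R[3]} :=
  nth 0 [:: square_obstruction3 (pencil_form f); square_obstruction4 (pencil_form f); 'X_2] i.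

End PencilForms.

Lemma map_mpoly_scale (R S : comNzRingType) (h : {rmorphism R -> S}) c (p : {mpoly R[3]}) :
  map_mpoly h (c *: p) = h c *: map_mpoly h p.
Proof. by apply/mpolyP => m; rewrite mcoeff_map_mpoly !mcoeffZ mcoeff_map_mpoly; exact: rmorphM. Qed.

Lemma map_mpoly_var (R S : comNzRingType) (h : {rmorphism R -> S}) i :
  map_mpoly h ('X_i : {mpoly R[3]}) = 'X_i.
Proof. by apply/mpolyP => m; rewrite mcoeff_map_mpoly !mcoeffX; exact: rmorph_nat. Qed.

Lemma map_pencil_form (R S : comNzRingType) (h : {rmorphism R -> S}) (f : {mpoly R[3]}) k :
  map_mpoly h (pencil_form f k) = pencil_form (map_mpoly h f) k.
Proof.
rewrite /pencil_form raddf_sum; apply: eq_bigr => j _ /=.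
by rewrite map_mpoly_scale mcoeff_map_mpoly rmorphM !rmorphXn /= !map_mpoly_var.
Qed.

Lemma map_vertical_forms (R S : comNzRingType) (h : {rmorphism R -> S}) (f : {mpoly R[3]}) i :
  map_mpoly h (vertical_forms f i) = vertical_forms (map_mpoly h f) i.
Proof.
move: i; apply: ord3P; rewrite /vertical_forms /=; last exact: map_mpoly_var.
  rewrite /square_obstruction3 !(rmorphB, rmorphM, rmorphXn, rmorph_nat) /=.
  by rewrite !map_pencil_form.
rewrite /square_obstruction4 !(rmorphB, rmorphM, rmorphXn, rmorph_nat) /=.
by rewrite !map_pencil_form.
Qed.

Lemma meval_pencil_form (f : {mpoly C[3]}) (v : 'I_3 -> C) k :
  (pencil_form f k).@[v] = pencil_coef (chart_coefs f) (v 0) (v 1) k.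
Proof.
rewrite /pencil_form raddf_sum; apply: eq_bigr => j _ /=.
by rewrite mevalZ rmorphM !rmorphXn /= !mevalXU mulrA.
Qed.

Lemma meval_vertical_forms (f : {mpoly C[3]}) (v : 'I_3 -> C) :
  let phi := pencil_coef (chart_coefs f) (v 0) (v 1) in
  [/\ (vertical_forms f 0).@[v] = square_obstruction3 phi,
      (vertical_forms f 1).@[v] = square_obstruction4 phi & (vertical_forms f 2).@[v] = v 2].
Proof.
rewrite /vertical_forms /= mevalXU /square_obstruction3 /square_obstruction4.
by split=> //; rewrite !(rmorphB, rmorphM, rmorphXn, rmorph_nat) /= !meval_pencil_form.
Qed.

Definition vertical_degree (i : 'I_3) : nat := nth 0%N [:: 3; 4; 1]%N i.

Lemma vertical_forms_homog (f : {mpoly C[3]}) i :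
  vertical_forms f i \is (vertical_degree i).-homog.
Proof.
have hX (j : 'I_3) : ('X_j : {mpoly C[3]}) \is 1.-homog by rewrite dhomogX; apply/eqP; exact: mdeg1.
have hp k : pencil_form f k \is k.-homog.
  apply: rpred_sum => j _; apply: rpredZ.
  have := dhomogM (dhomogMn (k - j) (hX 0)) (dhomogMn j (hX 1)).
  by rewrite !mul1n subnK // -ltnS.
have hn n : (n%:R : {mpoly C[3]}) \is 0.-homog by rewrite rpredMn ?dhomog1.
have hD : 4 * pencil_form f 0 * pencil_form f 2 - pencil_form f 1 ^+ 2 \is 2.-homog.
  apply: rpredB; last exact: (dhomogMn 2 (hp 1%N)).
  exact: (dhomogM (dhomogM (hn 4%N) (hp 0%N)) (hp 2%N)).
move: i; apply: ord3P; rewrite /vertical_forms /vertical_degree /=; last exact: hX.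
  apply: rpredB; last exact: (dhomogM (hp 1%N) hD).
  exact: (dhomogM (dhomogM (hn 8%N) (dhomogMn 2 (hp 0%N))) (hp 3%N)).
apply: rpredB; last exact: (dhomogMn 2 hD).
exact: (dhomogM (dhomogM (hn 64%N) (dhomogMn 3 (hp 0%N))) (hp 4%N)).
Qed.

Lemma shifted_fermat_pencil (u v : C) (phi := pencil_coef (chart_coefs (shifted_fermat C)) u v) :
  [/\ phi 0%N = 3, phi 1%N = 4 * (u + v), phi 2%N = 6 * (u ^+ 2 + v ^+ 2),
      phi 3%N = 4 * (u ^+ 3 + v ^+ 3) & phi 4%N = u ^+ 4 + v ^+ 4].
Proof.
have E : chart_restr (chart_coefs (shifted_fermat C)) (u *: 'X) (v *: 'X) =
    Poly [:: 3; 4 * (u + v); 6 * (u ^+ 2 + v ^+ 2); 4 * (u ^+ 3 + v ^+ 3); u ^+ 4 + v ^+ 4].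
  apply: (@poly_fun_eq _ _ _ 1); first exact: oner_neq0.
  move=> t _; rewrite chart_restr_horner ?shifted_fermat_homog //.
  rewrite meval_shifted_fermat !vec3E !hornerZ !hornerX horner_Poly /=; ring.
by rewrite /phi -!chart_restr_monomial // E !coef_Poly.
Qed.

Lemma open_no_vertical : exists2 P : A, P.@[fun k => bar (shifted_fermat C) k 0] != 0 &
  forall u, P.@[u] != 0 -> forall a b : C, (a, b) != (0, 0) ->
    let phi := pencil_coef (chart_coefs (quartic_of u)) a b in
    square_obstruction3 phi != 0 \/ square_obstruction4 phi != 0.
Proof.
(* The ideal contains X_0^6, X_1^6 and X_2, and a monomial of degree 11 = 5 + 5 + 1 is divisible by
   one of them. *)
have [|m m11|P P0 HP] := @open_no_common_zero C (vertical_forms generic_quartic) vertical_degree 11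
  (fun k => bar (shifted_fermat C) k 0).
- by move=> u i; rewrite map_vertical_forms; exact: vertical_forms_homog.
- pose F := vertical_forms (shifted_fermat C).
  suff [B E] : in_ideal F 'X_[m].
    exists B; rewrite {1}E; apply: eq_bigr => i _.
    by rewrite map_vertical_forms -/(quartic_of _) (quartic_of_bar (shifted_fermat_homog C)).
  pose e3 : {mpoly C[3]} := 2 * X 0 ^+ 3 - 3 * X 0 ^+ 2 * X 1 - 3 * X 0 * X 1 ^+ 2 + 2 * X 1 ^+ 3.
  pose e4 : {mpoly C[3]} := 11 * X 0 ^+ 4 - 28 * X 0 ^+ 3 * X 1 + 57 * X 0 ^+ 2 * X 1 ^+ 2
    - 28 * X 0 * X 1 ^+ 3 + 11 * X 1 ^+ 4.
  have mevalXn (v : 'I_3 -> C) (p : {mpoly C[3]}) n : (p ^+ n).@[v] = p.@[v] ^+ n.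
    exact: rmorphXn.
  have mevaln (v : 'I_3 -> C) n : (n%:R : {mpoly C[3]}).@[v] = n%:R by exact: rmorph_nat.
  have F0 : F 0 = 32%:R * e3.
    apply: mpoly3_eval_eq => v; have [-> _ _] := meval_vertical_forms (shifted_fermat C) (v 0).
    have [p0 p1 p2 p3 p4] := shifted_fermat_pencil (v 0 0) (v 0 1).
    rewrite /square_obstruction3 p0 p1 p2 p3 /e3 /X.
    by rewrite !(mevaln, mevalXn, mevalM, mevalB, mevalD) !mevalXU; ring.
  have F1 : (-1) * F 1 = 128%:R * e4.
    apply: mpoly3_eval_eq => v; rewrite mulN1r mevalN.
    have [_ -> _] := meval_vertical_forms (shifted_fermat C) (v 0).
    have [p0 p1 p2 p3 p4] := shifted_fermat_pencil (v 0 0) (v 0 1).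
    rewrite /square_obstruction4 p0 p1 p2 p4 /e4 /X.
    by rewrite !(mevaln, mevalXn, mevalM, mevalB, mevalD) !mevalXU; ring.
  have F2 : F 2 = X 2 by [].
  have I3 : in_ideal F e3.
    by apply: (@in_ideal_natl 32) => //; rewrite -F0; exact: in_ideal_gen.
  have I4 : in_ideal F e4.
    by apply: (@in_ideal_natl 128) => //; rewrite -F1; apply: in_ideal_mul; exact: in_ideal_gen.
  have IX : in_ideal F (X 2) by rewrite -F2; exact: in_ideal_gen.
  have bezout (x y : {mpoly C[3]}) : 
      e3 = 2 * x ^+ 3 - 3 * x ^+ 2 * y - 3 * x * y ^+ 2 + 2 * y ^+ 3 ->
      e4 = 11 * x ^+ 4 - 28 * x ^+ 3 * y + 57 * x ^+ 2 * y ^+ 2 - 28 * x * y ^+ 3 + 11 * y ^+ 4 ->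
      in_ideal F (x ^+ 6).
    (* A Bezout identity for the coprime binary forms [e3] and [e4], with denominators cleared by
       405. Both forms are symmetric, so it serves for either variable. *)
    move=> E3 E4; apply: (@in_ideal_natl 405) => //.
    have -> : 405%:R * x ^+ 6 =
        (- 34%:R * x ^+ 3 + 441%:R * x ^+ 2 * y - 225%:R * x * y ^+ 2 + 110%:R * y ^+ 3) * e3
        + (43%:R * x ^+ 2 + 20%:R * x * y - 20%:R * y ^+ 2) * e4.
      by rewrite E3 E4; ring.
    by apply: in_ideal_add; exact: in_ideal_mul.
  have I0 : in_ideal F (X 0 ^+ 6) by apply: (bezout _ (X 1)).
  have I1 : in_ideal F (X 1 ^+ 6) by apply: (bezout _ (X 0)); rewrite /e3 /e4; ring.
  rewrite mpolyX_3; have mE : (m 0%R + m 1%R + m 2%R = 11)%N by rewrite -m11 mdegE sum3.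
  move: (m 0) (m 1) (m 2) mE => i j [|k] ijk; last by rewrite exprSr mulrA; exact: in_ideal_mul.
  have [i6|i6] := leqP 6 i.
    rewrite -(subnK i6) exprD (_ : _ * _ * _ = X 0 ^+ (i - 6) * X 1 ^+ j * X 2 ^+ 0 * X 0 ^+ 6);
      [exact: in_ideal_mul | ring].
  have j6 : (6 <= j)%N by lia.
  rewrite -(subnK j6) exprD (_ : _ * _ * _ = X 0 ^+ i * X 1 ^+ (j - 6) * X 2 ^+ 0 * X 1 ^+ 6);
    [exact: in_ideal_mul | ring].
exists P => // u /HP {}HP a b ab phi.
have [|i] := HP (vec3 a b 0 0).
  have [a0|a0] := eqVneq a 0; last by exists 0; rewrite vec3E.
  by exists 1; rewrite vec3E; apply: contra ab => /eqP ->; rewrite a0.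
rewrite map_vertical_forms -/(quartic_of u).
have := meval_vertical_forms (quartic_of u) (vec3 a b 0 0); rewrite !vec3E -/phi.
move=> [e0 e1 e2]; move: i; apply: ord3P; rewrite ?e0 ?e1 ?e2 ?eqxx //.
- by left.
- by right.
Qed.

Lemma open_nondegenerate : exists2 P : A, P.@[fun k => bar (shifted_fermat C) k 0] != 0 &
  forall u, P.@[u] != 0 ->
    smooth (quartic_of u) /\ no_vertical_square (chart_coefs (quartic_of u)).
Proof.
have [P P0 HP] := open_smooth; have [Q Q0 HQ] := open_no_vertical.
have c0 u : chart_coefs (quartic_of u) 4 0 = u 0.
  have -> : chart_coefs (quartic_of u) 4 0 = (quartic_of u)@_(exp4 0) by [].
  rewrite quartic_ofE mcoeff_form_of_coefs mxE /multinomial.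
  have -> : (\prod_i (exp4 0%R i)`! = 4`!)%N.
    exact: (prod_mnm3 (fun _ n => n`!) 0%N 0%N 4%N).
  by rewrite divff ?mul1r // pnatr_eq0.
(* In the enumeration [exps 4] index 0 is the monomial x_2^4, so the factor ['X_0] keeps the curve
   away from (0 : 0 : 1). *)
exists (P * Q * 'X_0).
  rewrite !mevalM mevalXU !mulf_neq0 //.
  have := c0 (fun k => bar (shifted_fermat C) k 0); rewrite quartic_of_bar ?shifted_fermat_homog // => <-.
  have [p0 _ _ _ _] := shifted_fermat_pencil 0 0.
  move: p0; rewrite /pencil_coef big_ord1 /= !expr0 !mulr1 => ->.
  by rewrite pnatr_eq0.
move=> u; rewrite !mevalM mevalXU !mulf_eq0 !negb_or => /andP[/andP[/HP sm /HQ nv] u0].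
by split=> //; split; [rewrite c0 | exact: nv].
Qed.

End GenericQuartic.

(** * Counting bitangents by counting zeros *)

Section Nondegenerate.
Variable C : numClosedFieldType.
Implicit Types f : {mpoly C[3]}.

Definition nondegenerate f := smooth f /\ no_vertical_square (chart_coefs f).

Lemma nondegenerateZ (c : C) f : c != 0 -> nondegenerate (c *: f) -> nondegenerate f.
Proof.
move=> c0 [sm [g0 nv]].
have cE k j : chart_coefs (c *: f) k j = c * chart_coefs f k j by exact: mcoeffZ.
have pE a b k : pencil_coef (chart_coefs (c *: f)) a b k = c * pencil_coef (chart_coefs f) a b k.
  by rewrite /pencil_coef mulr_sumr; apply: eq_bigr => j _; rewrite cE !mulrA.
split; [|split].
- move=> v v0; have [ i ] := sm v v0; rewrite mderivZ mevalZ mulf_eq0 negb_or => /andP[_ fi]; by exists i.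
- by move: g0; rewrite cE mulf_eq0 negb_or => /andP[].
move=> a b /nv; rewrite /square_obstruction3 /square_obstruction4 !pE => -[] H; [left|right].
  by apply: contra H => /eqP H; apply/eqP; rewrite -[RHS](mulr0 (c ^+ 3)) -H; ring.
by apply: contra H => /eqP H; apply/eqP; rewrite -[RHS](mulr0 (c ^+ 4)) -H; ring.
Qed.

(** A Zariski open set needs homogeneous equations, so a component of [P] that is nonzero at the
    Fermat quartic is used. Its nonvanishing at f makes some multiple of f nondegenerate, hence f
    itself. *)
Lemma nondegenerate_open : exists Q : {mpoly C[15]}, exists d,
  [/\ Q \is d.-homog, Q.@[fun k => bar (shifted_fermat C) k 0] != 0 &
      forall f, f \is 4.-homog -> Q.@[fun k => bar f k 0] != 0 -> nondegenerate f].
Proof.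
have [P P0 HP] := open_nondegenerate C; have [d Pd] := some_component P0.
exists (pihomog mdeg d P), d; split=> [||f hf] //; first exact: pihomogP.
move=> /component_scaling[c c0 /HP ndc]; apply: (nondegenerateZ c0).
suff <- : quartic_of (fun k => c * bar f k 0) = c *: f by [].
rewrite -{2}(quartic_of_bar hf) !quartic_ofE scaler_sumr; apply: eq_bigr => k _.
by rewrite scalerA !mxE; congr (_ *: _); ring.
Qed.

(** At least k zeros. An exact count is expressed by this property for 56 and its failure for 57,
    because only lower bounds are transported along paths. *)
Definition square_zeros f k := exists w : 'I_k -> 'rV[C]_5,
  injective w /\ forall i, square_defect (chart_coefs f) (w i) = 0.

Lemma square_zeros_seq f k (t : seq 'rV[C]_5) : uniq t -> size t = k ->
  (forall z, z \in t -> square_defect (chart_coefs f) z = 0) -> square_zeros f k.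
Proof.
move=> ut <- Ht; exists (fun i => nth 0 t i); split=> [i j /eqP|i].
  by rewrite nth_uniq // => /eqP/val_inj.
by apply: Ht; exact: mem_nth.
Qed.

Lemma count_bitangents f : f \is 4.-homog -> nondegenerate f ->
  square_zeros f 56 -> ~ square_zeros f 57 -> exactly_proj 28 (bitangent f).
Proof.
move=> hf [sm nv] [w [w_inj w0]] no57.
pose t := codom w; have ut : uniq t by rewrite map_inj_uniq ?enum_uniq.
have st : size t = 56%N by rewrite size_codom card_ord.
have tP z : z \in t <-> square_defect (chart_coefs f) z = 0.
  split=> [/codomP[i ->] //|z0]; apply: contraT => zt; case: no57.
  apply: (@square_zeros_seq f _ (z :: t)) => /=; rewrite ?zt ?ut ?st //.
  by move=> y; rewrite inE => /predU1P[->|/codomP[i ->]].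
pose line (z : 'rV[C]_5) := (z 0 0, z 0 1); pose s := undup (map line t).
have sP ab : ab \in s -> exists2 z, square_defect (chart_coefs f) z = 0 & line z = ab.
  by rewrite mem_undup => /mapP[z /tP z0 ->]; exists z.
have [t' [ut' st' t'P]] := zeros_of_lines hf sm (undup_uniq _ : uniq s) sP.
(* [t'] lists the same zeros as [t], two for each line of [s], so 56 is twice the number of
   lines. *)
have s28 : size s = 28%N.
  suff : size t' = size t by rewrite st st' -[56%N]/(2 * 28)%N => /eqP; rewrite eqn_pmul2l // => /eqP.
  apply/perm_size/uniq_perm => // z; apply/idP/idP => [/t'P[/tP]//|zt].
  by apply/t'P; split; [exact/tP | rewrite mem_undup; exact: map_f].
exists (fun i : 'I_28 => chart_line (nth (0, 0) s i).1 (nth (0, 0) s i).2).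
have in_s (i : 'I_28) : nth (0, 0) s i \in s by rewrite mem_nth ?s28.
split=> [i|i j|l /(bitangent_zero hf nv)[z z0 zl]].
- by have [z z0 <-] := sP _ (in_s i); exact: zero_bitangent.
- move=> /chart_line_inj; rewrite -!surjective_pairing => /eqP.
  by rewrite nth_uniq ?undup_uniq ?s28 // => /eqP/val_inj.
have zs : line z \in s by rewrite mem_undup; apply/map_f/tP.
have zi : (index (line z) s < 28)%N by rewrite -s28 index_mem.
by exists (Ordinal zi); rewrite nth_index.
Qed.

End Nondegenerate.

Lemma shifted_fermat_zeros (C : numClosedFieldType) : smooth (shifted_fermat C) ->
  square_zeros (shifted_fermat C) 56 /\ ~ square_zeros (shifted_fermat C) 57.
Proof.
move=> sm; have [t [ut st tP]] := zeros_of_lines (shifted_fermat_homog C) sm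
  (uniq_fermat_lines C) (@shifted_fermat_zero C).
rewrite size_fermat_lines in st; split.
  by apply: (square_zeros_seq ut st) => z /tP[].
move=> [w [w_inj w0]].
have : (size (codom w) <= size t)%N.
  apply: uniq_leq_size; first by rewrite map_inj_uniq ?enum_uniq.
  by move=> z /codomP[i ->]; apply/tP; split; [exact: w0 | exact: shifted_fermat_lines].
by rewrite size_codom card_ord st.
Qed.

(** * Paths of nondegenerate quartics and conclusion *)

Module QuarticPath.

Import boolp classical_sets topology normedtype derive.
Import numFieldNormedType.Exports.
Import Transport.
Local Open Scope classical_set_scope.
Local Open Scope ring_scope.

Section Path.
Variable R : realType.
Local Notation C := R[i].

(** The arcs s + i c s (1 - s), for real c, meet only at their ends. A root with real part other
    than 0 and 1 lies on at most one of them, for c = [bad x], and c is taken larger than all these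
    values. *)
Lemma path_avoiding_roots (p : {poly C}) : p.[0] != 0 -> p.[1] != 0 ->
  exists sigma : R -> C, [/\ ccontinuous sigma, sigma 0 = 0, sigma 1 = 1 &
    forall s, 0 <= s <= 1 -> p.[sigma s] != 0].
Proof.
move=> p0 p1; have [r pE] := closed_field_poly_normal p.
have lp : lead_coef p != 0 by rewrite lead_coef_eq0; apply: contraNneq p0 => ->; rewrite horner0.
have rootE x : (p.[x] == 0) = (x \in r).
  rewrite pE hornerZ mulf_eq0 (negbTE lp) /= horner_prod.
  elim: r {pE} => [|y r IH]; first by rewrite big_nil oner_eq0.
  by rewrite big_cons mulf_eq0 IH inE hornerXsubC subr_eq0.
pose bad (x : C) := complex.Im x / (complex.Re x * (1 - complex.Re x)).
pose c := 1 + \sum_(x <- r) `|bad x|.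
have badc x : x \in r -> bad x < c.
  move=> xr; rewrite /c (big_rem x) //=.
  apply: le_lt_trans (ler_norm _) _; rewrite addrCA ltrDl.
  by apply: ltr_wpDr => //; apply: sumr_ge0.
exists (fun s => Complex s (c * s * (1 - s))); split.
- split=> /=; first exact: continuous_id.
  apply: continuous_mul; last apply: continuous_add.
  - by apply: continuous_mul; [exact: cst_continuous | exact: continuous_id].
  - exact: cst_continuous.
  - by apply: continuous_opp; exact: continuous_id.
- by rewrite mulr0 mul0r.
- by rewrite subrr mulr0.
move=> s s01; rewrite rootE; apply/negP => sr.
(* At the ends [bad] divides by zero and says nothing; there the hypotheses at 0 and 1 are used. *)
have s0 : s != 0.
  by apply: contraTneq sr => ->; rewrite mulr0 mul0r -rootE.
have s1 : 1 - s != 0.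
  rewrite subr_eq0; apply: contraTneq sr => <-; by rewrite subrr mulr0 -rootE.
have := badc _ sr; rewrite /bad /= -mulrA mulfK ?ltxx //.
by rewrite mulf_neq0.
Qed.

Lemma square_zeros_path (Q : {mpoly C[15]}) (f f' : {mpoly C[3]}) k :
  (forall h, h \is 4.-homog -> Q.@[fun j => bar h j 0] != 0 -> nondegenerate h) ->
  f \is 4.-homog -> f' \is 4.-homog ->
  Q.@[fun j => bar f j 0] != 0 -> Q.@[fun j => bar f' j 0] != 0 ->
  square_zeros f k -> square_zeros f' k.
Proof.
move=> HQ hf hf' Qf Qf'.
pose u j := bar f j 0; pose v j := bar f' j 0 - bar f j 0.
(* The restriction of [Q] to the complex line through f and f'. It is nonzero at both, so a path
   from 0 to 1 avoiding its roots stays among nondegenerate quartics. *)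
pose p := mmap polyC (fun j => (u j)%:P + v j *: 'X) Q.
have pE t : p.[t] = Q.@[fun j => bar (f + t *: (f' - f)) j 0].
  rewrite line_restr_horner; apply: meval_eq => j.
  by rewrite /u /v !mxE mcoeffD mcoeffZ mcoeffB; ring.
have f0E : f + 0 *: (f' - f) = f by rewrite scale0r addr0.
have f1E : f + 1 *: (f' - f) = f' by rewrite scale1r addrC subrK.
have [||sigma [sc s0 s1 Hs]] := @path_avoiding_roots p; rewrite ?pE ?f0E ?f1E //.
pose F s := f + sigma s *: (f' - f).
have F0 : F 0 = f by rewrite /F s0.
have F1 : F 1 = f' by rewrite /F s1.
have ndF s : 0 <= s <= 1 -> nondegenerate (F s).
  move=> /Hs; rewrite pE; apply: HQ; apply: rpredD => //; apply: rpredZ; exact: rpredB.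
rewrite -{1}F0 -F1; apply: (@ChartTransport.chart_transport _ (fun s => chart_coefs (F s))).
- move=> i j; apply: (ccontinuous_ext
    (f := fun s => chart_coefs f i j + sigma s * chart_coefs (f' - f) i j)).
    by move=> s; rewrite /chart_coefs [in RHS]mcoeffD [in RHS]mcoeffZ.
  apply: ccontinuous_add; first exact: ccontinuous_cst.
  by apply: ccontinuous_mul => //; exact: ccontinuous_cst.
- by move=> s /ndF[].
move=> s z /ndF[sm _]; apply: smooth_slope_unit => //.
apply: rpredD => //; apply: rpredZ; exact: rpredB.
Qed.

End Path.

End QuarticPath.

Theorem theorem0p1 (R : realType) :
  exists U : {mpoly R[i][3]} -> Prop,
    [/\ zariski_open U,
        exists f, U f &
        forall f, U f ->
          [/\ exactly_proj 28 (bitangent f),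
              forall l q, bitangent_conic f l q ->
                singular_point (WM f) (conic_coefs q) &
              forall l l' q q',
                bitangent_conic f l q -> bitangent_conic f l' q' ->
                (proj_eq q q' <-> proj_eq l l')]].
Proof.
have [Q [d [hQ Q0 HQ]]] := nondegenerate_open R[i].
have hf0 := shifted_fermat_homog R[i].
exists (fun f => quartic f /\ Q.@[fun k => bar f k 0] != 0); split.
- exists (eq Q); split=> [_ <-|f]; first by exists d.
  by split=> [[qf Qf]|[qf [_ <- Qf]]]; split=> //; exists Q.
- exists (shifted_fermat R[i]); split=> //; split=> //.
  apply/eqP => f0; have [_ []] := HQ _ hf0 Q0.
  by rewrite /chart_coefs f0 mcoeff0 eqxx.
move=> f [[hf _] Qf]; have [sm _] := HQ _ hf Qf.
split.
(* 56 zeros are carried from the Fermat quartic to f. A 57th zero of f would be carried back to the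
   Fermat quartic, which has only 56. *)
- have [Z56 Z57] := shifted_fermat_zeros (HQ _ hf0 Q0).1.
  apply: (count_bitangents hf (HQ _ hf Qf)).
    exact: (QuarticPath.square_zeros_path HQ hf0 hf Q0 Qf).
  by move/(QuarticPath.square_zeros_path HQ hf hf0 Qf Q0).
- by move=> l q [p [p' [/(bitangent_atP hf) S ->]]]; exact: WM_singular hf _ _ _ S.
move=> l l' q q' [p [p' [/(bitangent_atP hf) S ->]]] [p1 [p1' [/(bitangent_atP hf) S1 ->]]].
split; first exact: (same_conic_same_line hf sm S S1).
exact: (same_line_same_conic hf S S1).
Qed.
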